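(* Let $\alpha\in(0,1)$, $p,q\in[1,\infty)$, $\lambda\in[-n/p,1)$, $\mu\in[-n/q,1)$ and $\lambda+\alpha=\mu$. Let $u\in(0,\infty]$, $\Theta\in\Theta_*$, and let $$w(r)=r^{-\sigma}\Theta(r^{\tau}),\qquad \sigma,\tau\in(0,\infty)\ \text{with}\ \sigma>\tau.$$ Assume that $\sigma+\lambda+\alpha<1$. Assume also that $p$ and $q$ satisfy one of the following conditions: (i) $p=1$ and $1\le q<n/(n-\alpha)$; (ii) $1<p<n/\alpha$ and $1\le q\le pn/(n-p\alpha)$; (iii) $n/\alpha\le p<\infty$ and $1\le q<\infty$ (in this case, $0\le\mu<1$). Then $\tilde I_\alpha$ is bounded from $B_w^u(\mathcal L_{p,\lambda})(\mathbb R^n)$ to $B_w^u(\mathcal L_{q,\mu})(\mathbb R^n)$ and from $\dot B_w^u(\mathcal L_{p,\lambda})(\mathbb R^n)$ to $\dot B_w^u(\mathcal L_{q,\mu})(\mathbb R^n)$.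
   Context: For $r>0$, $Q_r\subset\mathbb R^n$ is the open cube $\{y:\max_i|y_i|<r\}$ (for all $r$), or the open ball $\{y:|y|<r\}$ (for all $r$); $Q(x,s)=x+Q_s$; $\chi_1$ is the characteristic function of $Q_1$; $f_G=\frac1{|G|}\int_G f$. For $U=\mathbb R^n$ or $U=Q_r$, the Campanato space $\mathcal L_{p,\lambda}(U)$ consists of all $f$ with $\|f\|_{\mathcal L_{p,\lambda}(U)}=\sup_{Q(x,s)\subset U}s^{-\lambda}\big(\frac1{|Q(x,s)|}\int_{Q(x,s)}|f-f_{Q(x,s)}|^p\big)^{1/p}<\infty$, regarded as a space of functions modulo constants. For $E=\mathcal L_{p,\lambda}$, $w:(0,\infty)\to(0,\infty)$ and $u\in(0,\infty]$, $B_w^u(E)(\mathbb R^n)$ and $\dot B_w^u(E)(\mathbb R^n)$ are the sets of measurable $f$ on $\mathbb R^n$ with $f|_{Q_r}\in E(Q_r)$ for all $r>0$ and, respectively, $\|f\|_{B_w^u(E)}=\big\|w(r)\|f\|_{E(Q_r)}\big\|_{L^u([1,\infty),dr/r)}<\infty$, $\|f\|_{\dot B_w^u(E)}=\big\|w(r)\|f\|_{E(Q_r)}\big\|_{L^u((0,\infty),dr/r)}<\infty$. $\Theta_*$ is the set of functions $\Theta:(0,\infty)\to(0,\infty)$ such that for some $C\in(0,\infty)$ and $\epsilon,\epsilon'\in(0,1)$, $\Theta(tr)/\Theta(r)\le C\max(t^{\epsilon},t^{\epsilon'})$ for all $r,t>0$. The modified fractional integral operator is $\tilde I_\alpha f(x)=\int_{\mathbb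 R^n}f(y)\Big(\frac1{|x-y|^{n-\alpha}}-\frac{1-\chi_1(y)}{|y|^{n-\alpha}}\Big)\,dy$. *)

(* Defs.v *)
From HB Require Import structures.
From mathcomp Require Import all_boot all_order all_algebra.
From mathcomp Require Import all_classical all_reals all_analysis.
From mathcomp Require Import measurable_realfun.

Set Implicit Arguments.
Unset Strict Implicit.
Unset Printing Implicit Defensive.
Import Order.TTheory GRing.Theory Num.Theory.
Import numFieldNormedType.Exports.
Local Open Scope classical_set_scope.
Local Open Scope ring_scope.

Definition measure_rV_display : measure_display -> measure_display.
Proof. exact. Qed.

(* ['rV_n] carries the sigma-algebra generated by the coordinates; for real
   entries this is the Borel sigma-algebra of R^n. *)
Section measurable_rV.
Context d (T : measurableType d) (n : nat).

Let coors (i : 'I_n) (v : 'rV[T]_n) : T := v ord0 i.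

Let rV_set0 : g_sigma_preimage coors set0.
Proof. exact: sigma_algebra0. Qed.

Let rV_setC A : g_sigma_preimage coors A -> g_sigma_preimage coors (~` A).
Proof. exact: sigma_algebraC. Qed.

Let rV_bigcup (F : (set 'rV[T]_n)^nat) :
  (forall i, g_sigma_preimage coors (F i)) ->
  g_sigma_preimage coors (\bigcup_i (F i)).
Proof. exact: sigma_algebra_bigcup. Qed.

HB.instance Definition _ := @isMeasurable.Build (measure_rV_display d)
  'rV[T]_n (g_sigma_preimage coors) rV_set0 rV_setC rV_bigcup.

Lemma measurable_coord (i : 'I_n) :
  measurable_fun [set: 'rV[T]_n] (fun v => v ord0 i).
Proof.
move=> _ Y mY; rewrite setTI; apply: sub_sigma_algebra => /=.
rewrite -bigcup_seq/=; exists i => /=; first by rewrite mem_index_enum.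
by exists Y => //; rewrite setTI.
Qed.

Lemma measurable_fun_rV d1 (T1 : measurableType d1) (f : T1 -> 'rV[T]_n) :
  (forall i, measurable_fun [set: T1] (fun x => f x ord0 i)) ->
  measurable_fun [set: T1] f.
Proof.
move=> mf _ A mA; rewrite setTI.
suff : g_sigma_preimage (fun i x => f x ord0 i) `<=` measurable.
  apply; rewrite (g_sigma_preimage_comp coors f).
  by exists A => //; rewrite setTI.
apply: smallest_sub; first exact: sigma_algebra_measurable.
rewrite -bigcup_seq/= => B [i _ [Y mY <-]].
exact: mf.
Qed.

End measurable_rV.

Section lebesgue_measure_rV.
Context {R : realType}.

Definition rV_cons n (xv : R * 'rV[R]_n) : 'rV[R]_n.+1 :=
  \row_i if unlift ord0 i is Some j then xv.2 ord0 j else xv.1.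

Definition rV_uncons n (v : 'rV[R]_n.+1) : R * 'rV[R]_n :=
  (v ord0 ord0, \row_j v ord0 (lift ord0 j)).

Lemma rV_consK n : cancel (@rV_cons n) (@rV_uncons n).
Proof.
case=> x v; rewrite /rV_uncons !mxE unlift_none; congr pair.
by apply/rowP => j; rewrite !mxE liftK.
Qed.

Lemma rV_unconsK n : cancel (@rV_uncons n) (@rV_cons n).
Proof.
move=> v; apply/rowP => i; rewrite mxE.
by case: (unliftP ord0 i) => [j|] -> //=; rewrite mxE.
Qed.

Lemma measurable_rV_cons n : measurable_fun [set: R * 'rV[R]_n] (@rV_cons n).
Proof.
apply: measurable_fun_rV => i; under eq_fun do rewrite mxE.
case: (unlift ord0 i) => [j|]; last exact: measurable_fst.
exact: measurableT_comp (@measurable_coord _ R n j) measurable_snd.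
Qed.

Lemma measurable_rV_uncons n : measurable_fun [set: 'rV[R]_n.+1] (@rV_uncons n).
Proof.
apply/measurable_fun_pairP; split; first exact: measurable_coord.
apply: measurable_fun_rV => i /=; under eq_fun do rewrite mxE.
exact: measurable_coord.
Qed.

Section step.
Context n (mu : {sigma_finite_measure set 'rV[R]_n -> \bar R}).

Definition lebesgue_rV_step : set 'rV[R]_n.+1 -> \bar R :=
  pushforward (lebesgue_measure \x mu)%E (@rV_cons n).

HB.instance Definition _ := Measure.copy lebesgue_rV_step
  (measure_function_pushforward__canonical__measure_function_Measure
    (lebesgue_measure \x mu)%E (@measurable_rV_cons n)).

Let step_sigma_finite : sigma_finite setT lebesgue_rV_step.
Proof.
have /sigma_finiteP[F [FT ndF Foo]] := sigma_finiteT (@lebesgue_measure R).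
have /sigma_finiteP[G [GT ndG Goo]] := sigma_finiteT mu.
exists (fun k => @rV_uncons n @^-1` (F k `*` G k)).
  rewrite -preimage_bigcup (_ : \bigcup_i _ = setT) ?preimage_setT//.
  rewrite -setXTT FT GT predeqE => -[x y]; split.
    by move=> [k _ []/= ? ?]; split; exists k.
  move=> [/= [i _ Fix] [k _ Gky]]; exists (maxn i k) => //; split.
  - by move: x Fix; exact/subsetPset/ndF/leq_maxl.
  - by move: y Gky; exact/subsetPset/ndG/leq_maxr.
move=> k; have [mF Fk] := Foo k; have [mG Gk] := Goo k; split.
  rewrite -[X in measurable X]setTI.
  by apply: measurable_rV_uncons => //; exact: measurableX.
rewrite /lebesgue_rV_step /pushforward -comp_preimage.
rewrite (_ : _ \o _ = id); last by apply/funext => x /=; rewrite rV_consK.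
by rewrite preimage_id product_measure1E// lte_mul_pinfty// ge0_fin_numE.
Qed.

HB.instance Definition _ := Measure_isSigmaFinite.Build _ _ _
  lebesgue_rV_step step_sigma_finite.

End step.

(* Lebesgue measure on R^n, as an iterated product. *)
Fixpoint lebesgue_rV n : {sigma_finite_measure set 'rV[R]_n -> \bar R} :=
  if n is m.+1 then lebesgue_rV_step (lebesgue_rV m) else \d_(0 : 'rV[R]_0).

Lemma lebesgue_rV_box n (A : 'I_n -> set R) :
  (forall i, measurable (A i)) ->
  lebesgue_rV n [set v | forall i, A i (v ord0 i)] =
  (\prod_(i < n) lebesgue_measure (A i))%E.
Proof.
elim: n A => [|n IHn] A mA.
  rewrite big_ord0 /= diracE mem_set//.
  by case.
rewrite big_ord_recl -(IHn (fun i => A (lift ord0 i)))//.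
rewrite -product_measure1E//; first last.
- rewrite [X in measurable X](_ : _ = \bigcap_(i in [set: 'I_n])
      ((fun v : 'rV[R]_n => v ord0 i) @^-1` A (lift ord0 i))).
    apply: fin_bigcap_measurable => // i _.
    by rewrite -[X in measurable X]setTI; exact: measurable_coord.
  by apply/seteqP; split => [v vA i _|v vA i]; [exact: vA|exact: vA i I].
- exact: mA.
apply: (congr1 (product_measure1 lebesgue_measure (lebesgue_rV n))).
apply/seteqP; split => [[x v] /= xvA|[x v] /= [xA vA] i].
  split=> [|i]; first by have := xvA ord0; rewrite mxE unlift_none.
  by have := xvA (lift ord0 i); rewrite mxE liftK.
by rewrite mxE; case: (unliftP ord0 i) => [j|] ->.
Qed.

End lebesgue_measure_rV.

Section dr_over_r.
Context {R : realType}.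

(* The measure dr/r on (0, +oo), extended by zero to R. *)
Definition dr_over_r : set (measurableTypeR R) -> \bar R := fun V =>
  (\int[lebesgue_measure]_(r in V `&` `]0%R, +oo[) (r^-1)%:E)%E.

Let dr_over_r0 : dr_over_r set0 = 0%E.
Proof. by rewrite /dr_over_r set0I integral_set0. Qed.

Let dr_over_r_ge0 V : (0 <= dr_over_r V)%E.
Proof.
apply: integral_ge0 => r [_]/=; rewrite in_itv/= andbT => r0.
by rewrite lee_fin invr_ge0 ltW.
Qed.

Let dr_over_r_sigma_additive : semi_sigma_additive dr_over_r.
Proof.
move=> F mF tF mUF; rewrite /dr_over_r setI_bigcupl.
have ge0 k r : (F k `&` `]0, +oo[) r -> (0 <= (r^-1)%:E)%E.
  by move=> [_]/=; rewrite in_itv/= andbT => r0; rewrite lee_fin invr_ge0 ltW.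
rewrite ge0_integral_bigcup//=.
- apply: is_cvg_ereal_nneg_natsum_cond => i _ _; exact: dr_over_r_ge0.
- by move=> k; apply: measurableI => //; exact: measurable_itv.
- apply/measurable_EFinP; apply: (eq_measurable_fun (@powR R ^~ (-1))).
    move=> r; rewrite inE => -[i _ [_]]/=; rewrite in_itv/= andbT => r0.
    by rewrite powR_inv1// ltW.
  exact: (measurable_funTS (@measurable_powR R (-1))).
- by move=> r [i _]; exact: ge0.
- exact: trivIset_setIr.
Qed.

HB.instance Definition _ := isMeasure.Build _ _ _ dr_over_r
  dr_over_r0 dr_over_r_ge0 dr_over_r_sigma_additive.

End dr_over_r.

(* The sets Q_r are either all cubes (for the sup norm) or all Euclidean
   balls. *)
Inductive body := Cube | Ball.

Section spaces.
Context {R : realType} {n : nat}.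
Implicit Types (k : body) (x y : 'rV[R]_n) (U G : set 'rV[R]_n).
Implicit Types (f : 'rV[R]_n -> R) (w : R -> R) (u : \bar R) (J : set R).
Local Notation mu := (lebesgue_rV n).

Definition euclidean_norm x : R := Num.sqrt (\sum_(i < n) x ord0 i ^+ 2).

(* [`|x|] is the sup norm on ['rV_n]. *)
Definition body_norm k x : R := if k is Cube then `|x| else euclidean_norm x.

Definition Q k x (s : R) : set 'rV[R]_n := [set y | body_norm k (y - x) < s].

(* ['rV_n] carries the Borel sigma-algebra; being equal a.e. to a Borel function
   is Lebesgue measurability.  The integral of a nonnegative function is the
   supremum of the integrals of the Borel simple functions below it, so it is
   the Lebesgue integral for such functions as well. *)
Definition lebesgue_measurable f : Prop :=
  exists2 g : 'rV[R]_n -> R,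
    measurable_fun [set: 'rV[R]_n] g & \forall x \ae mu, f x = g x.

Definition average G f : R := (fine (mu G))^-1 * \int[mu]_(y in G) f y.

Definition oscillation (p : R) G f : \bar R :=
  (((fine (mu G))^-1)%:E * \int[mu]_(y in G) (`|f y - average G f| `^ p)%:E)
    `^ p^-1.

(* If f is not integrable on G then [average G f] is a junk real number, but
   [oscillation p G f] is then +oo for p >= 1: a measurable f with finite norm
   is in L^p(G) for every Q(x, s) = G contained in U. *)
Definition campanato_norm k (p lambda : R) U f : \bar R :=
  ereal_sup [set z | exists x (s : R), [/\ 0 < s, Q k x s `<=` U &
    z = ((s `^ (- lambda))%:E * oscillation p (Q k x s) f)%E]].

Definition campanato k (p lambda : R) U : set ('rV[R]_n -> R) :=
  [set f | (campanato_norm k p lambda U f < +oo)%E].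

(* J = [1, +oo[ gives the space B_w^u(L_{p,lambda}) and J = ]0, +oo[ gives its
   dotted version.  The function of r whose L^u(J, dr/r) norm is taken is
   nonnegative, so that it may be extended by zero outside J, also when
   u = +oo. *)
Definition B_norm k J w u (p lambda : R) f : \bar R :=
  ('N[dr_over_r]_u
    [(fun r => (w r)%:E * campanato_norm k p lambda (Q k 0%R r) f) \_ J])%E.

Definition B_space k J w u (p lambda : R) : set ('rV[R]_n -> R) :=
  [set f | [/\ lebesgue_measurable f,
    forall r : R, 0 < r -> campanato k p lambda (Q k 0 r) f &
    (B_norm k J w u p lambda f < +oo)%E]].

Definition fractional_kernel k (alpha : R) x y : R :=
  (euclidean_norm (x - y) `^ (n%:R - alpha))^-1
  - (1 - \1_(Q k 0 1) y) / euclidean_norm y `^ (n%:R - alpha).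

Definition fractional_integral k (alpha : R) f x : R :=
  \int[mu]_y (f y * fractional_kernel k alpha x y).

Definition fractional_integral_cvg k (alpha : R) f x : Prop :=
  (\int[mu]_y `|f y * fractional_kernel k alpha x y|%:E < +oo)%E.

(* The first conjunct says that the integral defining the operator converges
   absolutely at almost every point, i.e. that the operator is defined on the
   source space. *)
Definition fractional_integral_bounded k (alpha : R) J w u
    (p lambda q lambda' : R) : Prop :=
  exists2 C : R, 0 < C & forall f, B_space k J w u p lambda f ->
    [/\ \forall x \ae mu, fractional_integral_cvg k alpha f x,
        B_space k J w u q lambda' (fractional_integral k alpha f) &
        (B_norm k J w u q lambda' (fractional_integral k alpha f)
           <= C%:E * B_norm k J w u p lambda f)%E].

End spaces.

Definition Theta_star {R : realType} (Theta : R -> R) : Prop :=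
  (forall r : R, 0 < r -> 0 < Theta r) /\
  exists C e e' : R, [/\ 0 < C, 0 < e < 1, 0 < e' < 1 &
    forall r t : R, 0 < r -> 0 < t ->
      Theta (t * r) / Theta r <= C * Num.max (t `^ e) (t `^ e')].

(* Main.v *)
Require Import Defs.
From mathcomp Require Import all_boot all_order all_algebra.
From mathcomp Require Import all_classical all_reals all_analysis.
From mathcomp Require Import measurable_realfun ess_sup_inf ring lra.

(** Write [F] for the modified fractional integral of [f] and [N r] for the
Campanato norm of [f] on [Q_r].  Everything rests on a local estimate
[campanato_fractional_le]: the Campanato norm of [F] on [Q_r], with exponents
[q] and [lambda + alpha], is at most a constant times
[sum_i 2 ^ (i (lambda + alpha - 1)) * N (2 ^ (i + 1) r)].  It is then integrated
in [r] against the weight.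

The local estimate.  Let [G = Q(c, s)] be contained in [Q_r], let [m] be the
average of [f] on [2 G], and let [K v = |v| ^ (alpha - n)].  For [x], [z] in [G],
[F x - F z] is the integral of [f y * (K (x - y) - K (z - y))], and [f] may be
replaced by [f - m] because the reflection [y |-> x + z - y] exchanges the two
kernels, so that their difference has integral zero
([fractional_integral_increment]).

- Over [2 G] the two kernels are treated separately, as Riesz potentials of
  [|f - m|] restricted to [2 G].  The Hardy-Littlewood-Sobolev inequality
  [potential_Lq] bounds their L^q norm on [G], and [z] is chosen in [G] such that
  the potential at [z] is at most about its mean ([exists_good_point]).  If
  [p >= n / alpha], the inequality is used for a smaller exponent [p0]
  ([sobolev_pair_exists]).
- Outside [2 G] the difference of the kernels is [O(s |y - c| ^ (alpha - n - 1))],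
  while the mean of [|f - m|] on [2 ^ j G] is bounded by the sum of the
  oscillations of [f] on the [2 ^ i G] with [i <= j], since consecutive averages
  differ by at most an oscillation ([integral_chain]).  Summing over dyadic
  shells gives [far_bound].

The Hardy-Littlewood-Sobolev inequality is proved as by Hedberg: where the
maximal function of [h] is at most [t], the integral of [h] on a small cube of
radius [r] is [O(t r ^ n)], on a large one it is controlled by the L^p norm, and
the resulting dyadic sum is comparable to its largest term
([potential_pointwise]).  The maximal function enters only through its superlevel
sets, written as unions of rational cubes, for which the weak type (1,1) bound
follows from the finite Vitali covering argument ([cube_covering_bound]).

The weight.  [Theta] is almost increasing, hence [w r <= C T ^ sigma * w (T r)]
for [T >= 1], and [w] is comparable to a measurable weight [wt] with the same
property ([regular_weight]).  Therefore
[wt r * N (2 ^ (i + 1) r) <= C 2 ^ (i sigma) * (wt N) (2 ^ (i + 1) r)], and since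
[sigma + lambda + alpha < 1] the sum over [i] is still geometric after giving away
a factor [2 ^ (i d)]: it is [O(b)] as soon as [(wt N) (2 ^ (i + 1) r) <= 2 ^ (i d) b]
for all [i] ([weighted_tail_sum]).  One may take for [b ^ u] the sum of the
[2 ^ (- i d u) * (wt N) (2 ^ (i + 1) r) ^ u], whose integral against [dr / r] is
computed termwise by dilation invariance.  This works for every [u], also below
[1], where the triangle inequality fails ([norm_transfer]).  Both ranges of [r]
are covered because they are stable under [r |-> T r] for [T >= 1]. *)

Set Implicit Arguments.
Unset Strict Implicit.
Unset Printing Implicit Defensive.
Import Order.TTheory GRing.Theory Num.Theory.
Import numFieldNormedType.Exports.
Local Open Scope classical_set_scope.
Local Open Scope ring_scope.

(** * Cubes and balls *)

Section body_norm_theory.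
Context {R : realType} {n : nat}.
Implicit Types (k : body) (x y : 'rV[R]_n) (a : R).

Lemma ler_coord_norm x i : `|x ord0 i| <= `|x|.
Proof.
rewrite [leRHS]/Num.Def.normr /= mx_normrE; apply/bigmax_geP; right => /=.
by exists (ord0, i).
Qed.

Lemma rV_norm_ltP x a : 0 < a ->
  reflect (forall i, `|x ord0 i| < a) (`|x| < a).
Proof.
move=> a0; apply: (iffP idP) => [xa i|xa].
  exact: le_lt_trans (ler_coord_norm x i) xa.
rewrite [ltLHS]/Num.Def.normr /= mx_normrE; apply/bigmax_ltP; split => // -[i j] _ /=.
by rewrite ord1.
Qed.

Lemma rV_norm_leP x a : 0 <= a ->
  reflect (forall i, `|x ord0 i| <= a) (`|x| <= a).
Proof.
move=> a0; apply: (iffP idP) => [xa i|xa].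
  exact: le_trans (ler_coord_norm x i) xa.
rewrite [leLHS]/Num.Def.normr /= mx_normrE; apply/bigmax_leP; split => // -[i j] _ /=.
by rewrite ord1.
Qed.

Lemma euclidean_norm_ge0 x : 0 <= euclidean_norm x.
Proof. exact: sqrtr_ge0. Qed.

Lemma norm_le_euclidean x : `|x| <= euclidean_norm x.
Proof.
apply/rV_norm_leP; first exact: euclidean_norm_ge0.
move=> i; rewrite -sqrtr_sqr ler_wsqrtr// (bigD1 i)//= lerDl.
by apply: sumr_ge0 => j _; exact: sqr_ge0.
Qed.

Lemma euclidean_le_norm x : euclidean_norm x <= n%:R * `|x|.
Proof.
rewrite -[leRHS]ger0_norm ?mulr_ge0// -sqrtr_sqr ler_wsqrtr//.
apply: (@le_trans _ _ (\sum_(i < n) `|x| ^+ 2)).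
  apply: ler_sum => i _; rewrite -(real_normK (num_real (x ord0 i))).
  by rewrite lerXn2r ?nnegrE// ler_coord_norm.
rewrite sumr_const card_ord exprMn -[leLHS]mulr_natl ler_wpM2r ?sqr_ge0//.
by rewrite -natrX ler_nat -mulnn; case: (n) => // m; rewrite leq_pmulr.
Qed.

(** The polynomial [t |-> sum_i (x_i + t y_i) ^ 2] has no negative value. *)
Lemma cauchy_schwarz_rV x y :
  (\sum_(i < n) x ord0 i * y ord0 i) ^+ 2 <=
  (\sum_(i < n) x ord0 i ^+ 2) * (\sum_(i < n) y ord0 i ^+ 2).
Proof.
set A := \sum_(i < n) x ord0 i ^+ 2; set B := \sum_(i < n) y ord0 i ^+ 2.
set P := \sum_(i < n) _.
have H (t : R) : 0 <= A + 2 * t * P + t ^+ 2 * B.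
  have -> : A + 2 * t * P + t ^+ 2 * B =
      \sum_(i < n) (x ord0 i + t * y ord0 i) ^+ 2.
    rewrite /A /B /P !mulr_sumr -!big_split; apply: eq_bigr => i _ /=.
    by ring.
  by apply: sumr_ge0 => i _; exact: sqr_ge0.
have A0 : 0 <= A by apply: sumr_ge0 => i _; exact: sqr_ge0.
have : 0 <= B by apply: sumr_ge0 => i _; exact: sqr_ge0.
rewrite le_eqVlt => /predU1P[B0|B0].
  have := H (- (A + 1) / (2 * P)); rewrite -B0 !mulr0 addr0.
  have [->|P0] := eqVneq P 0; first by rewrite expr0n.
  rewrite (_ : A + _ = -1) ?ler0N1//.
  by field.
have := H (- P / B).
rewrite (_ : A + _ + _ = (A * B - P ^+ 2) / B); last first.
  by field; rewrite gt_eqF.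
by rewrite pmulr_lge0 ?invr_gt0// subr_ge0.
Qed.

Lemma ler_euclidean_normD x y :
  euclidean_norm (x + y) <= euclidean_norm x + euclidean_norm y.
Proof.
have := cauchy_schwarz_rV x y; rewrite /euclidean_norm.
set A := \sum_(i < n) x ord0 i ^+ 2; set B := \sum_(i < n) y ord0 i ^+ 2.
set P := \sum_(i < n) _ => PAB.
have A0 : 0 <= A by apply: sumr_ge0 => i _; exact: sqr_ge0.
have B0 : 0 <= B by apply: sumr_ge0 => i _; exact: sqr_ge0.
have -> : \sum_(i < n) (x + y) ord0 i ^+ 2 = A + 2 * P + B.
  rewrite /A /B /P mulr_sumr -!big_split; apply: eq_bigr => i _ /=.
  by rewrite mxE; ring.
rewrite -[leRHS]ger0_norm ?addr_ge0 ?sqrtr_ge0// -sqrtr_sqr ler_wsqrtr//.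
rewrite sqrrD !sqr_sqrtr// lerD2r lerD2l -[leRHS]mulr_natl ler_wpM2l//.
rewrite -sqrtrM// (le_trans (ler_norm _))// -sqrtr_sqr.
exact: ler_wsqrtr.
Qed.

Lemma euclidean_normZ a x : euclidean_norm (a *: x) = `|a| * euclidean_norm x.
Proof.
rewrite /euclidean_norm -sqrtr_sqr -sqrtrM ?sqr_ge0//; congr Num.sqrt.
by rewrite mulr_sumr; apply: eq_bigr => i _; rewrite mxE exprMn.
Qed.

Lemma euclidean_normN x : euclidean_norm (- x) = euclidean_norm x.
Proof. by rewrite -scaleN1r euclidean_normZ normrN1 mul1r. Qed.

Lemma body_norm_ge0 k x : 0 <= body_norm k x.
Proof. by case: k => //=; exact: euclidean_norm_ge0. Qed.

Lemma ler_body_normD k x y : body_norm k (x + y) <= body_norm k x + body_norm k y.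
Proof. by case: k => /=; [exact: ler_normD|exact: ler_euclidean_normD]. Qed.

Lemma body_normZ k a x : body_norm k (a *: x) = `|a| * body_norm k x.
Proof. by case: k => /=; [exact: normrZ|exact: euclidean_normZ]. Qed.

Lemma body_normN k x : body_norm k (- x) = body_norm k x.
Proof. by rewrite -scaleN1r body_normZ normrN1 mul1r. Qed.

Lemma body_norm_distC k x y : body_norm k (x - y) = body_norm k (y - x).
Proof. by rewrite -body_normN opprB. Qed.

Lemma body_norm0 k : body_norm k (0 : 'rV[R]_n) = 0.
Proof. by rewrite -(scale0r 0) body_normZ normr0 mul0r. Qed.

Lemma norm_le_body k x : `|x| <= body_norm k x.
Proof. by case: k => //=; exact: norm_le_euclidean. Qed.

Lemma body_le_euclidean k x : body_norm k x <= euclidean_norm x.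
Proof. by case: k => //=; exact: norm_le_euclidean. Qed.

Lemma body_le_norm k x : (0 < n)%N -> body_norm k x <= n%:R * `|x|.
Proof.
move=> n0; case: k => /=; last exact: euclidean_le_norm.
by rewrite ler_peMl// ler1n.
Qed.

Lemma euclidean_le_body k x : euclidean_norm x <= n%:R * body_norm k x.
Proof.
by rewrite (le_trans (euclidean_le_norm x))// ler_wpM2l// norm_le_body.
Qed.

Lemma body_norm_distD k x y z :
  body_norm k (x - z) <= body_norm k (x - y) + body_norm k (y - z).
Proof. by rewrite -(subrKA y) ler_body_normD. Qed.

End body_norm_theory.

Section body_sets.
Context {R : realType} {n : nat}.
Implicit Types (k : body) (x y : 'rV[R]_n) (s t : R).

Lemma QE k x s : Q k x s = [set y | body_norm k (y - x) < s].
Proof. by []. Qed.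

Lemma Q_center k x s : 0 < s -> Q k x s x.
Proof. by move=> s0; rewrite QE/= subrr body_norm0. Qed.

Lemma subset_Q k x y s t : body_norm k (x - y) + s <= t -> Q k x s `<=` Q k y t.
Proof.
move=> xyst z; rewrite !QE/= => zx.
rewrite (le_lt_trans (body_norm_distD k z x y))//.
by rewrite (lt_le_trans _ xyst)// addrC ltrD2l.
Qed.

Lemma le_Q k x s t : s <= t -> Q k x s `<=` Q k x t.
Proof. by move=> st; apply: subset_Q; rewrite subrr body_norm0 add0r. Qed.

Lemma Q_center_lt k x s r : 0 < s -> Q k x s `<=` Q k 0 r -> body_norm k x < r.
Proof. by move=> s0 /(_ x (Q_center _ _ s0)); rewrite QE/= subr0. Qed.

(** If [r < s], then [Q x s] contains [x + v] and [x - v] for [v] of norm [r].  They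
are at distance [2 r], which exceeds the distance of any two points of [Q 0 r]. *)
Lemma Q_radius_le k x s r : (0 < n)%N -> 0 < s -> Q k x s `<=` Q k 0 r -> s <= r.
Proof.
move=> n0 s0 xsr; rewrite leNgt; apply/negP => rs.
pose e : 'rV[R]_n := const_mx 1.
have e0 : 0 < body_norm k e.
  rewrite (lt_le_trans _ (norm_le_body k e))//.
  rewrite (lt_le_trans _ (ler_coord_norm e (Ordinal n0)))//.
  by rewrite mxE normr1.
have r0 : 0 < r.
  rewrite (le_lt_trans (body_norm_ge0 k x))//.
  by have := xsr _ (Q_center k x s0); rewrite QE/= subr0.
pose v := (r / body_norm k e) *: e.
have vr : body_norm k v = r.
  by rewrite body_normZ ger0_norm ?divr_ge0 ?ltW// divfK// gt_eqF.
have H1 : body_norm k (x + v) < r.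
  have := xsr (x + v); rewrite !QE/= addrAC subrr add0r subr0 vr; exact.
have H2 : body_norm k (x - v) < r.
  have := xsr (x - v); rewrite !QE/= addrAC subrr add0r subr0 body_normN vr; exact.
have : body_norm k ((x + v) - (x - v)) < r + r.
  by rewrite (le_lt_trans (ler_body_normD _ _ _))// body_normN ltrD.
rewrite opprB addrC addrA subrK -mulr2n -scaler_nat body_normZ vr ger0_norm//.
by rewrite mulr_natl mulr2n ltxx.
Qed.

End body_sets.

Section body_measure.
Context {R : realType} {n : nat}.
Implicit Types (k : body) (x y : 'rV[R]_n) (s t : R).
Local Notation mu := (lebesgue_rV n).

Lemma cube_box x s : 0 < s ->
  Q Cube x s = 
  [set y | forall i, `]x ord0 i - s, x ord0 i + s[%classic (y ord0 i)].
Proof.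
move=> s0; apply/seteqP; split => y; rewrite QE/=.
  move=> /(rV_norm_ltP _ s0) H i; have := H i.
  by rewrite !mxE in_itv/= distrC ltr_distlC.
move=> H; apply/(rV_norm_ltP _ s0) => i; have := H i.
by rewrite in_itv/= !mxE distrC ltr_distlC.
Qed.

Lemma measurable_box (A : 'I_n -> set R) : (forall i, measurable (A i)) ->
  measurable [set v : 'rV[R]_n | forall i, A i (v ord0 i)].
Proof.
move=> mA; rewrite [X in measurable X](_ : _ = \bigcap_(i in [set: 'I_n])
    ((fun v : 'rV[R]_n => v ord0 i) @^-1` A i)).
  apply: fin_bigcap_measurable => // i _.
  by rewrite -[X in measurable X]setTI; exact: measurable_coord.
by apply/seteqP; split => [v vA i _|v vA i]; [exact: vA|exact: vA i I].
Qed.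

Lemma measurable_cube x s : measurable (Q Cube x s).
Proof.
have [s0|s0] := ltP 0 s; last first.
  rewrite (_ : Q _ _ _ = set0)//; apply/seteqP; split => // y; rewrite QE/=.
  by rewrite ltNge (le_trans s0).
rewrite cube_box//; apply: (measurable_box (A := fun i => `]x ord0 i - s, x ord0 i + s[%classic)) => i.
exact: measurable_itv.
Qed.

Lemma lebesgue_cube x s : 0 < s -> mu (Q Cube x s) = ((2 * s) ^+ n)%:E.
Proof.
move=> s0; rewrite cube_box// (lebesgue_rV_box (A := fun i => `]x ord0 i - s, x ord0 i + s[%classic))//.
  rewrite (eq_bigr (fun=> (2 * s)%:E)).
    by rewrite prodEFin prodr_const card_ord.
  move=> i _; rewrite lebesgue_measure_itv/= lte_fin ltrBlDr -addrA ltrDl addr_gt0//.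
  by rewrite EFinN -EFinB; congr EFin; ring.
Qed.

Lemma measurable_euclidean_norm : measurable_fun [set: 'rV[R]_n] euclidean_norm.
Proof.
have ms : measurable_fun [set: R] (@Num.sqrt R).
  by apply: nondecreasing_measurable => // a b; exact: ler_wsqrtr.
apply: (measurableT_comp ms); apply: measurable_sum => i.
by apply: measurable_funX; exact: measurable_coord.
Qed.

Lemma measurable_rV_norm : measurable_fun [set: 'rV[R]_n] (fun x => `|x|).
Proof.
apply: (measurability (@RGenInftyO.G R)); first exact: RGenInftyO.measurableE.
move=> _ [_ [a ->] <-]; rewrite setTI.
have := measurable_cube 0 a; congr measurable.
by apply/seteqP; split => y; rewrite QE/= subr0 in_itv.
Qed.

Lemma measurable_body_norm k : measurable_fun [set: 'rV[R]_n] (body_norm k).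
Proof. by case: k; [exact: measurable_rV_norm|exact: measurable_euclidean_norm]. Qed.

Lemma measurable_fun_rVB (d : measure_display) (T : measurableType d)
    (f g : T -> 'rV[R]_n) :
  measurable_fun [set: T] f -> measurable_fun [set: T] g ->
  measurable_fun [set: T] (fun z => f z - g z).
Proof.
move=> mf mg; apply: measurable_fun_rV => i; under eq_fun do rewrite !mxE.
by apply: measurable_funB; apply: (measurableT_comp (measurable_coord i)).
Qed.

Lemma measurable_Q k x s : measurable (Q k x s).
Proof.
have m : measurable_fun [set: 'rV[R]_n] (fun y => body_norm k (y - x)).
  apply: (measurableT_comp (measurable_body_norm k)).
  by apply: measurable_fun_rVB => //; exact: measurable_cst.
rewrite -[Q k x s]setTI (_ : Q k x s = (fun y => body_norm k (y - x)) @^-1` `]-oo, s[).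
  by apply: m => //; exact: measurable_itv.
by apply/seteqP; split => y; rewrite QE/= in_itv.
Qed.

Lemma Q_sub_cube k x s : Q k x s `<=` Q Cube x s.
Proof. by move=> y; rewrite !QE/=; exact/le_lt_trans/norm_le_body. Qed.

Lemma lebesgue_Q_le k x s : 0 < s -> (mu (Q k x s) <= ((2 * s) ^+ n)%:E)%E.
Proof.
move=> s0; rewrite -(lebesgue_cube x s0) le_measure ?inE//; last exact: Q_sub_cube.
- exact: measurable_Q.
- exact: measurable_cube.
Qed.

(** [Q k x s] lies between the cubes of radius [s / n] and [s] around [x].  These
crude bounds stand in for the volume of the ball. *)
Lemma lebesgue_Q_ge k x s : (0 < n)%N -> 0 < s ->
  (((2 * (s / n%:R)) ^+ n)%:E <= mu (Q k x s))%E.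
Proof.
move=> n0 s0; have sn : 0 < s / n%:R by rewrite divr_gt0// ltr0n.
rewrite -(lebesgue_cube x sn) le_measure ?inE//.
- exact: measurable_cube.
- exact: measurable_Q.
move=> y; rewrite !QE/= => yx; rewrite (le_lt_trans (body_le_norm k _ n0))//.
by rewrite mulrC -ltr_pdivlMr// ltr0n.
Qed.

Lemma lebesgue_Q_fin k x s : 0 < s -> mu (Q k x s) \is a fin_num.
Proof.
move=> s0; rewrite ge0_fin_numE//.
by rewrite (le_lt_trans (lebesgue_Q_le k x s0))// ltry.
Qed.

Definition vol k x s : R := fine (mu (Q k x s)).

Lemma volE k x s : 0 < s -> mu (Q k x s) = (vol k x s)%:E.
Proof. by move=> s0; rewrite fineK// lebesgue_Q_fin. Qed.

Lemma vol_le k x s : 0 < s -> vol k x s <= 2 ^+ n * s ^+ n.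
Proof.
by move=> s0; rewrite -exprMn -lee_fin -volE//; exact: lebesgue_Q_le.
Qed.

Lemma vol_ge k x s : (0 < n)%N -> 0 < s -> (2 / n%:R) ^+ n * s ^+ n <= vol k x s.
Proof.
move=> n0 s0; rewrite -exprMn -lee_fin -volE// mulrAC -mulrA.
exact: lebesgue_Q_ge.
Qed.

Lemma vol_gt0 k x s : (0 < n)%N -> 0 < s -> 0 < vol k x s.
Proof.
move=> n0 s0; apply: lt_le_trans (vol_ge k x n0 s0).
by rewrite mulr_gt0// exprn_gt0// divr_gt0// ltr0n.
Qed.

End body_measure.

(** * Reflections preserve Lebesgue measure *)

Section reflection.
Context {R : realType}.

Lemma lebesgue_measure_reflect (a : R) (A : set R) : measurable A ->
  lebesgue_measure ((fun t => a - t) @^-1` A) = lebesgue_measure A.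
Proof.
move=> mA.
have mr : measurable_fun [set: measurableTypeR R] (fun t : measurableTypeR R => a - t : measurableTypeR R).
  by apply: measurable_funB => //; exact: measurable_cst.
rewrite -[LHS]/(pushforward lebesgue_measure (fun t : measurableTypeR R => a - t : measurableTypeR R) A).
apply/esym; apply: (@lebesgue_measure_unique R (measure_function_pushforward__canonical__measure_function_Measure lebesgue_measure mr)) => //= _ [[b c] /= _ <-].
rewrite /pushforward (_ : _ @^-1` _ = `[a - c, a - b[%classic); last first.
  apply/seteqP; split => x; rewrite /= !in_itv/= => /andP[H1 H2]; apply/andP; split; lra.
rewrite !lebesgue_measure_itv/= !lte_fin ltrD2l ltrN2.
by case: ifP => // _; rewrite -!EFinD; congr EFin; ring.
Qed.

Lemma measurable_reflect n (v : 'rV[R]_n) : measurable_fun [set: 'rV[R]_n] (fun y => v - y).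
Proof.
apply: measurable_fun_rV => i; under eq_fun do rewrite !mxE.
apply: measurable_funB; first exact: measurable_cst.
exact: measurable_coord.
Qed.

(** By induction on the dimension, from the uniqueness of product measures. *)
Lemma lebesgue_rV_reflect n (v : 'rV[R]_n) (A : set 'rV[R]_n) : measurable A ->
  lebesgue_rV n ((fun y => v - y) @^-1` A) = lebesgue_rV n A.
Proof.
elim: n v A => [|n IHn] v A mA.
  congr (lebesgue_rV 0 _); apply/seteqP; split => y /=; congr A; by apply/rowP => -[].
pose psi (z : measurableTypeR R * 'rV[R]_n) : measurableTypeR R * 'rV[R]_n :=
  (v ord0 ord0 - z.1, (rV_uncons v).2 - z.2).
have mpsi : measurable_fun [set: measurableTypeR R * 'rV[R]_n] psi.
  apply/measurable_fun_pairP; split => /=.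
    by apply: measurable_funB; [exact: measurable_cst|exact: measurable_fst].
  exact: measurableT_comp (measurable_reflect _) measurable_snd.
rewrite /= /lebesgue_rV_step /pushforward.
have -> : rV_cons (n:=n) @^-1` [set y | A (v - y)] = psi @^-1` (rV_cons (n:=n) @^-1` A).
  apply/seteqP; split => -[x w] /=; congr A; apply/rowP => i; rewrite !mxE;
      by case: (unliftP ord0 i) => [j|] -> /=; rewrite ?mxE.
set B := _ @^-1` A.
have mB : measurable B.
  by rewrite -[B]setTI; exact: measurable_rV_cons.
rewrite -[LHS]/(pushforward (lebesgue_measure \x lebesgue_rV n)%E psi B).
pose m' := measure_function_pushforward__canonical__measure_function_Measure
  (lebesgue_measure \x lebesgue_rV n)%E mpsi.
suff H : forall C D, measurable C -> measurable D ->
    m' (C `*` D) = (lebesgue_measure C * lebesgue_rV n D)%E.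
  by rewrite (product_measure_unique (m' := m') H mB).
move=> C D mC mD; rewrite /m'/=.
rewrite /pushforward (_ : _ @^-1` _ = ((fun t => v ord0 ord0 - t) @^-1` C) `*` ((fun y => (rV_uncons v).2 - y) @^-1` D))//.
rewrite product_measure1E//.
- by congr (_ * _)%E; [exact: lebesgue_measure_reflect|exact: IHn].
- by rewrite -[X in measurable X]setTI; apply: measurable_funB => //; exact: measurable_cst.
- by rewrite -[X in measurable X]setTI; exact: measurable_reflect.
Qed.

Lemma ge0_integral_reflect n (v : 'rV[R]_n) (f : 'rV[R]_n -> \bar R) :
  measurable_fun [set: 'rV[R]_n] f -> (forall y, 0 <= f y)%E ->
  (\int[lebesgue_rV n]_y f (v - y)%R = \int[lebesgue_rV n]_y f y)%E.
Proof.
move=> mf f0.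
have mr := measurable_reflect v.
transitivity (\int[pushforward (lebesgue_rV n) (fun y => (v - y)%R)]_y f y)%E.
  by rewrite ge0_integral_pushforward.
by apply: eq_measure_integral => A mA _; exact: lebesgue_rV_reflect.
Qed.

End reflection.

(** * Superlevel sets of the maximal function *)

Section maximal_sets.
Context {R : realType} {n : nat}.
Implicit Types (x y c : 'rV[R]_n) (s t r e : R) (h : 'rV[R]_n -> R).
Local Notation mu := (lebesgue_rV n).

Lemma measurable_EFin_fun h A :
  measurable_fun [set: 'rV[R]_n] h -> measurable_fun A (fun y => (h y)%:E).
Proof. by move=> mh; apply/measurable_EFinP; exact: measurable_funTS. Qed.

Lemma seq_has_max (T : eqType) (f : T -> R) (s : seq T) : s != [::] ->
  exists2 p, p \in s & forall q, q \in s -> f q <= f p.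
Proof.
elim: s => // a [_ _|b s /(_ isT)[p ps pmax] _].
  by exists a; rewrite ?mem_head// => q; rewrite inE => /eqP ->.
have [ap|pa] := leP (f a) (f p).
  exists p; first by rewrite inE ps orbT.
  by move=> q; rewrite inE => /predU1P[->//|/pmax].
exists a; first by rewrite mem_head.
by move=> q; rewrite inE => /predU1P[->//|/pmax /le_trans]; apply; exact: ltW.
Qed.

(** The finite Vitali argument.  A cube of largest radius is set apart together with
all the cubes that meet it: they lie in its threefold dilation, whose measure is
at most [6 ^ n / t] times the integral of [h] over the cube itself.  The other cubes
are disjoint from it, so the integrals add up. *)
Lemma cube_covering_bound h (t : R) (s : seq ('rV[R]_n * R)) :
  measurable_fun [set: 'rV[R]_n] h -> (forall y, 0 <= h y) -> 0 < t ->
  (forall p, p \in s -> 0 < p.2 /\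
    ((t * p.2 ^+ n)%:E <= \int[mu]_(y in Q Cube p.1 p.2) (h y)%:E)%E) ->
  (mu (\bigcup_(p in [set` s]) Q Cube p.1 p.2) <=
   (6 ^+ n / t)%:E *
   \int[mu]_(y in \bigcup_(p in [set` s]) Q Cube p.1 p.2) (h y)%:E)%E.
Proof.
move=> mh h0 t0.
have mhE A : measurable_fun A (fun y => (h y)%:E) by exact: measurable_EFin_fun.
have hE0 y : (0 <= (h y)%:E)%E by rewrite lee_fin.
have mU (l : seq ('rV[R]_n * R)) :
    measurable (\bigcup_(p in [set` l]) Q Cube p.1 p.2).
  by rewrite bigcup_seq; apply: bigsetU_measurable => p _; exact: measurable_Q.
have [m] := ubnP (size s); elim: m s => // m IH s; rewrite ltnS => sm Hs.
have [->|s0] := eqVneq s [::].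
  rewrite (_ : [set` _] = set0) ?bigcup_set0 ?measure0 ?integral_set0 ?mule0//.
  by apply/seteqP; split.
have [p0 p0s p0max] := seq_has_max (fun p : 'rV[R]_n * R => p.2) s0.
have [e0 Hp0] := Hs _ p0s.
pose a (p : 'rV[R]_n * R) := `[< Q Cube p.1 p.2 `&` Q Cube p0.1 p0.2 = set0 >].
pose s' := [seq p <- s | a p].
set A := \bigcup_(p in _) _.
set A' := \bigcup_(p in [set` s']) Q Cube p.1 p.2.
have s's p : p \in s' -> p \in s by rewrite mem_filter => /andP[].
have sm' : (size s' < m)%N.
  apply: leq_trans sm; rewrite size_filter -(count_predC a s) -addn1 leq_add2l.
  rewrite -has_count; apply/hasP; exists p0 => //=; apply/asboolPn.
  rewrite setIid => Q0; have := Q_center Cube p0.1 e0; by rewrite Q0.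
have IHs' := IH _ sm' (fun p ps' => Hs p (s's p ps')).
have AQ : A `<=` Q Cube p0.1 (3 * p0.2) `|` A'.
  move=> y [p /= ps pq].
  have [ap|/asboolPn/eqP/set0P[z [pz p0z]]] := boolP (a p).
    by right; exists p => //=; rewrite mem_filter ap.
  left; have := p0max _ ps; move: pq pz p0z; rewrite !QE/= => yp zp zp0 pp0.
  rewrite (le_lt_trans (body_norm_distD Cube _ p.1 _))//.
  have := body_norm_distD Cube p.1 z p0.1.
  rewrite (body_norm_distC Cube p.1 z) /=; move: yp zp zp0 => /=; lra.
have QA' : [disjoint Q Cube p0.1 p0.2 & A'].
  apply/eqP/seteqP; split => // y [yp0 [p /=]].
  rewrite mem_filter => /andP[/asboolP ap _] yp.
  have : (Q Cube p.1 p.2 `&` Q Cube p0.1 p0.2) y by [].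
  by rewrite ap.
have QA : Q Cube p0.1 p0.2 `|` A' `<=` A.
  move=> y [yQ|[p /= ps' yp]]; first by exists p0.
  by exists p => //=; exact: s's.
have mQ := measurable_Q Cube p0.1 p0.2.
apply: (@le_trans _ _ (mu (Q Cube p0.1 (3 * p0.2)) + mu A')%E).
  apply: (le_trans (y := mu (Q Cube p0.1 (3 * p0.2) `|` A'))).
    apply: le_measure => //; rewrite inE; first exact: mU.
    by apply: measurableU; [exact: measurable_Q|exact: mU].
  by apply: measureU2; [exact: measurable_Q|exact: mU].
rewrite lebesgue_cube ?mulr_gt0//.
apply: (@le_trans _ _ ((6 ^+ n / t)%:E *
    (\int[mu]_(y in Q Cube p0.1 p0.2) (h y)%:E + \int[mu]_(y in A') (h y)%:E))%E).
  rewrite ge0_muleDr; [|exact: integral_ge0|exact: integral_ge0].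
  apply: leeD => //.
  rewrite [leLHS](_ : _ = (6 ^+ n / t)%:E * (t * p0.2 ^+ n)%:E)%E; last first.
    rewrite -EFinM; congr EFin.
    rewrite (_ : 2 * (3 * p0.2) = 6 * p0.2); last by ring.
    by rewrite exprMn; field; rewrite gt_eqF.
  by apply: lee_wpmul2l => //; rewrite lee_fin divr_ge0 ?exprn_ge0 ?ltW.
rewrite -ge0_integral_setU//; last exact: mU.
apply: lee_wpmul2l.
  by rewrite lee_fin divr_ge0 ?exprn_ge0 ?ltW.
apply: ge0_subset_integral => //; last exact: mU.
by apply: measurableU => //; exact: mU.
Qed.

Definition maximal_index h t : set ('rV[rat]_n * rat) :=
  [set p | 0 < ratr p.2 :> R /\
    ((t * ratr p.2 ^+ n)%:E <
      \int[mu]_(y in Q Cube (map_mx ratr p.1) (ratr p.2)) (h y)%:E)%E].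

(** The superlevel set of the uncentred maximal function, the mean over a cube of
radius [e] being replaced by [e ^- n] times the integral.  Restricting to cubes with
rational centre and radius makes it a countable union, hence measurable. *)
Definition maximal_set h t : set 'rV[R]_n :=
  \bigcup_(p in maximal_index h t) Q Cube (map_mx ratr p.1) (ratr p.2).

Lemma measurable_maximal_set h t : measurable (maximal_set h t).
Proof.
rewrite /maximal_set bigcup_mkcond; apply: countable_bigcupT_measurable => // p.
by case: ifP => // _; exact: measurable_Q.
Qed.

(** The weak type (1,1) bound: a countable union is the limit of its finite
subunions, to which [cube_covering_bound] applies. *)
Lemma lebesgue_maximal_set_le h t :
  measurable_fun [set: 'rV[R]_n] h -> (forall y, 0 <= h y) -> 0 < t ->
  (mu (maximal_set h t) <= (6 ^+ n / t)%:E * \int[mu]_y (h y)%:E)%E.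
Proof.
move=> mh h0 t0.
have mhE A : measurable_fun A (fun y => (h y)%:E) by exact: measurable_EFin_fun.
pose L N : seq ('rV[R]_n * R) := [seq (map_mx ratr p.1, ratr p.2) |
  p <- pmap unpickle (iota 0 N) & `[< maximal_index h t p >]].
pose F N := \bigcup_(p in [set` L N]) Q Cube p.1 p.2.
have mF N : measurable (F N).
  by rewrite /F bigcup_seq; apply: bigsetU_measurable => p _; exact: measurable_Q.
have FE : maximal_set h t = \bigcup_N F N.
  apply/seteqP; split => y.
    move=> [p tp yp]; exists (pickle p).+1 => //.
    exists (map_mx ratr p.1, ratr p.2) => //=; apply/mapP; exists p => //.
    rewrite mem_filter; apply/andP; split; first exact/asboolP.
    rewrite mem_pmap; apply/mapP; exists (pickle p); last by rewrite pickleK.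
    by rewrite mem_iota/= add0n.
  move=> [N _ [q /= /mapP[p]]]; rewrite mem_filter => /andP[/asboolP tp _] -> yq.
  by exists p.
have FC := @nondecreasing_cvg_mu _ _ _ mu F mF.
rewrite FE; move: FC; rewrite -FE => /(_ (measurable_maximal_set h t)) FC.
have {}FC : (mu \o F) x @[x --> \oo] --> mu (maximal_set h t).
  apply: FC => N M NM; apply/subsetPset => y [q /= /mapP[p]].
  rewrite mem_filter => /andP[tp]; rewrite mem_pmap => /mapP[i iN ip] qp yq.
  exists q => //=; apply/mapP; exists p => //; rewrite mem_filter tp/=.
  rewrite mem_pmap; apply/mapP; exists i => //.
  by move: iN; rewrite !mem_iota/= !add0n => /leq_trans; apply.
rewrite -(cvg_lim _ FC)//; apply: lime_le; first by apply/cvg_ex; eexists; exact: FC.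
apply: nearW => N /=.
have HL p : p \in L N -> 0 < p.2 /\
    ((t * p.2 ^+ n)%:E <= \int[mu]_(y in Q Cube p.1 p.2) (h y)%:E)%E.
  move=> /mapP[q]; rewrite mem_filter => /andP[/asboolP[q0 qh] _] -> /=.
  by split => //; exact: ltW.
apply: (le_trans (cube_covering_bound mh h0 t0 HL)).
apply: lee_wpmul2l; first by rewrite lee_fin divr_ge0 ?exprn_ge0 ?ltW.
by apply: ge0_subset_integral => // [|y _]; [exact: mF|rewrite lee_fin].
Qed.

Lemma rV_rat_dense x r : 0 < r -> exists c : 'rV[rat]_n, `|map_mx ratr c - x| < r.
Proof.
move=> r0.
have H i : exists q : rat, `|ratr q - x ord0 i| < r.
  have [|q] := @rat_in_itvoo R (x ord0 i - r) (x ord0 i + r); first by lra.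
  by rewrite in_itv/= -ltr_distlC distrC => ?; exists q.
exists (\row_i sval (cid (H i))).
by apply/(rV_norm_ltP _ r0) => i; rewrite !mxE; case: cid.
Qed.

(** A rational cube of radius between [3 r / 2] and [2 r], with centre close to [x],
contains [Q x r]; a large integral over [Q x r] would put [x] in the maximal set. *)
Lemma maximal_setC_integral_le h t x r :
  measurable_fun [set: 'rV[R]_n] h -> (forall y, 0 <= h y) -> 0 <= t -> 0 < r ->
  ~ maximal_set h t x ->
  (\int[mu]_(y in Q Cube x r) (h y)%:E <= (t * (2 * r) ^+ n)%:E)%E.
Proof.
move=> mh h0 t0 r0 xt.
have mhE A : measurable_fun A (fun y => (h y)%:E) by exact: measurable_EFin_fun.
have r20 : 0 < r / 2 by rewrite divr_gt0.
have [c cx] := rV_rat_dense x r20.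
have [|e] := @rat_in_itvoo R (3 / 2 * r) (2 * r); first by lra.
rewrite in_itv/= => /andP[er1 er2].
have e0 : 0 < ratr e :> R by lra.
apply: (@le_trans _ _ (\int[mu]_(y in Q Cube (map_mx (@ratr R) c) (@ratr R e)) (h y)%:E)%E).
  apply: ge0_subset_integral => //; [exact: measurable_Q|exact: measurable_Q| |].
    by move=> y _; rewrite lee_fin.
  by apply: subset_Q; rewrite body_norm_distC /=; lra.
rewrite leNgt; apply/negP => te; apply: xt; exists (c, e).
  split => //=; apply: le_lt_trans te; rewrite lee_fin ler_wpM2l//.
  by apply: lerXn2r; rewrite ?nnegrE; lra.
by rewrite QE /= distrC; lra.
Qed.

(** The truncation used in Marcinkiewicz interpolation.  On a cube of radius [e] the
values of [h] below [t] contribute at most [2 ^ n * t * e ^ n], so those above [t]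
must account for the remaining [t * e ^ n]. *)
Lemma maximal_set_truncate h t :
  measurable_fun [set: 'rV[R]_n] h -> (forall y, 0 <= h y) -> 0 < t ->
  (mu (maximal_set h ((2 ^+ n + 1) * t)) <=
   (6 ^+ n / t)%:E * \int[mu]_y (h y * (t < h y)%R%:R)%:E)%E.
Proof.
move=> mh h0 t0.
have mhE A : measurable_fun A (fun y => (h y)%:E) by exact: measurable_EFin_fun.
pose g y := h y * (t < h y)%R%:R.
have mg : measurable_fun [set: 'rV[R]_n] g.
  apply: measurable_funM => //.
  rewrite (_ : (fun _ => _) = \1_(h @^-1` `]t, +oo[)).
    apply: measurable_indic; rewrite -[X in measurable X]setTI.
    by apply: mh => //; exact: measurable_itv.
  by apply/funext => y; rewrite indicE; congr ((nat_of_bool _)%:R); apply/idP/idP; rewrite inE/= in_itv/= andbT.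
have g0 y : 0 <= g y by rewrite mulr_ge0.
apply: le_trans (lebesgue_maximal_set_le mg g0 t0).
rewrite le_measure ?inE; [by []|exact: measurable_maximal_set|exact: measurable_maximal_set|].
move=> x [p [e0 hp] xp]; exists p => //; split => //.
set e : R := ratr p.2 in e0 hp xp *; set c := map_mx ratr p.1 in hp xp *.
have : (\int[mu]_(y in Q Cube c e) (h y)%:E <=
    (t * (2 * e) ^+ n)%:E + \int[mu]_(y in Q Cube c e) (g y)%:E)%E.
  rewrite EFinM -(lebesgue_cube c e0) -integral_cst; last exact: measurable_Q.
  rewrite -ge0_integralD//; first last.
  - exact: measurable_EFin_fun.
  - by move=> y _; rewrite lee_fin.
  - by move=> y _; rewrite lee_fin ltW.
  - exact: measurable_Q.
  apply: ge0_le_integral => //; first exact: measurable_Q.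
  - by move=> y _; rewrite lee_fin.
  - by apply: emeasurable_funD => //; exact: measurable_EFin_fun.
  move=> y _; rewrite -EFinD lee_fin /g; case: ltP => /= ht; rewrite ?mulr1 ?mulr0.
    by rewrite lerDr ltW.
  by rewrite addr0.
move=> /(lt_le_trans hp) H; rewrite ltNge; apply/negP => I.
move: H; rewrite ltNge => /negP; apply.
rewrite (_ : ((2 ^+ n + 1) * t * e ^+ n)%:E =
  (t * (2 * e) ^+ n)%:E + (t * e ^+ n)%:E)%E; first exact: leeD.
by rewrite -EFinD [(2 * e) ^+ n]exprMn; congr EFin; move: (2 ^+ n) (e ^+ n) => a b; ring.
Qed.

End maximal_sets.

(** * Dyadic sums *)

Section dyadic_sums.
Context {R : realType}.
Implicit Types (x y a b r : R) (u : nat -> \bar R).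

Lemma powR_expR a x : 0 < a -> a `^ x = expR (x * ln a).
Proof. by move=> a0; rewrite /powR gt_eqF. Qed.

Lemma powRD_gt0 a x y : 0 < a -> a `^ (x + y) = a `^ x * a `^ y.
Proof. by move=> a0; rewrite powRD// (gt_eqF a0) /= implybT. Qed.

Lemma powR_natM a x (j : nat) : 0 < a -> a `^ (x * j%:R) = (a `^ x) ^+ j.
Proof. by move=> a0; rewrite powRrM powR_mulrn// powR_ge0. Qed.

Lemma ltr_powR2 x y : x < y -> 2 `^ x < 2 `^ y.
Proof.
by move=> xy; rewrite !powR_expR// ltr_expR ltr_pM2r// ln_gt0// ltr1n.
Qed.

Lemma powR2_lt1 x : x < 0 -> 2 `^ x < 1 :> R.
Proof. by move=> /ltr_powR2; rewrite powRr0. Qed.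

Lemma powR_le_nexp a b x : 0 < a -> a <= b -> 0 <= x -> b `^ (- x) <= a `^ (- x).
Proof.
move=> a0 ab x0; have b0 := lt_le_trans a0 ab.
rewrite !powRN lef_pV2 ?posrE ?powR_gt0//.
by rewrite ge0_ler_powR ?nnegrE// ltW.
Qed.

Lemma exists_pow2_gt x : exists j : nat, x < 2 `^ j%:R.
Proof.
exists (Num.truncn x).+1; rewrite powR_mulrn//.
apply: (lt_le_trans (truncnS_gt x)).
by rewrite -natrX ler_nat ltnW// ltn_expl.
Qed.

Lemma dyadic_shell_below a b : 0 < a -> a < b ->
  exists j : nat, b * 2 `^ (- j.+1%:R) <= a < b * 2 `^ (- j%:R).
Proof.
move=> a0 ab; have b0 := lt_trans a0 ab.
have ex : exists j : nat, b * 2 `^ (- j%:R) <= a.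
  have [j Hj] := exists_pow2_gt (b / a); exists j.
  by rewrite powRN ler_pdivrMr ?powR_gt0// mulrC -ler_pdivrMr// ltW.
case: (ex_minnP ex) => -[|j] ja jmin.
  by move: ja; rewrite oppr0 powRr0 mulr1 leNgt ab.
exists j; rewrite ja /= ltNge; apply/negP => /jmin.
by rewrite ltnn.
Qed.

Lemma dyadic_shell_above a b : 0 < b -> b <= a ->
  exists j : nat, b * 2 `^ j%:R <= a < b * 2 `^ j.+1%:R.
Proof.
move=> b0 ba; have a0 := lt_le_trans b0 ba.
have ex : exists j : nat, a < b * 2 `^ j%:R.
  have [j Hj] := exists_pow2_gt (a / b); exists j.
  by rewrite mulrC -ltr_pdivrMr.
case: (ex_minnP ex) => -[|j] ja jmin.
  by move: ja; rewrite powRr0 mulr1 ltNge ba.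
exists j; rewrite ja andbT leNgt; apply/negP => /jmin.
by rewrite ltnn.
Qed.

Lemma geo_sum_le r (m N : nat) : 0 <= r < 1 ->
  \sum_(j < N) (if (m <= j)%N then r ^+ (j - m) else 0) <= (1 - r)^-1.
Proof.
move=> /andP[r0 r1].
suff -> : \sum_(j < N) (if (m <= j)%N then r ^+ (j - m) else 0) =
    (1 - r ^+ (N - m)) / (1 - r).
  rewrite ler_pdivrMr ?subr_gt0// mulVf ?gt_eqF ?subr_gt0//.
  by rewrite gerBl exprn_ge0.
elim: N => [|N IH]; first by rewrite big_ord0 sub0n expr0 subrr mul0r.
rewrite big_ord_recr/= IH; case: leqP => mN.
  rewrite subSn// exprS; field; rewrite subr_eq0 gt_eqF//.
have E1 : (N.+1 - m)%N = 0%N by apply/eqP; rewrite subn_eq0.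
have E : (N - m)%N = 0%N by apply/eqP; rewrite subn_eq0 ltnW.
by rewrite addr0 E E1.
Qed.

Lemma geo_sum_rev_le r (m N : nat) : 0 <= r < 1 ->
  \sum_(j < N) (if (j <= m)%N then r ^+ (m - j) else 0) <= (1 - r)^-1.
Proof.
move=> /andP[r0 r1].
elim: m => [|m IH].
  apply: (@le_trans _ _ 1); last by rewrite invf_ge1 ?subr_gt0// gerBl.
  case: N => [|N]; first by rewrite big_ord0.
  rewrite big_ord_recl/= subnn expr0 big1 ?addr0// => j _.
apply: (@le_trans _ _ (r * (1 - r)^-1 + 1)); last first.
  by rewrite le_eqVlt; apply/orP; left; apply/eqP; field; rewrite subr_eq0 gt_eqF.
apply: (@le_trans _ _ (r * \sum_(j < N) (if (j <= m)%N then r ^+ (m - j) else 0) +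
   \sum_(j < N) ((j : nat) == m.+1)%:R)).
  rewrite mulr_sumr -big_split ler_sum// => j _ /=.
  rewrite leq_eqVlt ltnS; case: eqP => [->|_] /=.
    by rewrite subnn ltnn mulr0 add0r.
  by case: ifP => jm; rewrite ?mulr0 addr0// subSn// exprS.
apply: lerD; first by rewrite ler_wpM2l.
have [mN|mN] := ltnP m.+1 N.
  rewrite (bigD1 (Ordinal mN))//= eqxx big1 ?addr0// => j.
  by rewrite -val_eqE/= => /negbTE ->.
rewrite big1// => j _; case: eqP => // jm.
by have := ltn_ord j; rewrite jm ltnNge mN.
Qed.

Lemma nneseries_term_le u (j : nat) : (forall k, 0 <= u k)%E ->
  (u j <= \sum_(0 <= k <oo) u k)%E.
Proof.
move=> u0; apply: le_trans (nneseries_lim_ge j.+1 (fun k _ _ => u0 k)).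
rewrite big_nat_recr//= leeDr//; apply: sume_ge0 => k _; exact: u0.
Qed.

Lemma nneseries_le_fin u (b : \bar R) : (forall k, 0 <= u k)%E ->
  (forall N, \sum_(k < N) u k <= b)%E -> (\sum_(0 <= k <oo) u k <= b)%E.
Proof.
move=> u0 ub; apply: lime_le; first by apply: is_cvg_nneseries => k _ _; exact: u0.
by apply: nearW => N; rewrite big_mkord.
Qed.

Lemma nneseries_EFin_le (u' : nat -> R) b : (forall k, 0 <= u' k) ->
  (forall N, \sum_(k < N) u' k <= b) -> (\sum_(0 <= k <oo) (u' k)%:E <= b%:E)%E.
Proof.
move=> u0 ub; apply: nneseries_le_fin => [k|N]; first by rewrite lee_fin.
by rewrite sumEFin lee_fin.
Qed.

(** The terms increase geometrically as long as [j d <= k] and decrease geometrically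
afterwards, so the sum is comparable to the value of the summand at the real
exponent [j = k / d]. *)
Lemma dyadic_peak_sum (al d : R) : 0 < al -> al < d ->
  exists2 C : R, 0 < C & forall k N : nat,
    \sum_(j < N) 2 `^ (- j%:R * al) * Num.min (2 `^ k%:R) (2 `^ (j%:R * d))
      <= C * 2 `^ (k%:R * (1 - al / d)).
Proof.
move=> al0 ald; have d0 := lt_trans al0 ald.
pose eta := Num.min al (d - al).
have eta0 : 0 < eta by rewrite /eta lt_min al0 subr_gt0.
pose r : R := 2 `^ (- eta).
have r0 : 0 < r by rewrite powR_gt0.
have r1 : r < 1 by apply: powR2_lt1; rewrite oppr_lt0.
have r01 : 0 <= r < 1 by rewrite (ltW r0).
exists (2 `^ eta * ((1 - r)^-1 + (1 - r)^-1)).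
  by rewrite mulr_gt0 ?powR_gt0// addr_gt0// invr_gt0 subr_gt0.
move=> k N.
set kap := k%:R / d.
have kap0 : 0 <= kap by rewrite divr_ge0// ltW.
pose m := Num.truncn kap.
have /andP[mk km] : (m%:R <= kap < m.+1%:R) by exact: truncn_itv.
have term (j : nat) : 2 `^ (- j%:R * al) * Num.min (2 `^ k%:R) (2 `^ (j%:R * d)) <=
    2 `^ (k%:R * (1 - al / d)) * (2 `^ eta *
     ((if (m <= j)%N then r ^+ (j - m) else 0) +
      (if (j <= m)%N then r ^+ (m - j) else 0))).
  have kE : k%:R = kap * d by rewrite /kap divfK// gt_eqF.
  have kdE : kap * d * (1 - al / d) = kap * d - kap * al.
    by field; rewrite gt_eqF.
  have etal : eta <= al by rewrite /eta ge_min lexx.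
  have etad : eta <= d - al by rewrite /eta ge_min lexx orbT.
  have [jm|mj] := leqP j m.
    apply: (@le_trans _ _ (2 `^ (- j%:R * al) * 2 `^ (j%:R * d))).
      by rewrite ler_wpM2l ?powR_ge0// ge_min lexx orbT.
    apply: (@le_trans _ _ (2 `^ (k%:R * (1 - al / d)) * (2 `^ eta * r ^+ (m - j)))).
      rewrite -powR_natM// -!powRD_gt0// ler_powR ?ler1n// natrB//.
      have jmR : j%:R <= m%:R :> R by rewrite ler_nat.
      rewrite kE kdE; nra.
    rewrite ler_wpM2l ?powR_ge0// ler_wpM2l ?powR_ge0// lerDr.
    by case: ifP => // _; rewrite exprn_ge0// ltW.
  apply: (@le_trans _ _ (2 `^ (- j%:R * al) * 2 `^ k%:R)).
    by rewrite ler_wpM2l ?powR_ge0// ge_min lexx.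
  apply: (@le_trans _ _ (2 `^ (k%:R * (1 - al / d)) * (2 `^ eta * r ^+ (j - m)))).
    rewrite -powR_natM// -!powRD_gt0// ler_powR ?ler1n// natrB ?(ltnW mj)//.
    have mjR : m.+1%:R <= j%:R :> R by rewrite ler_nat.
    rewrite -natr1 in mjR km.
    rewrite kE kdE; nra.
  by rewrite ler_wpM2l ?powR_ge0// ler_wpM2l ?powR_ge0// (ltnW mj) addr0.
apply: (le_trans (ler_sum _ (fun (j : 'I_N) _ => term j))).
rewrite -mulr_sumr mulrC ler_wpM2r ?powR_ge0//.
rewrite -mulr_sumr ler_wpM2l ?powR_ge0// big_split/= lerD//.
  exact: geo_sum_le.
exact: geo_sum_rev_le.
Qed.

(** A geometric sum over the dyadic levels below [b]: for [th < 1] it is comparable to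
its first term, for [th > 1] to its last one, where [2 ^ k] is about [b].  At [th = 1]
there would be an additional logarithm. *)
Lemma layer_sum (p th : R) : 1 <= p -> th <= p -> th != 1 ->
  exists2 C : R, 0 < C & forall (b : R) (N : nat), 0 <= b ->
    \sum_(k < N) 2 `^ (k.+1%:R * th) * (2 `^ (- k%:R) * (b * (2 `^ k%:R < b)%R%:R))
      <= C * b `^ p.
Proof.
move=> p1 thp th1.
have tE (b : R) (k : nat) : 2 `^ (k.+1%:R * th) * (2 `^ (- k%:R) * (b * (2 `^ k%:R < b)%R%:R)) =
    2 `^ th * b * (2 `^ ((th - 1) * k%:R) * (2 `^ k%:R < b)%R%:R) :> R.
  rewrite (_ : k.+1%:R * th = th + k%:R * th); last by rewrite -natr1; ring.
  rewrite (_ : (th - 1) * k%:R = k%:R * th + (- k%:R)); last by ring.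
  by rewrite !powRD_gt0//; ring.
have [th_lt1|] := ltP th 1.
  pose r : R := 2 `^ (th - 1).
  have r1 : r < 1 by apply: powR2_lt1; rewrite subr_lt0.
  have r0 : 0 <= r by exact: powR_ge0.
  exists (2 `^ th * (1 - r)^-1); first by rewrite mulr_gt0 ?powR_gt0 ?invr_gt0 ?subr_gt0.
  move=> b N b0; under eq_bigr do rewrite tE.
  rewrite -mulr_sumr -!mulrA ler_wpM2l ?powR_ge0//.
  have [b1|b1] := leP b 1.
    rewrite big1 ?mulr0; first by rewrite mulr_ge0 ?powR_ge0// invr_ge0 subr_ge0 ltW.
    move=> k _; rewrite ltNge (le_trans b1) ?mulr0//.
    by rewrite powR_mulrn// exprn_ege1// ler1n.
  rewrite [leRHS]mulrC ler_pM//; last 2 first.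
  - by rewrite (le_trans _ (le1r_powR (ltW b1) p1)).
  - apply: le_trans (geo_sum_le 0 N (_ : 0 <= r < 1)); last by rewrite r0.
    apply: ler_sum => k _; rewrite ?leq0n subn0 -powR_natM//.
    by case: (2 `^ k%:R < b) => /=; rewrite ?mulr1// mulr0 powR_ge0.
  by apply: sumr_ge0 => k _; rewrite mulr_ge0 ?powR_ge0.
rewrite le_eqVlt eq_sym (negbTE th1)/= => th_gt1.
pose r : R := 2 `^ (- (th - 1)).
have r1 : r < 1 by apply: powR2_lt1; rewrite oppr_lt0 subr_gt0.
have r0 : 0 <= r by exact: powR_ge0.
exists (2 `^ th * (1 - r)^-1); first by rewrite mulr_gt0 ?powR_gt0 ?invr_gt0 ?subr_gt0.
move=> b N b0; under eq_bigr do rewrite tE.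
rewrite -mulr_sumr -!mulrA ler_wpM2l ?powR_ge0//.
have [b1|b1] := leP b 1.
  rewrite big1 ?mulr0; first by rewrite mulr_ge0 ?powR_ge0// invr_ge0 subr_ge0 ltW.
  move=> k _; rewrite ltNge (le_trans b1) ?mulr0//.
  by rewrite powR_mulrn// exprn_ege1// ler1n.
have b_gt0 : 0 < b by apply: lt_trans b1.
have [m /andP[_ mb]] := dyadic_shell_above (@ltr01 R) (ltW b1).
have bm := dyadic_shell_above (@ltr01 R) (ltW b1).
have {m mb bm} [m mb bm] : exists2 m : nat, 2 `^ m%:R <= b & b < 2 `^ m.+1%:R.
  by case: bm => j; rewrite !mul1r => /andP[? ?]; exists j.
apply: (@le_trans _ _ (b * (b `^ (th - 1) * (1 - r)^-1))).
  rewrite ler_wpM2l//.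
  apply: (@le_trans _ _ (b `^ (th - 1) *
      \sum_(k < N) (if (k <= m)%N then r ^+ (m - k) else 0))); last first.
    by rewrite ler_wpM2l ?powR_ge0// geo_sum_rev_le// r0.
  rewrite mulr_sumr ler_sum// => k _.
  have [kb|kb] := ltP (2 `^ k%:R) b; last first.
    rewrite mulr0; case: ifP => _; last by rewrite mulr0.
    by rewrite mulr_ge0 ?powR_ge0// exprn_ge0.
  have km : (k <= m)%N.
    rewrite -ltnS -(ltr_nat R) ltNge; apply/negP => mk.
    have : 2 `^ m.+1%:R <= 2 `^ k%:R :> R by rewrite ler_powR// ler1n.
    by move=> /le_lt_trans/(_ kb)/(lt_trans bm); rewrite ltxx.
  rewrite km mulr1 -powR_natM// natrB//.
  apply: (@le_trans _ _ ((2 `^ m%:R) `^ (th - 1) * 2 `^ (- (th - 1) * (m%:R - k%:R)))).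
    rewrite -powRrM -powRD_gt0// ler_powR ?ler1n//.
    by rewrite le_eqVlt; apply/orP; left; apply/eqP; ring.
  rewrite ler_wpM2r ?powR_ge0//; apply: ge0_ler_powR.
  - by rewrite subr_ge0 ltW.
  - by rewrite nnegrE powR_ge0.
  - by rewrite nnegrE ltW.
  - exact: mb.
rewrite mulrA mulrC ler_wpM2l ?invr_ge0 ?subr_ge0 ?(ltW r1)//.
rewrite -[X in X * _](powRr1 b0) -powRD_gt0// ler_powR ?(ltW b1)//.
by rewrite addrC subrK.
Qed.

End dyadic_sums.

(** * The Riesz kernel and its potentials *)

Section potential.
Context {R : realType} {n : nat}.
Implicit Types (x y v : 'rV[R]_n) (s r : R) (h : 'rV[R]_n -> R).
Local Notation mu := (lebesgue_rV n).

(** The Riesz kernel [|v| ^ (alpha - n)], with value [0] at the origin. *)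
Definition riesz (alpha : R) v : R := (euclidean_norm v `^ (n%:R - alpha))^-1.

Section kernel.
Context (alpha : R).
Hypotheses (n_gt0 : (0 < n)%N) (alpha01 : 0 < alpha < 1).
Let beta : R := n%:R - alpha.

Lemma riesz_exponent_gt0 : 0 < beta.
Proof.
rewrite /beta subr_gt0; case/andP: alpha01 => _ /lt_le_trans; apply.
by rewrite ler1n.
Qed.

Lemma riesz_ge0 v : 0 <= riesz alpha v.
Proof. by rewrite invr_ge0 powR_ge0. Qed.

Lemma riesz_opp v : riesz alpha (- v) = riesz alpha v.
Proof. by rewrite /riesz euclidean_normN. Qed.

Lemma riesz_le v r : 0 < r -> r <= `|v| -> riesz alpha v <= r `^ (- beta).
Proof.
move=> r0 rv; rewrite /riesz -/beta -powRN powR_le_nexp//.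
  exact: le_trans (norm_le_euclidean v).
exact/ltW/riesz_exponent_gt0.
Qed.

Lemma measurable_riesz : measurable_fun [set: 'rV[R]_n] (riesz alpha).
Proof.
rewrite (_ : riesz alpha = fun v => euclidean_norm v `^ (- beta)).
  apply: (measurableT_comp (measurable_powR (- beta))).
  exact: measurable_euclidean_norm.
by apply/funext => v; rewrite /riesz powRN.
Qed.

Lemma measurable_riesz_sub x : measurable_fun [set: 'rV[R]_n] (fun y => riesz alpha (x - y)).
Proof. exact: (measurableT_comp measurable_riesz (measurable_reflect x)). Qed.

Lemma measurable_riesz_sub2 : measurable_fun [set: 'rV[R]_n * 'rV[R]_n]
  (fun z => riesz alpha (z.1 - z.2)).
Proof.
apply: (measurableT_comp measurable_riesz).
by apply: measurable_fun_rVB; [exact: measurable_fst|exact: measurable_snd].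
Qed.

Lemma riesz_near_le v s : `|v| < s ->
  ((riesz alpha v)%:E <= \sum_(0 <= j <oo)
    ((s * 2 `^ (- j.+1%:R)) `^ (- beta) * (`|v| < s * 2 `^ (- j%:R))%R%:R)%:E)%E.
Proof.
move=> vs.
have u0 (j : nat) :
    (0 <= ((s * 2 `^ (- j.+1%:R)) `^ (- beta) * (`|v| < s * 2 `^ (- j%:R))%R%:R)%:E)%E.
  by rewrite lee_fin mulr_ge0 ?powR_ge0.
have [->|v0] := eqVneq v 0.
  rewrite /riesz -/beta (_ : euclidean_norm 0 = 0); last exact: (body_norm0 Ball).
  rewrite powR0 ?gt_eqF ?riesz_exponent_gt0// invr0.
  by apply: nneseries_ge0 => k _ _; rewrite lee_fin mulr_ge0 ?powR_ge0.
have v_gt0 : 0 < `|v| by rewrite normr_gt0.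
have [j /andP[j1 j2]] := dyadic_shell_below v_gt0 vs.
apply: le_trans (nneseries_term_le j u0); rewrite lee_fin j2 mulr1 riesz_le//.
by rewrite mulr_gt0 ?powR_gt0// (lt_trans v_gt0).
Qed.

Definition potential h x : \bar R := (\int[mu]_y (riesz alpha (x - y) * h y)%:E)%E.

Lemma potential_ge0 h x : (forall y, 0 <= h y) -> (0 <= potential h x)%E.
Proof.
by move=> h0; apply: integral_ge0 => y _; rewrite lee_fin mulr_ge0 ?riesz_ge0.
Qed.

Lemma measurable_potential h : measurable_fun [set: 'rV[R]_n] h ->
  (forall y, 0 <= h y) -> measurable_fun [set: 'rV[R]_n] (potential h).
Proof.
move=> mh h0.
apply: (measurable_fun_fubini_tonelli_F (m2 := mu)
  (fun z : 'rV[R]_n * 'rV[R]_n => (riesz alpha (z.1 - z.2) * h z.2)%:E)).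
  apply/measurable_EFinP; apply: measurable_funM; first exact: measurable_riesz_sub2.
  by apply: measurableT_comp => //; exact: measurable_snd.
by move=> z; rewrite lee_fin mulr_ge0 ?riesz_ge0.
Qed.

(** On each dyadic shell around [x] the kernel is comparable to a constant, which turns
the potential into a sum of integrals over cubes centred at [x]. *)
Lemma potential_near_le h x s : measurable_fun [set: 'rV[R]_n] h ->
  (forall y, 0 <= h y) -> (forall y, ~ Q Cube x s y -> h y = 0) ->
  (potential h x <= \sum_(0 <= j <oo)
    (((s * 2 `^ (- j.+1%:R)) `^ (- beta))%:E *
     \int[mu]_(y in Q Cube x (s * 2 `^ (- j%:R))) (h y)%:E))%E.
Proof.
move=> mh h0 hs.
pose u (j : nat) y := (((s * 2 `^ (- j.+1%:R)) `^ (- beta))%:E *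
  (h y * \1_(Q Cube x (s * 2 `^ (- j%:R))) y)%:E)%E.
have mu_ j : measurable_fun [set: 'rV[R]_n] (u j).
  apply: emeasurable_funM; first exact: measurable_cst.
  apply/measurable_EFinP/measurable_funM => //.
  by apply: measurable_indic; exact: measurable_Q.
have u0 (j : nat) y : (0 <= u j y)%E.
  by rewrite mule_ge0// lee_fin ?powR_ge0// mulr_ge0.
rewrite [leRHS](_ : _ = \sum_(0 <= j <oo) \int[mu]_y u j y)%E; last first.
  apply: eq_eseriesr => j _.
  rewrite ge0_integralZl//; last 3 first.
  - apply/measurable_EFinP/measurable_funM => //.
    by apply: measurable_indic; exact: measurable_Q.
  - by move=> y _; rewrite lee_fin mulr_ge0.
  - by rewrite lee_fin powR_ge0.
  congr (_ * _)%E; rewrite [LHS]integral_mkcond; apply: eq_integral => y _.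
  by rewrite patchE indicE; case: ifPn => _; rewrite ?mulr1 ?mulr0.
rewrite -integral_nneseries//.
apply: ge0_le_integral => //.
- by move=> y _; rewrite lee_fin mulr_ge0 ?riesz_ge0.
- by apply/measurable_EFinP; apply: measurable_funM => //; exact: measurable_riesz_sub.
- by apply: ge0_emeasurable_sum => // j _; exact: mu_.
move=> y _.
have [xy|xy] := pselect (Q Cube x s y); last first.
  by rewrite hs// mulr0; apply: nneseries_ge0 => k _ _; exact: u0.
rewrite mulrC EFinM.
apply: (@le_trans _ _ ((h y)%:E * \sum_(0 <= j <oo)
    ((s * 2 `^ (- j.+1%:R)) `^ (- beta) * (`|x - y| < s * 2 `^ (- j%:R))%R%:R)%:E)%E).
  apply: lee_wpmul2l; first by rewrite lee_fin.
  by apply: riesz_near_le; rewrite distrC.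
rewrite -nneseriesZl; last first.
  by move=> j _; rewrite lee_fin mulr_ge0 ?powR_ge0.
apply: lee_nneseries => j _; first by rewrite mule_ge0// lee_fin// mulr_ge0 ?powR_ge0.
rewrite /u -!EFinM lee_fin indicE.
rewrite (_ : (y \in _) = (`|x - y| < s * 2 `^ (- j%:R))).
  by rewrite le_eqVlt; apply/orP; left; apply/eqP; ring.
by apply/idP/idP; rewrite inE QE/= distrC.
Qed.

End kernel.
End potential.

(** * The Hardy-Littlewood-Sobolev inequality *)

Section potential_Lq.
Context {R : realType} {n : nat}.
Implicit Types (x y v : 'rV[R]_n) (s r : R) (h : 'rV[R]_n -> R).
Local Notation mu := (lebesgue_rV n).

(** Either [b <= kap], or [b <= kap * (b / kap) ^ p].  Integrated, and with [kap] chosen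
optimally, this plays the part of Hoelder's inequality at the cost of a factor [2]. *)
Lemma ler_trade (p b kap : R) : 1 <= p -> 0 <= b -> 0 < kap ->
  b <= kap + kap `^ (1 - p) * b `^ p.
Proof.
move=> p1 b0 k0; have [bk|kb] := leP b kap.
  by rewrite (le_trans bk)// lerDl mulr_ge0 ?powR_ge0.
have bE : b = kap * (b / kap) by rewrite mulrC divfK// gt_eqF.
rewrite (le_trans (y := kap `^ (1 - p) * b `^ p))//; last by rewrite lerDr ltW.
rewrite [in leRHS]bE powRM ?divr_ge0 ?(ltW k0)// mulrA -powRD_gt0// subrK.
rewrite powRr1 ?(ltW k0)// [leLHS]bE ler_wpM2l ?(ltW k0)//.
by rewrite le1r_powR// ler_pdivlMr// mul1r ltW.
Qed.

Lemma measurable_powR_fun (p : R) h : measurable_fun [set: 'rV[R]_n] h ->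
  measurable_fun [set: 'rV[R]_n] (fun y => h y `^ p).
Proof. by move=> mh; exact: (measurableT_comp (measurable_powR p)). Qed.

Lemma integral_trade (p kap : R) (D : set 'rV[R]_n) h : 1 <= p -> 0 < kap ->
  measurable D -> measurable_fun [set: 'rV[R]_n] h -> (forall y, 0 <= h y) ->
  (\int[mu]_(y in D) (h y)%:E <=
    kap%:E * mu D + (kap `^ (1 - p))%:E * \int[mu]_(y in D) (h y `^ p)%:E)%E.
Proof.
move=> p1 k0 mD mh h0.
have mhp := measurable_powR_fun p mh.
rewrite -integral_cst// -ge0_integralZl//; last 3 first.
- exact: measurable_EFin_fun.
- by move=> y _; rewrite lee_fin powR_ge0.
- by rewrite lee_fin powR_ge0.
rewrite -ge0_integralD//; last 3 first.
- by move=> y _; rewrite lee_fin ltW.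
- by move=> y _; rewrite -EFinM lee_fin mulr_ge0 ?powR_ge0.
- apply: emeasurable_funM; first exact: measurable_cst.
  exact: measurable_EFin_fun.
apply: ge0_le_integral => //.
- by move=> y _; rewrite lee_fin.
- exact: measurable_EFin_fun.
- apply: emeasurable_funD => //; apply: emeasurable_funM; first exact: measurable_cst.
  exact: measurable_EFin_fun.
by move=> y _; rewrite -EFinM -EFinD lee_fin ler_trade.
Qed.

Context (alpha : R).
Hypotheses (n_gt0 : (0 < n)%N) (alpha01 : 0 < alpha < 1).
Let beta : R := n%:R - alpha.
Let L : R := 2 ^+ n + 1.

Let alpha_gt0 : 0 < alpha. Proof. by case/andP: alpha01. Qed.

(** Hedberg's argument.  For [x] outside the [k]-th maximal set, the integral of [h] over
a cube of radius [r] around [x] is bounded in two ways: by [2 ^ k r ^ n], which is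
better for small [r], and through the L^p norm, which is better for large [r].  The
dyadic sum over [r] is then [dyadic_peak_sum] with [d = n / p]. *)
Lemma potential_pointwise (p A : R) : 1 <= p -> p * alpha < n%:R -> 0 <= A ->
  exists2 C : R, 0 < C & forall h x s (k : nat), 0 < s ->
    measurable_fun [set: 'rV[R]_n] h -> (forall y, 0 <= h y) ->
    (forall y, ~ Q Cube x s y -> h y = 0) ->
    (\int[mu]_y (h y `^ p)%:E <= (A * s ^+ n)%:E)%E ->
    ~ maximal_set h (L * 2 `^ k%:R) x ->
    (potential alpha h x <=
      (C * s `^ alpha * 2 `^ (k%:R * (1 - alpha / (n%:R / p))))%:E)%E.
Proof.
move=> p1 pan A0; have p0 : 0 < p by apply: lt_le_trans p1.
have nR0 : 0 < n%:R :> R by rewrite ltr0n.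
set d : R := n%:R / p.
have ad : alpha < d by rewrite /d ltr_pdivlMr// mulrC.
have [C0 C00 HC0] := dyadic_peak_sum alpha_gt0 ad.
pose C1 : R := L * 2 ^+ n + A.
have L0 : 0 < L by rewrite /L ltr_wpDl// exprn_ge0.
have C10 : 0 < C1 by rewrite /C1 ltr_pwDl// mulr_gt0// exprn_gt0.
exists (C1 * 2 `^ beta * C0); first by rewrite !mulr_gt0// powR_gt0.
move=> h x s k s0 mh h0 hs hp xk.
have Mj (j : nat) : (\int[mu]_(y in Q Cube x (s * 2 `^ (- j%:R))) (h y)%:E <=
    (C1 * (s * 2 `^ (- j%:R)) ^+ n * Num.min (2 `^ k%:R) (2 `^ (j%:R * d)))%:E)%E.
  set r := s * _.
  have r0 : 0 < r by rewrite mulr_gt0 ?powR_gt0.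
  have rn0 : 0 <= r ^+ n by rewrite exprn_ge0// ltW.
  have [_|_] := leP (2 `^ k%:R) (2 `^ (j%:R * d)).
    have := maximal_setC_integral_le mh h0 (_ : 0 <= L * 2 `^ k%:R) r0 xk.
    move=> /(_ (mulr_ge0 (ltW L0) (powR_ge0 _ _)))/le_trans; apply.
    rewrite lee_fin exprMn; set P := 2 `^ _.
    have P0 : 0 <= P by exact: powR_ge0.
    rewrite (_ : L * P * _ = (L * 2 ^+ n) * r ^+ n * P); last by ring.
    by rewrite ler_wpM2r// ler_wpM2r// /C1 lerDl.
  set kap := 2 `^ _.
  have k0 : 0 < kap by rewrite powR_gt0.
  apply: le_trans (integral_trade p1 k0 (measurable_Q Cube x r) mh h0) _.
  rewrite lebesgue_cube//.
  apply: (@le_trans _ _ (kap%:E * ((2 * r) ^+ n)%:E + (kap `^ (1 - p))%:E * (A * s ^+ n)%:E)%E).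
    rewrite leeD2l// lee_wpmul2l ?lee_fin ?powR_ge0//.
    apply: le_trans hp; apply: ge0_subset_integral => //; first exact: measurable_Q.
      by apply: measurable_EFin_fun; exact: measurable_powR_fun.
    by move=> y _; rewrite lee_fin powR_ge0.
  rewrite -!EFinM -EFinD lee_fin.
  have -> : kap `^ (1 - p) * (A * s ^+ n) = A * r ^+ n * kap.
    rewrite -!powR_mulrn ?(ltW s0) ?(ltW r0)// mulrCA -mulrA; congr (A * _).
    rewrite /kap /r !powR_expR ?powR_gt0 ?mulr_gt0 ?powR_gt0 ?expR_gt0// lnM ?posrE ?powR_gt0 ?expR_gt0//.
    rewrite !expRK -!expRD; congr expR; rewrite /d; field; rewrite gt_eqF//.
  rewrite exprMn (_ : kap * _ = 2 ^+ n * r ^+ n * kap); last by ring.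
  rewrite -!mulrDl ler_wpM2r ?(ltW k0)// ler_wpM2r// /C1 lerD2r ler_peMl ?exprn_ge0//.
  by rewrite /L lerDr exprn_ge0.
apply: (le_trans (potential_near_le n_gt0 alpha01 mh h0 hs)).
apply: (@le_trans _ _ (\sum_(0 <= j <oo) (C1 * 2 `^ beta * s `^ alpha *
    (2 `^ (- j%:R * alpha) * Num.min (2 `^ k%:R) (2 `^ (j%:R * d))))%:E)%E).
  apply: lee_nneseries => j _.
    rewrite mule_ge0//; first by rewrite lee_fin powR_ge0.
    by apply: integral_ge0 => y _; rewrite lee_fin.
  apply: (@le_trans _ _ (((s * 2 `^ (- j.+1%:R)) `^ (- (n%:R - alpha)))%:E *
     (C1 * (s * 2 `^ (- j%:R)) ^+ n * Num.min (2 `^ k%:R) (2 `^ (j%:R * d)))%:E)%E).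
    by rewrite lee_wpmul2l// lee_fin powR_ge0.
  rewrite -EFinM lee_fin le_eqVlt; apply/orP; left; apply/eqP.
  rewrite !mulrA; congr (_ * _).
  rewrite [_ `^ _ * C1]mulrC -!mulrA; congr (C1 * _).
  rewrite -powR_mulrn ?mulr_ge0 ?powR_ge0 ?(ltW s0)//.
  rewrite !(powR_expR _ (_ : 0 < 2))// !powR_expR ?mulr_gt0 ?expR_gt0//.
  rewrite !lnM ?posrE ?expR_gt0// !expRK -!expRD; congr expR.
  by rewrite /beta -natr1; ring.
apply: nneseries_EFin_le => [j|N].
  by rewrite !mulr_ge0 ?powR_ge0 ?(ltW C10)// le_min !powR_ge0.
rewrite -mulr_sumr (_ : _ * C0 * _ * _ = C1 * 2 `^ beta * s `^ alpha *
  (C0 * 2 `^ (k%:R * (1 - alpha / d)))); last by ring.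
by rewrite ler_wpM2l// !mulr_ge0 ?powR_ge0 ?(ltW C10).
Qed.

Lemma nneseries_ge1 (u : nat -> \bar R) : (forall k, 1 <= u k)%E ->
  (\sum_(0 <= k <oo) u k = +oo)%E.
Proof.
move=> u1; have u0 k : (0 <= u k)%E by exact: le_trans (u1 k).
apply/eqyP => A A0; apply: (@le_trans _ _ (\sum_(0 <= k < (Num.truncn A).+1) u k)%E).
  apply: (@le_trans _ _ (\sum_(0 <= k < (Num.truncn A).+1) 1)%E).
    rewrite big_mkord sumEFin sumr_const card_ord lee_fin.
    exact/ltW/truncnS_gt.
  by apply: lee_sum => k _.
by apply: nneseries_lim_ge => k _ _.
Qed.

(** The inequality [q (1 - p alpha / n) <= p] is [1 / q >= 1 / p - alpha / n].  Equality
is excluded for [p = 1], where only a weak type bound holds. *)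
Definition sobolev_pair (p q : R) := p * alpha < n%:R /\
  ((p = 1 /\ q * (1 - alpha / n%:R) < 1) \/
   (1 < p /\ q * (1 - p * alpha / n%:R) <= p)).

(** If [m] is the first level whose maximal set avoids [x], then [potential_pointwise]
bounds the [q]-th power of the potential at [x] by a multiple of [2 ^ (m th)].  This is
at most the sum of [1] and of the [2 ^ ((k + 1) th)] with [x] in the [k]-th maximal set.
Integrating, [maximal_set_truncate] turns the sum into that of [layer_sum]. *)
Lemma potential_Lq (p q A : R) : 1 <= p -> 1 <= q -> sobolev_pair p q -> 0 <= A ->
  exists2 C : R, 0 < C & forall (k : body) h c s, 0 < s ->
    measurable_fun [set: 'rV[R]_n] h -> (forall y, 0 <= h y) ->
    (forall y, ~ Q k c (2 * s) y -> h y = 0) ->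
    (\int[mu]_y (h y `^ p)%:E <= (A * s ^+ n)%:E)%E ->
    (\int[mu]_(x in Q k c s) (potential alpha h x `^ q) <=
      (C * s ^+ n * s `^ (alpha * q))%:E)%E.
Proof.
move=> p1 q1 [pan pq] A0; have p0 : 0 < p by apply: lt_le_trans p1.
have q0 : 0 < q by apply: lt_le_trans q1.
have nR0 : 0 < n%:R :> R by rewrite ltr0n.
have dE : alpha / (n%:R / p) = p * alpha / n%:R by field; rewrite !gt_eqF.
have d1 : p * alpha / n%:R < 1 by rewrite ltr_pdivrMr// mul1r.
(* For p > 1 the exponent p serves; for p = 1 a smaller one is needed, as
   [layer_sum] excludes the exponent 1. *)
have [th [th0 th1 thp qth]] : exists th : R, [/\ 0 < th, th != 1, th <= p &
    q * (1 - p * alpha / n%:R) <= th].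
  case: pq => [[pE]|[p_gt1]] H; last by exists p; rewrite p0 gt_eqF//.
  exists (q * (1 - alpha / n%:R)); rewrite lt_eqF// pE mul1r; split => //.
  - by rewrite mulr_gt0// subr_gt0; rewrite pE mul1r in d1.
  - exact: ltW.
have L0 : 0 < L by rewrite /L ltr_wpDl// exprn_ge0.
have [C1 C10 HC1] := potential_pointwise p1 pan (A := A) A0.
have [C2 C20 HC2] := layer_sum p1 thp th1.
pose C3 : R := 2 ^+ n + 6 ^+ n * C2 * A.
have C30 : 0 < C3 by rewrite ltr_pwDl ?exprn_gt0// !mulr_ge0// ltW.
exists ((C1 * 3 `^ alpha) `^ q * C3); first by rewrite mulr_gt0// powR_gt0// mulr_gt0// powR_gt0.
move=> k h c s s0 mh h0 hs hp.
have s30 : 0 < 3 * s by rewrite mulr_gt0.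
pose E (i : nat) := maximal_set h (L * 2 `^ i%:R).
have mE i : measurable (E i) by exact: measurable_maximal_set.
pose t (i : nat) x : \bar R := ((2 `^ (i.+1%:R * th))%:E * (\1_(E i) x)%:E)%E.
have t0 i x : (0 <= t i x)%E by rewrite mule_ge0// lee_fin ?powR_ge0.
pose S x : \bar R := (1 + \sum_(0 <= i <oo) t i x)%E.
pose B : R := (C1 * (3 * s) `^ alpha) `^ q.
have B0 : 0 < B by rewrite powR_gt0// mulr_gt0// powR_gt0.
have mpot : measurable_fun [set: 'rV[R]_n] (fun x => potential alpha h x `^ q)%E.
  by apply: (measurableT_comp (measurable_poweR q)); exact: measurable_potential.
have mt i : measurable_fun [set: 'rV[R]_n] (t i).
  apply: emeasurable_funM; first exact: measurable_cst.
  by apply/measurable_EFinP; exact: measurable_indic.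
have mS : measurable_fun [set: 'rV[R]_n] S.
  apply: emeasurable_funD; first exact: measurable_cst.
  by apply: ge0_emeasurable_sum => // i _; exact: mt.
have mQ := measurable_Q k c s.
have pointwise x : Q k c s x -> (potential alpha h x `^ q <= B%:E * S x)%E.
  move=> xc.
  have sumt0 : (0 <= \sum_(0 <= i <oo) t i x)%E by apply: nneseries_ge0.
  have [[i Ei]|allE] := pselect (exists i, ~ E i x); last first.
    have SE : S x = +oo%E.
      rewrite /S nneseries_ge1 // => i; rewrite /t indicE.
      have [Ei|Ei] := pselect (E i x); last by exfalso; apply: allE; exists i.
      rewrite mem_set// mule1 lee_fin -[leLHS](powRr0 2) ler_powR ?ler1n//.
      by rewrite mulr_ge0// ltW.
    by rewrite SE gt0_muley ?lte_fin// leey.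
  have ex : exists i, `[< ~ E i x >] by exists i; apply/asboolP.
  case: (ex_minnP ex) => m /asboolP Em mmin {i Ei ex}.
  have hs' y : ~ Q Cube x (3 * s) y -> h y = 0.
    move=> yx; apply: hs => yc; apply: yx.
    apply: (Q_sub_cube (k := k)); move: yc xc; rewrite !QE/= => yc xc.
    rewrite (le_lt_trans (body_norm_distD k y c x))// (body_norm_distC k c x).
    by rewrite -natr1 mulrDl mul1r ltrD.
  have hp' : (\int[mu]_y (h y `^ p)%:E <= (A * (3 * s) ^+ n)%:E)%E.
    apply: (le_trans hp); rewrite lee_fin ler_wpM2l//.
    by apply: lerXn2r; rewrite ?nnegrE; lra.
  have := HC1 h x (3 * s) m s30 mh h0 hs' hp' Em.
  rewrite dE; set e := 1 - _ => Hpot.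
  have e0 : 0 <= e by rewrite /e subr_ge0 ltW.
  apply: (@le_trans _ _ ((C1 * (3 * s) `^ alpha * 2 `^ (m%:R * e))%:E `^ q)%E).
    apply: gt0_ler_poweR => //; first exact: ltW.
    - by rewrite in_itv/= leey potential_ge0.
    - by rewrite in_itv/= leey lee_fin !mulr_ge0 ?powR_ge0 ?(ltW C10).
  rewrite poweR_EFin powRM ?mulr_ge0 ?powR_ge0 ?(ltW C10)// EFinM.
  rewrite lee_wpmul2l ?lee_fin ?(ltW B0)// -powRrM.
  apply: (@le_trans _ _ (2 `^ (m%:R * th))%:E).
    by rewrite lee_fin ler_powR ?ler1n// -mulrA ler_wpM2l// mulrC.
  case: m mmin {Em Hpot} => [|m] mmin; rewrite /S.
    by rewrite mul0r powRr0 leeDl.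
  apply: (@le_trans _ _ (t m x)); last first.
    by apply: (le_trans (nneseries_term_le m (fun i => t0 i x))); rewrite leeDr.
  rewrite /t indicE mem_set ?mule1//.
  by apply: contrapT => /asboolP/mmin; rewrite ltnn.
apply: (@le_trans _ _ (\int[mu]_(x in Q k c s) (B%:E * S x))%E).
  apply: ge0_le_integral => //.
  - by move=> x _; exact: poweR_ge0.
  - exact: measurable_funTS.
  - by apply: measurable_funTS; apply: emeasurable_funM => //; exact: measurable_cst.
have S0 x : (0 <= S x)%E by rewrite adde_ge0//; apply: nneseries_ge0.
rewrite ge0_integralZl//; last 2 first.
- exact: measurable_funTS.
- by rewrite lee_fin ltW.
rewrite (_ : _ * C3 * _ * _ = B * (C3 * s ^+ n)); last first.
  rewrite /B !powRM ?mulr_ge0 ?powR_ge0 ?(ltW C10) ?(ltW s0)//.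
  by rewrite -!powRrM; ring.
rewrite EFinM; apply: lee_wpmul2l; first by rewrite lee_fin ltW.
rewrite ge0_integralD//; last 2 first.
- by move=> x _; apply: nneseries_ge0.
- by apply: measurable_funTS; apply: ge0_emeasurable_sum => // i _; exact: mt.
rewrite /C3 mulrDl EFinD; apply: leeD.
  by rewrite integral_cst// mul1e -exprMn; exact: lebesgue_Q_le.
rewrite integral_nneseries//; last by move=> i; exact: measurable_funTS.
pose g (i : nat) y := ((2 `^ (i.+1%:R * th) * (2 `^ (- i%:R) * (h y * (2 `^ i%:R < h y)%R%:R)))%:E).
have mg0 i : measurable_fun [set: 'rV[R]_n] (fun y => h y * (2 `^ i%:R < h y)%R%:R).
  apply: measurable_funM => //.
  rewrite (_ : (fun _ => _) = \1_(h @^-1` `]2 `^ i%:R, +oo[)).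
    apply: measurable_indic; rewrite -[X in measurable X]setTI.
    by apply: mh => //; exact: measurable_itv.
  by apply/funext => y; rewrite indicE; congr ((nat_of_bool _)%:R); apply/idP/idP; rewrite inE/= in_itv/= andbT.
have g0 i y : (0 <= g i y)%E by rewrite lee_fin !mulr_ge0 ?powR_ge0.
have mg i : measurable_fun [set: 'rV[R]_n] (g i).
  by apply/measurable_EFinP; do 2 (apply: measurable_funM => //).
apply: (@le_trans _ _ (\sum_(0 <= i <oo) ((6 ^+ n)%:E * \int[mu]_y g i y))%E).
  apply: lee_nneseries => i _; first by move=> _; apply: integral_ge0.
  rewrite /t [in leLHS]ge0_integralZl//; last first.
    by apply: measurable_EFin_fun; exact: measurable_indic.
  rewrite integral_indic// -[X in (_ <= _ * X)%E]/(\int[mu]_y g i y)%E.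
  rewrite /g; under [in leRHS]eq_integral do rewrite EFinM.
  rewrite ge0_integralZl//; last 2 first.
  - by apply/measurable_EFinP; apply: measurable_funM => //.
  - by move=> y _; rewrite lee_fin !mulr_ge0 ?powR_ge0.
  rewrite muleCA; apply: lee_wpmul2l; first by rewrite lee_fin powR_ge0.
  under eq_integral do rewrite EFinM.
  rewrite ge0_integralZl//; last 2 first.
  - by apply/measurable_EFinP.
  - by move=> y _; rewrite lee_fin !mulr_ge0 ?powR_ge0.
  rewrite muleA -EFinM powRN.
  apply: (@le_trans _ _ (mu (E i))).
    by rewrite le_measure ?inE//; exact: measurableI.
  by apply: maximal_set_truncate => //; rewrite powR_gt0.
rewrite nneseriesZl; last by move=> i _; exact: integral_ge0.
rewrite -!mulrA EFinM; apply: lee_wpmul2l; first by rewrite lee_fin exprn_ge0.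
rewrite -integral_nneseries// EFinM.
apply: (@le_trans _ _ (\int[mu]_y (C2%:E * (h y `^ p)%:E))%E).
  apply: ge0_le_integral => //.
  - by move=> y _; apply: nneseries_ge0.
  - by apply: ge0_emeasurable_sum => // i _; exact: mg.
  - apply: emeasurable_funM; first exact: measurable_cst.
    by apply: measurable_EFin_fun; exact: measurable_powR_fun.
  move=> y _; rewrite -EFinM; apply: nneseries_EFin_le => [i|N].
    by rewrite !mulr_ge0 ?powR_ge0.
  exact: HC2.
rewrite ge0_integralZl//; last 3 first.
- by apply: measurable_EFin_fun; exact: measurable_powR_fun.
- by move=> y _; rewrite lee_fin powR_ge0.
- by rewrite lee_fin ltW.
by apply: lee_wpmul2l => //; rewrite lee_fin ltW.
Qed.

End potential_Lq.

(** * Differences of Riesz kernels *)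

Section far_kernel.
Context {R : realType} {n : nat} (alpha : R).
Hypotheses (n_gt0 : (0 < n)%N) (alpha01 : 0 < alpha < 1).
Implicit Types (k : body) (x y z c : 'rV[R]_n) (s : R).
Local Notation mu := (lebesgue_rV n).
Let beta : R := n%:R - alpha.
Let beta_gt0 : 0 < beta := riesz_exponent_gt0 n_gt0 alpha01.

(** With [t = M / m], this reduces to [1 - t ^ (- b) <= b * ln t <= b * (t - 1)]. *)
Lemma powRN_lipschitz (b m M : R) : 0 < m -> m <= M -> 0 <= b ->
  m `^ (- b) - M `^ (- b) <= b * (M - m) * m `^ (- b - 1).
Proof.
move=> m0 mM b0; have M0 := lt_le_trans m0 mM.
pose t := M / m; have t0 : 0 < t by rewrite divr_gt0.
have ME : M = m * t by rewrite /t mulrC divfK// gt_eqF.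
have -> : M `^ (- b) = m `^ (- b) * t `^ (- b) by rewrite ME powRM ?ltW.
have -> : b * (M - m) * m `^ (- b - 1) = m `^ (- b) * (b * (t - 1)).
  by rewrite powRD_gt0// powR_inv1 ?ltW// ME; field; rewrite gt_eqF.
rewrite -[X in X - _]mulr1 -mulrBr ler_wpM2l ?powR_ge0//.
rewrite powR_expR// lerBlDl -lerBlDr (le_trans _ (expR_ge1Dx _))//.
rewrite mulNr lerD2l lerN2 ler_wpM2l//.
have := @le_ln1Dx R (t - 1); rewrite (addrC 1) subrK; apply.
by rewrite ltrBrDl addrN.
Qed.

Lemma riesz_lipschitz x y (rho : R) : 0 < rho ->
  rho <= euclidean_norm x -> rho <= euclidean_norm y ->
  `|riesz alpha x - riesz alpha y| <= beta * euclidean_norm (x - y) * rho `^ (- beta - 1).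
Proof.
move=> rho0; wlog : x y / euclidean_norm x <= euclidean_norm y.
  move=> wh rx ry; have [xy|/ltW yx] := leP (euclidean_norm x) (euclidean_norm y).
    exact: wh.
  by rewrite distrC -(euclidean_normN (x - y)) opprB; exact: wh.
move=> xy rx ry; have x0 := lt_le_trans rho0 rx.
rewrite /riesz -/beta -!powRN ger0_norm; last first.
  by rewrite subr_ge0; apply: powR_le_nexp => //; exact: ltW.
rewrite (le_trans (powRN_lipschitz x0 xy (ltW beta_gt0)))//.
apply: ler_pM.
- by apply: mulr_ge0; [exact: ltW|rewrite subr_ge0].
- exact: powR_ge0.
- rewrite ler_wpM2l ?(ltW beta_gt0)// lerBlDl.
  have := ler_euclidean_normD x (y - x).
  by rewrite addrC subrK -(euclidean_normN (x - y)) opprB.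
- rewrite -opprD; apply: powR_le_nexp; [exact: rho0|exact: rx|].
  by apply: addr_ge0 => //; exact: ltW.
Qed.

Definition far_const : R := beta * (2 * n%:R).

Lemma far_const_gt0 : 0 < far_const.
Proof. by rewrite !mulr_gt0// ltr0n. Qed.

(** If [y] is outside [Q c (2 s)], then [x - y] and [z - y] have norm at least half of
that of [y - c]. *)
Lemma riesz_far k c s x z y : 0 < s -> Q k c s x -> Q k c s z ->
  ~ Q k c (2 * s) y ->
  `|riesz alpha (x - y) - riesz alpha (z - y)| <=
    far_const * s * (body_norm k (y - c) / 2) `^ (- beta - 1).
Proof.
move=> s0; rewrite !QE/= => xc zc /negP; rewrite -leNgt => yc.
have yc0 : 0 < body_norm k (y - c) by apply: lt_le_trans yc; rewrite mulr_gt0.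
have far v : body_norm k (v - c) < s ->
    body_norm k (y - c) / 2 <= euclidean_norm (v - y).
  move=> vc; apply: le_trans (body_le_euclidean k _).
  have := body_norm_distD k y v c; rewrite (body_norm_distC k y v).
  by lra.
have := riesz_lipschitz (_ : 0 < body_norm k (y - c) / 2) (far _ xc) (far _ zc).
move=> /(_ (divr_gt0 yc0 (ltr0Sn _ _)))/le_trans; apply.
rewrite ler_wpM2r ?powR_ge0// /far_const -!mulrA ler_wpM2l ?(ltW beta_gt0)//.
rewrite opprB addrA subrK (le_trans (euclidean_le_body k _))//.
rewrite mulrCA ler_wpM2l//.
by have := body_norm_distD k x c z; rewrite (body_norm_distC k c z); lra.
Qed.

(** The bound of [riesz_far] on the [j]-th dyadic shell around [Q c (2 s)]. *)
Definition far_weight s (j : nat) : R :=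
  far_const * 2 `^ (beta + 1) * (s * (2 * s * 2 `^ j%:R) `^ (- beta - 1)).

Lemma far_weight_ge0 s j : 0 <= s -> 0 <= far_weight s j.
Proof.
by move=> s0; rewrite !mulr_ge0 ?powR_ge0// ltW ?far_const_gt0.
Qed.

Lemma far_weightE s j : 0 < s -> far_weight s j =
  far_const * (s `^ alpha * ((s * 2 `^ j%:R) `^ (- n%:R) * 2 `^ (- j%:R * (1 - alpha)))).
Proof.
move=> s0; rewrite /far_weight -!mulrA; congr (_ * _).
rewrite -[X in X * (_ `^ (- beta - 1))](powRr1 (ltW s0)).
rewrite !(powR_expR _ (_ : 0 < 2))// !powR_expR ?mulr_gt0 ?expR_gt0//.
rewrite !lnM ?posrE ?mulr_gt0 ?expR_gt0// !expRK -!expRD; do 2 congr (_ * _); congr expR.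
by rewrite /beta; ring.
Qed.

Lemma far_integral_le k c s (phi : 'rV[R]_n -> R) x z : 0 < s ->
  measurable_fun [set: 'rV[R]_n] phi -> (forall y, 0 <= phi y) ->
  Q k c s x -> Q k c s z ->
  (\int[mu]_(y in ~` Q k c (2 * s))
      (phi y * `|riesz alpha (x - y) - riesz alpha (z - y)|)%:E <=
   \sum_(0 <= j <oo) (far_weight s j)%:E *
     \int[mu]_(y in Q k c (2 * s * 2 `^ j.+1%:R)) (phi y)%:E)%E.
Proof.
move=> s0 mphi phi0 xc zc.
pose u (j : nat) y := ((far_weight s j)%:E *
  (phi y * \1_(Q k c (2 * s * 2 `^ j.+1%:R)) y)%:E)%E.
have mphi1 (j : nat) : measurable_fun [set: 'rV[R]_n]
    (fun y => phi y * \1_(Q k c (2 * s * 2 `^ j.+1%:R)) y).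
  by apply: measurable_funM => //; apply: measurable_indic; exact: measurable_Q.
have mu_ j : measurable_fun [set: 'rV[R]_n] (u j).
  by apply: emeasurable_funM; [exact: measurable_cst|exact/measurable_EFinP].
have u0 (j : nat) y : (0 <= u j y)%E.
  by rewrite mule_ge0// lee_fin ?far_weight_ge0 ?(ltW s0)// mulr_ge0.
rewrite [leRHS](_ : _ = \sum_(0 <= j <oo) \int[mu]_y u j y)%E; last first.
  apply: eq_eseriesr => j _.
  rewrite ge0_integralZl//; last 3 first.
  - exact/measurable_EFinP.
  - by move=> y _; rewrite lee_fin mulr_ge0.
  - by rewrite lee_fin far_weight_ge0// ltW.
  congr (_ * _)%E; rewrite [LHS]integral_mkcond; apply: eq_integral => y _.
  by rewrite patchE indicE; case: ifPn => _; rewrite ?mulr1 ?mulr0.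
rewrite -integral_nneseries// [leLHS]integral_mkcond.
have mC : measurable (~` Q k c (2 * s)) by apply: measurableC; exact: measurable_Q.
apply: ge0_le_integral => //.
- by move=> y _; rewrite patchE; case: ifPn => // _; rewrite lee_fin mulr_ge0.
- apply/(measurable_restrictT _ mC); apply: measurable_EFin_fun.
  apply: measurable_funM => //; apply: (measurableT_comp (@normr_measurable R setT)).
  by apply: measurable_funB; exact: measurable_riesz_sub.
- by apply: ge0_emeasurable_sum => // j _; exact: mu_.
move=> y _; rewrite patchE; case: ifPn => yc; last by apply: nneseries_ge0 => j _ _.
move: yc; rewrite inE/= => yc.
have yc2 : 2 * s <= body_norm k (y - c) by rewrite leNgt; apply/negP.
have [j /andP[j1 j2]] := dyadic_shell_above (mulr_gt0 (ltr0Sn _ _) s0) yc2.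
apply: le_trans (nneseries_term_le j (fun i => u0 i y)).
rewrite /u -EFinM lee_fin mulrCA ler_wpM2l// indicE mem_set// mulr1.
rewrite (le_trans (riesz_far s0 xc zc yc))//.
set w := 2 * s * 2 `^ j%:R.
have w0 : 0 < w by rewrite !mulr_gt0// powR_gt0.
have wE : 2 `^ (beta + 1) * w `^ (- beta - 1) = (w / 2) `^ (- beta - 1).
  rewrite !powR_expR ?divr_gt0// lnM ?posrE ?invr_gt0// lnV ?posrE// -expRD.
  by congr expR; ring.
rewrite /far_weight -/w (_ : _ * _ * (s * _) =
    far_const * s * (2 `^ (beta + 1) * w `^ (- beta - 1))); last by ring.
rewrite wE; apply: ler_wpM2l; first by rewrite mulr_ge0 ?(ltW far_const_gt0) ?ltW.
rewrite -opprD; apply: powR_le_nexp.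
- by rewrite divr_gt0.
- by rewrite ler_wpM2r.
- by rewrite addr_ge0// ltW.
Qed.

End far_kernel.

Section far_bound.
Context {R : realType} {n : nat} (alpha lam : R).
Hypotheses (n_gt0 : (0 < n)%N) (alpha01 : 0 < alpha < 1).
Implicit Types (k : body) (x y z c : 'rV[R]_n) (s : R) (phi : 'rV[R]_n -> R).
Local Notation mu := (lebesgue_rV n).

(** Exchanging the two sums leaves, for each [i], a geometric series over [j >= i - 2] of
ratio [2 ^ (alpha - 1)], which is comparable to its first term. *)
Lemma tail_sum_le : exists2 C : R, 0 < C & forall (s a W : R) (nu : nat -> R) (N : nat),
  0 < s -> 0 <= a -> (forall i, 0 <= nu i) ->
  (forall M : nat, \sum_(i < M) 2 `^ (i%:R * (lam + alpha - 1)) * nu i <= W) ->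
  \sum_(j < N) 2 `^ (- j%:R * (1 - alpha)) *
     (a + \sum_(i < j.+3) (s * 2 `^ i%:R) `^ lam * nu i)
    <= C * (a + s `^ lam * W).
Proof.
pose r : R := 2 `^ (- (1 - alpha)).
have r_gt0 : 0 < r by exact: powR_gt0.
have r1 : r < 1 by apply: powR2_lt1; rewrite oppr_lt0 subr_gt0; case/andP: alpha01.
have r01 : 0 <= r < 1 by rewrite (ltW r_gt0).
have V0 : 0 <= (1 - r)^-1 by rewrite invr_ge0 subr_ge0 ltW.
have r2 : 1 <= r ^- 2 by rewrite invf_ge1 ?exprn_gt0// exprn_ile1// ltW.
exists (r ^- 2 * (1 - r)^-1).
  by rewrite mulr_gt0 ?invr_gt0 ?exprn_gt0 ?subr_gt0.
move=> s a W nu N s0 a0 nu0 HW.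
have rE (j : nat) : 2 `^ (- j%:R * (1 - alpha)) = r ^+ j.
  by rewrite -powR_natM//; congr (_ `^ _); ring.
under eq_bigr do rewrite rE mulrDr.
rewrite big_split/= mulrDr; apply: lerD.
  rewrite -mulr_suml ler_wpM2r//.
  apply: (@le_trans _ _ ((1 - r)^-1)); last by rewrite ler_peMl.
  apply: le_trans (geo_sum_le 0 N r01); apply: ler_sum => j _.
  by rewrite subn0.
pose b (i : nat) := (s * 2 `^ i%:R) `^ lam * nu i.
have b0 i : 0 <= b i by rewrite mulr_ge0 ?powR_ge0.
apply: (@le_trans _ _ (\sum_(j < N) \sum_(i < N.+2)
    r ^- 2 * (r ^+ i * b i * (if (i <= j.+2)%N then r ^+ (j.+2 - i) else 0)))).
  apply: ler_sum => j _; rewrite mulr_sumr.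
  have jN : (j.+3 <= N.+2)%N by rewrite !ltnS.
  rewrite (big_ord_widen_cond _ xpredT (fun i => r ^+ j * b i) jN) big_mkcond.
  apply: ler_sum => i _ /=; rewrite ltnS; case: ifPn => ij; last first.
    by rewrite mulr0 mulr0.
  rewrite le_eqVlt; apply/orP; left; apply/eqP.
  rewrite (mulrAC (r ^+ i)) -exprD subnKC//.
  have -> : r ^+ j.+2 = r ^+ j * r ^+ 2 by rewrite -exprD addn2.
  by field; rewrite gt_eqF.
rewrite exchange_big/=.
apply: (@le_trans _ _ (\sum_(i < N.+2) r ^- 2 * (r ^+ i * b i) * (1 - r)^-1)).
  apply: ler_sum => i _.
  under eq_bigr do rewrite mulrA.
  rewrite -mulr_sumr ler_wpM2l//.
    apply: mulr_ge0; first by rewrite invr_ge0 exprn_ge0 ?(ltW r_gt0).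
    by apply: mulr_ge0; [rewrite exprn_ge0 ?(ltW r_gt0)|exact: b0].
  apply: le_trans (geo_sum_le i N.+2 r01).
  rewrite 2!big_ord_recl/= addrA lerDr addr_ge0//; case: ifP => // _;
    by rewrite exprn_ge0// ltW.
rewrite (_ : r ^- 2 / (1 - r) * (s `^ lam * W) = s `^ lam * W * (r ^- 2 / (1 - r))); last by ring.
rewrite (eq_bigr (fun i : 'I_N.+2 => r ^+ i * b i * (r ^- 2 / (1 - r)))); last first.
  by move=> i _; ring.
rewrite -mulr_suml ler_wpM2r ?mulr_ge0 ?invr_ge0 ?exprn_ge0 ?subr_ge0 ?(ltW r_gt0) ?(ltW r1)//.
apply: (@le_trans _ _ (s `^ lam * \sum_(i < N.+2) 2 `^ (i%:R * (lam + alpha - 1)) * nu i)); last first.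
  by rewrite ler_wpM2l ?powR_ge0.
rewrite mulr_sumr ler_sum// => i _.
rewrite le_eqVlt; apply/orP; left; apply/eqP.
rewrite /b !mulrA; congr (_ * _).
rewrite powRM ?powR_ge0 ?(ltW s0)// mulrCA; congr (_ * _).
by rewrite -rE -powRrM -powRD_gt0//; congr (_ `^ _); ring.
Qed.

(** The last hypothesis is the growth of the integrals of [phi] that [integral_chain]
provides for [phi = |f - m|], with [m] an average of [f]; the summand [a] accounts for
a constant added to [phi]. *)
Lemma far_bound : exists2 C : R, 0 < C & forall k c s phi x z a (nu : nat -> R) W,
  0 < s -> measurable_fun [set: 'rV[R]_n] phi -> (forall y, 0 <= phi y) ->
  Q k c s x -> Q k c s z -> 0 <= a -> (forall i, 0 <= nu i) ->
  (forall M : nat, \sum_(i < M) 2 `^ (i%:R * (lam + alpha - 1)) * nu i <= W) ->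
  (forall j : nat, (\int[mu]_(y in Q k c (s * 2 `^ j.+2%:R)) (phi y)%:E <=
     ((s * 2 `^ j%:R) ^+ n * (a + \sum_(i < j.+3) (s * 2 `^ i%:R) `^ lam * nu i))%:E)%E) ->
  (\int[mu]_(y in ~` Q k c (2 * s))
      (phi y * `|riesz alpha (x - y) - riesz alpha (z - y)|)%:E <=
   (C * (s `^ alpha * (a + s `^ lam * W)))%:E)%E.
Proof.
have [C C0 HC] := tail_sum_le.
have F0 : 0 < @far_const R n alpha := far_const_gt0 n_gt0 alpha01.
exists (@far_const R n alpha * C); first by rewrite mulr_gt0.
move=> k c s phi x z a nu W s0 mphi phi0 xc zc a0 nu0 HW Hphi.
apply: (le_trans (far_integral_le n_gt0 alpha01 s0 mphi phi0 xc zc)).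
apply: (@le_trans _ _ (\sum_(0 <= j <oo) (@far_const R n alpha * s `^ alpha *
   (2 `^ (- j%:R * (1 - alpha)) *
     (a + \sum_(i < j.+3) (s * 2 `^ i%:R) `^ lam * nu i)))%:E)%E).
  apply: lee_nneseries => j _.
    move=> _; rewrite mule_ge0//; last by apply: integral_ge0 => y _; rewrite lee_fin.
    by rewrite lee_fin far_weight_ge0// ltW.
  have -> : 2 * s * 2 `^ j.+1%:R = s * 2 `^ j.+2%:R.
    by rewrite -[j.+2%:R]natr1 powRD_gt0// powRr1//; ring.
  apply: le_trans (lee_wpmul2l _ (Hphi j)) _.
    by rewrite lee_fin far_weight_ge0// ltW.
  rewrite -EFinM lee_fin far_weightE//.
  have r0 : 0 < s * 2 `^ j%:R by rewrite mulr_gt0// powR_gt0.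
  rewrite -(powR_mulrn n (ltW r0)) powRN.
  rewrite le_eqVlt; apply/orP; left; apply/eqP.
  by field; rewrite gt_eqF// powR_gt0.
apply: nneseries_EFin_le => [j|N].
  apply: mulr_ge0; first by rewrite mulr_ge0 ?powR_ge0 ?(ltW F0).
  apply: mulr_ge0; first exact: powR_ge0.
  apply: addr_ge0 => //; apply: sumr_ge0 => i _.
  by apply: mulr_ge0 => //; exact: powR_ge0.
rewrite -mulr_sumr (_ : _ * C * _ = @far_const R n alpha * s `^ alpha *
  (C * (a + s `^ lam * W))); last by ring.
apply: ler_wpM2l; last exact: HC.
by apply: mulr_ge0; [exact: ltW|exact: powR_ge0].
Qed.

(** The reflection [y |-> x + z - y] exchanges the two kernels, so their difference is
odd with respect to it. *)
Lemma riesz_difference_integral0 x z :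
  (\int[mu]_y `|riesz alpha (x - y) - riesz alpha (z - y)|%:E < +oo)%E ->
  (\int[mu]_y (riesz alpha (x - y) - riesz alpha (z - y))%:E = 0)%E.
Proof.
pose D y := (riesz alpha (x - y) - riesz alpha (z - y))%:E.
have mD : measurable_fun [set: 'rV[R]_n] D.
  by apply/measurable_EFinP/measurable_funB; exact: measurable_riesz_sub.
have Dr y : D (x + z - y) = (- D y)%E.
  rewrite /D -EFinN; congr EFin; rewrite [RHS]opprB.
  have -> : x - (x + z - y) = - (z - y) by rewrite -(addrA x) opprD addrA subrr add0r.
  have -> : z - (x + z - y) = - (x - y).
    by rewrite (addrC x) -(addrA z) opprD addrA subrr add0r.
  by rewrite !riesz_opp.
move=> Dfin; rewrite integralE.
have -> : (\int[mu]_y D^\- y = \int[mu]_y D^\+ y)%E.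
  rewrite -(ge0_integral_reflect (x + z)); last 2 first.
  - exact: measurable_funeneg.
  - by move=> y; exact: funeneg_ge0.
  by apply: eq_integral => y _; rewrite funenegE funeposE Dr oppeK.
rewrite subee// ge0_fin_numE; last by apply: integral_ge0 => y _; exact: funepos_ge0.
apply: le_lt_trans Dfin; apply: ge0_le_integral => //.
- exact: measurable_funepos.
- apply/measurable_EFinP; apply: (measurableT_comp (@normr_measurable R setT)).
  by apply/measurable_EFinP.
move=> y _; rewrite funeposE /D -EFin_max lee_fin ge_max normr_ge0 andbT.
exact: ler_norm.
Qed.

End far_bound.

(** * Oscillations and averages on dilated balls *)

Section oscillations.
Context {R : realType} {n : nat}.
Hypothesis n_gt0 : (0 < n)%N.
Implicit Types (k : body) (x y z c : 'rV[R]_n) (s t p q : R) (f h : 'rV[R]_n -> R).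
Local Notation mu := (lebesgue_rV n).

Lemma measurable_dist f a : measurable_fun [set: 'rV[R]_n] f ->
  measurable_fun [set: 'rV[R]_n] (fun y => `|f y - a|).
Proof.
move=> mf; apply: (measurableT_comp (@normr_measurable R setT)).
by apply: measurable_funB => //; exact: measurable_cst.
Qed.

Lemma ge0_le_integral_fun (D : set 'rV[R]_n) h1 h2 : measurable D ->
  measurable_fun [set: 'rV[R]_n] h1 -> measurable_fun [set: 'rV[R]_n] h2 ->
  (forall y, D y -> 0 <= h1 y <= h2 y) ->
  (\int[mu]_(y in D) (h1 y)%:E <= \int[mu]_(y in D) (h2 y)%:E)%E.
Proof.
move=> mD m1 m2 h12; apply: ge0_le_integral => //.
- by move=> y /h12/andP[h10 _]; rewrite lee_fin.
- exact: measurable_EFin_fun.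
- exact: measurable_EFin_fun.
- by move=> y /h12/andP[_]; rewrite lee_fin.
Qed.

(** [ler_trade] with [kap] the L^p mean [o]; the small term added to [o] keeps [kap]
positive when [o] vanishes. *)
Lemma L1_le_of_Lp p (o V : R) (D : set 'rV[R]_n) h : 1 <= p -> 0 <= o -> 0 < V ->
  measurable D -> mu D = V%:E ->
  measurable_fun [set: 'rV[R]_n] h -> (forall y, 0 <= h y) ->
  (\int[mu]_(y in D) (h y `^ p)%:E <= (V * o `^ p)%:E)%E ->
  (\int[mu]_(y in D) (h y)%:E <= (V * (2 * o))%:E)%E.
Proof.
move=> p1 o0 V0 mD DV mh h0 hp.
have p0 : 0 < p by exact: lt_le_trans p1.
apply/lee_addgt0Pr => e e0.
pose kap := o + e / (2 * V).
have k0 : 0 < kap by rewrite ltr_wpDl// divr_gt0// mulr_gt0.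
have ok : o <= kap by rewrite lerDl divr_ge0 ?mulr_ge0// ltW.
apply: (le_trans (integral_trade p1 k0 mD mh h0)).
apply: (@le_trans _ _ (kap%:E * V%:E + (kap `^ (1 - p))%:E * (V * o `^ p)%:E)%E).
  by rewrite DV leeD2l// lee_wpmul2l// lee_fin powR_ge0.
rewrite -!EFinM -!EFinD lee_fin.
have ->: V * (2 * o) + e = kap * V + kap * V by rewrite /kap; field; rewrite gt_eqF.
rewrite lerD2l mulrCA mulrC ler_wpM2r ?(ltW V0)//.
apply: (@le_trans _ _ (kap `^ (1 - p) * kap `^ p)).
  by rewrite ler_wpM2l ?powR_ge0// ge0_ler_powR ?nnegrE ?(ltW p0) ?(ltW k0).
by rewrite -powRD_gt0// subrK powRr1// ltW.
Qed.

Lemma oscillation_integral p k c t f (o : R) : 1 <= p -> 0 < t -> 0 <= o ->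
  (oscillation p (Q k c t) f <= o%:E)%E ->
  (\int[mu]_(y in Q k c t) (`|f y - average (Q k c t) f| `^ p)%:E <=
    (vol k c t * o `^ p)%:E)%E.
Proof.
move=> p1 t0 o0; have p0 : 0 < p by exact: lt_le_trans p1.
have V0 := vol_gt0 k c n_gt0 t0.
rewrite /oscillation -/(vol k c t); set I := (\int[_]_(_ in _) _)%E => H.
have I0 : (0 <= I)%E by apply: integral_ge0 => y _; rewrite lee_fin powR_ge0.
have W0 : (0 <= ((vol k c t)^-1)%:E * I)%E.
  by rewrite mule_ge0// lee_fin invr_ge0 ltW.
have : (((((vol k c t)^-1)%:E * I) `^ p^-1) `^ p <= (o `^ p)%:E)%E.
  rewrite -poweR_EFin; apply: gt0_ler_poweR => //; first exact: ltW.
  - by rewrite in_itv/= leey poweR_ge0.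
  - by rewrite in_itv/= leey lee_fin o0.
rewrite -poweRrM mulVf ?gt_eqF// poweRe1// => VI.
rewrite EFinM; apply: le_trans (lee_wpmul2l _ VI); last by rewrite lee_fin ltW.
by rewrite muleA -EFinM mulfV ?gt_eqF// mul1e.
Qed.

Lemma oscillation_le_of_integral p k c t f (o : R) : 1 <= p -> 0 < t -> 0 <= o ->
  (\int[mu]_(y in Q k c t) (`|f y - average (Q k c t) f| `^ p)%:E <=
    (vol k c t * o `^ p)%:E)%E ->
  (oscillation p (Q k c t) f <= o%:E)%E.
Proof.
move=> p1 t0 o0 H; have p0 : 0 < p by exact: lt_le_trans p1.
have V0 := vol_gt0 k c n_gt0 t0.
rewrite /oscillation -/(vol k c t).
set I := (\int[_]_(_ in _) _)%E in H *.
have I0 : (0 <= I)%E by apply: integral_ge0 => y _; rewrite lee_fin powR_ge0.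
have VI : (((vol k c t)^-1)%:E * I <= (o `^ p)%:E)%E.
  apply: (@le_trans _ _ (((vol k c t)^-1)%:E * (vol k c t * o `^ p)%:E)%E).
    by apply: lee_wpmul2l => //; rewrite lee_fin invr_ge0 ltW.
  by rewrite -EFinM mulrA mulVf ?mul1r// gt_eqF.
apply: (@le_trans _ _ ((o `^ p)%:E `^ p^-1)%E).
  apply: gt0_ler_poweR => //; first by rewrite invr_ge0 ltW.
  - rewrite in_itv/= leey mule_ge0// lee_fin invr_ge0 ltW//.
  - by rewrite in_itv/= leey lee_fin powR_ge0.
by rewrite poweR_EFin -powRrM mulfV ?gt_eqF// powRr1.
Qed.

Lemma oscillation_integrable p k c t f (o : R) : 1 <= p -> 0 < t -> 0 <= o ->
  measurable_fun [set: 'rV[R]_n] f ->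
  (oscillation p (Q k c t) f <= o%:E)%E ->
  (\int[mu]_(y in Q k c t) (`|f y - average (Q k c t) f|)%:E <=
    (vol k c t * (2 * o))%:E)%E.
Proof.
move=> p1 t0 o0 mf H; apply: (L1_le_of_Lp p1 o0).
- exact: vol_gt0.
- exact: measurable_Q.
- exact: volE.
- exact: measurable_dist.
- by move=> y.
- exact: oscillation_integral.
Qed.

Lemma integrable_of_dist k c t f (a : R) : 0 < t ->
  measurable_fun [set: 'rV[R]_n] f ->
  (\int[mu]_(y in Q k c t) (`|f y - a|)%:E < +oo)%E ->
  mu.-integrable (Q k c t) (EFin \o f).
Proof.
move=> t0 mf H; have mQ := measurable_Q k c t.
apply/integrableP; split; first by apply/measurable_EFinP; exact: measurable_funTS.
apply: (@le_lt_trans _ _ (\int[mu]_(y in Q k c t) (`|f y - a|)%:E +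
    \int[mu]_(y in Q k c t) (`|a|)%:E)%E).
  rewrite -ge0_integralD//; last first.
    by apply: measurable_EFin_fun; exact: measurable_dist.
  apply: ge0_le_integral => //.
  - apply: measurableT_comp => //; exact: measurable_EFin_fun.
  - apply: emeasurable_funD => //; by apply: measurable_EFin_fun; exact: measurable_dist.
  by move=> y _ /=; rewrite -EFinD lee_fin -[X in `|X| <= _](subrK a) ler_normD.
rewrite lte_add_pinfty// integral_cst// lte_mul_pinfty//.
by have := lebesgue_Q_fin k c t0; rewrite ge0_fin_numE.
Qed.

Lemma average_dist_le k c t f (a : R) : 0 < t ->
  measurable_fun [set: 'rV[R]_n] f ->
  mu.-integrable (Q k c t) (EFin \o f) ->
  ((vol k c t * `|average (Q k c t) f - a|)%:E <=
     \int[mu]_(y in Q k c t) (`|f y - a|)%:E)%E.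
Proof.
move=> t0 mf If; have mQ := measurable_Q k c t.
have V0 := vol_gt0 k c n_gt0 t0.
have Ia : mu.-integrable (Q k c t) (cst a%:E).
  apply/integrableP; split => //=; rewrite integral_cst// lte_mul_pinfty//.
  by have := lebesgue_Q_fin k c t0; rewrite ge0_fin_numE.
have aE : a = (vol k c t)^-1 * \int[mu]_(y in Q k c t) a.
  rewrite Rintegral_cst// -/(vol k c t) mulrC -mulrA mulfV ?mulr1// gt_eqF//.
rewrite {1}aE /average -/(vol k c t) -mulrBr normrM gtr0_norm ?invr_gt0//.
rewrite mulrA mulfV ?gt_eqF// mul1r -RintegralB//.
have Ifa : mu.-integrable (Q k c t) (EFin \o (fun y => f y - a)).
  by have := integrableB mQ If Ia; apply: eq_integrable.
rewrite EFin_normr_Rintegral//.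
apply: (le_trans (le_abse_integral _ _ _)) => //.
by apply/measurable_EFinP; apply: measurable_funTS; apply: measurable_funB.
Qed.

End oscillations.

Section oscillation_chain.
Context {R : realType} {n : nat}.
Hypothesis n_gt0 : (0 < n)%N.
Implicit Types (k : body) (x y z c : 'rV[R]_n) (s t p q : R) (f h : 'rV[R]_n -> R).
Local Notation mu := (lebesgue_rV n).

(** Up to a factor, the average is the best constant: its distance to [a] is at most the
L^1 mean of [|f - a|]. *)
Lemma oscillation_le_dist q k c t f (a o : R) : 1 <= q -> 0 < t -> 0 <= o ->
  measurable_fun [set: 'rV[R]_n] f ->
  (\int[mu]_(y in Q k c t) (`|f y - a| `^ q)%:E <= (vol k c t * o `^ q)%:E)%E ->
  (oscillation q (Q k c t) f <= (8 * o)%:E)%E.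
Proof.
move=> q1 t0 o0 mf H; have q0 : 0 < q by exact: lt_le_trans q1.
have V0 := vol_gt0 k c n_gt0 t0.
have mQ := measurable_Q k c t.
have mfa := measurable_dist a mf.
have L1 : (\int[mu]_(y in Q k c t) (`|f y - a|)%:E <= (vol k c t * (2 * o))%:E)%E.
  apply: (L1_le_of_Lp q1 o0 V0) => //; exact: volE.
have If : mu.-integrable (Q k c t) (EFin \o f).
  by apply: (integrable_of_dist t0 mf (a := a)); rewrite (le_lt_trans L1)// ltry.
have av : `|average (Q k c t) f - a| <= 2 * o.
  have := average_dist_le n_gt0 a t0 mf If.
  by move=> /le_trans/(_ L1); rewrite lee_fin ler_pM2l.
set m := average _ _ in av *.
apply: oscillation_le_of_integral => //; first by rewrite mulr_ge0.
apply: (@le_trans _ _ (\int[mu]_(y in Q k c t)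
    (2 `^ q * (`|f y - a| `^ q + (2 * o) `^ q))%:E)%E).
  apply: ge0_le_integral_fun => //.
  - by apply: measurable_powR_fun; exact: measurable_dist.
  - apply: measurable_funM => //; apply: measurable_funD => //.
    exact: measurable_powR_fun.
  move=> y _; rewrite powR_ge0/=.
  have H1 : `|f y - m| <= `|f y - a| + 2 * o.
    rewrite -(subrKA a) (le_trans (ler_normD _ _))// lerD2l.
    by rewrite distrC.
  pose M := Num.max `|f y - a| (2 * o).
  have M0 : 0 <= M by rewrite le_max normr_ge0.
  apply: (@le_trans _ _ ((2 * M) `^ q)).
    apply: ge0_ler_powR; rewrite ?nnegrE ?mulr_ge0 ?(ltW q0)//.
    apply: (le_trans H1).
    have MA : `|f y - a| <= M by rewrite /M le_max lexx.
    have MB : 2 * o <= M by rewrite /M le_max lexx orbT.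
    lra.
  rewrite [leLHS]powRM// ler_wpM2l ?powR_ge0//.
  by rewrite /M; case: (leP `|f y - a| (2 * o)) => _; [rewrite lerDr|rewrite lerDl]; exact: powR_ge0.
under eq_integral do rewrite EFinM EFinD.
have mE : measurable_fun (Q k c t) (fun y => (`|f y - a| `^ q)%:E).
  by apply: measurable_EFin_fun; exact: measurable_powR_fun.
rewrite ge0_integralZl//; last 2 first.
- by apply: (emeasurable_funD mE); exact: measurable_cst.
- by move=> y _; rewrite adde_ge0// lee_fin powR_ge0.
rewrite ge0_integralD//; last by move=> y _; rewrite lee_fin powR_ge0.
apply: (@le_trans _ _ ((2 `^ q)%:E * ((vol k c t * o `^ q)%:E +
    ((2 * o) `^ q * vol k c t)%:E))%E).
  apply: lee_wpmul2l; first by rewrite lee_fin powR_ge0.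
  apply: leeD => //; rewrite integral_cst// EFinM -(volE k c t0)//.
rewrite -EFinD -EFinM lee_fin !powRM//.
have -> : 8 `^ q = 2 `^ q * (2 `^ q * 2 `^ q) :> R.
  by rewrite -!powRM ?mulr_ge0//; congr (_ `^ _); ring.
have q2 : 2 <= 2 `^ q :> R by rewrite le1r_powR// ler1n.
set P := 2 `^ q in q2 *; set O := o `^ q.
have O0 : 0 <= O by exact: powR_ge0.
rewrite (_ : P * (_ + _) = vol k c t * (P * (1 + P)) * O); last by ring.
rewrite [leRHS]mulrA ler_wpM2r// ler_wpM2l ?(ltW V0)//.
by rewrite ler_wpM2l; nra.
Qed.

Lemma subset_Q_pow2 k c s (i j : nat) : 0 < s -> (i <= j)%N ->
  Q k c (s * 2 `^ i%:R) `<=` Q k c (s * 2 `^ j%:R).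
Proof.
by move=> s0 ij; apply: le_Q; rewrite ler_pM2l// ler_powR ?ler1n// ler_nat.
Qed.

Definition vol_ratio : R := 2 ^+ n * n%:R ^+ n.

Lemma vol_ratio_gt0 : 0 < vol_ratio.
Proof. by rewrite mulr_gt0// exprn_gt0// ltr0n. Qed.

Lemma vol_double k c (r : R) : 0 < r -> vol k c (r * 2) <= vol_ratio * vol k c r.
Proof.
move=> r0; have r20 : 0 < r * 2 by rewrite mulr_gt0.
apply: (le_trans (vol_le k c r20)).
have nR : 0 < n%:R :> R by rewrite ltr0n.
rewrite (le_trans (y := vol_ratio * ((2 / n%:R) ^+ n * r ^+ n)))//; last first.
  by rewrite ler_wpM2l ?(ltW vol_ratio_gt0)//; exact: vol_ge.
rewrite /vol_ratio le_eqVlt; apply/orP; left; apply/eqP.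
rewrite -!exprMn; congr (_ ^+ _); field.
by rewrite gt_eqF.
Qed.

Section chain.
Context (p lam : R) (f : 'rV[R]_n -> R) (k : body) (c : 'rV[R]_n) (s : R) (nu : nat -> R).
Hypotheses (p1 : 1 <= p) (mf : measurable_fun [set: 'rV[R]_n] f) (s0 : 0 < s)
  (nu0 : forall i, 0 <= nu i).
Let B (i : nat) := Q k c (s * 2 `^ i%:R).
Let b (i : nat) := (s * 2 `^ i%:R) `^ lam * nu i.
Hypothesis osc : forall i, (oscillation p (B i) f <= (b i)%:E)%E.
Let r0 (i : nat) : 0 < s * 2 `^ i%:R. Proof. by rewrite mulr_gt0// powR_gt0. Qed.
Let b0 i : 0 <= b i. Proof. by rewrite mulr_ge0 ?powR_ge0. Qed.

Lemma chain_integrable i : mu.-integrable (B i) (EFin \o f).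
Proof.
apply: (integrable_of_dist (r0 i) mf (a := average (B i) f)).
apply: le_lt_trans (oscillation_integrable n_gt0 p1 (r0 i) (b0 i) mf (osc i)) _.
exact: ltry.
Qed.

Lemma average_step i :
  `|average (B i) f - average (B i.+1) f| <= vol_ratio * (2 * b i.+1).
Proof.
have V0 := vol_gt0 k c n_gt0 (r0 i).
rewrite -(ler_pM2l V0) -lee_fin.
have H := average_dist_le n_gt0 (average (B i.+1) f) (r0 i) mf (chain_integrable i).
apply: (le_trans H).
apply: (@le_trans _ _ (\int[mu]_(y in B i.+1) (`|f y - average (B i.+1) f|)%:E)%E).
  apply: ge0_subset_integral => //; [exact: measurable_Q|exact: measurable_Q| |].
    by apply: measurable_EFin_fun; exact: measurable_dist.
  exact: subset_Q_pow2.
apply: (le_trans (oscillation_integrable n_gt0 p1 (r0 i.+1) (b0 i.+1) mf (osc i.+1))).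
rewrite lee_fin [leRHS]mulrA; apply: ler_wpM2r; first by apply: mulr_ge0 => //; exact: b0.
rewrite [leRHS]mulrC; apply: le_trans (vol_double k c (r0 i)).
rewrite le_eqVlt; apply/orP; left; apply/eqP; congr (vol _ _ _).
by rewrite -[i.+1%:R]natr1 powRD_gt0// powRr1// mulrA.
Qed.

Lemma average_chain j : `|average (B j.+1) f - average (B 1) f| <=
  vol_ratio * (2 * \sum_(i < j.+2) b i).
Proof.
have vr := vol_ratio_gt0.
have Sge0 m : 0 <= \sum_(i < m) b i by apply: sumr_ge0 => i _.
elim: j => [|j IH].
  by rewrite subrr normr0 mulr_ge0 ?(ltW vr)// mulr_ge0.
rewrite -(subrKA (average (B j.+1) f)) (le_trans (ler_normD _ _))//.
rewrite big_ord_recr/= !mulrDr addrC lerD//.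
by rewrite distrC average_step.
Qed.

(** The averages over consecutive dilates differ by at most a multiple of an
oscillation, so comparing [f] with the average over the second ball costs the sum of
the oscillations up to that dilate. *)
Lemma integral_chain j :
  (\int[mu]_(y in B j.+1) (`|f y - average (B 1) f|)%:E <=
   (2 ^+ n * (s * 2 `^ j.+1%:R) ^+ n * ((2 + vol_ratio * 2) * \sum_(i < j.+2) b i))%:E)%E.
Proof.
have vr := vol_ratio_gt0.
have Sge0 m : 0 <= \sum_(i < m) b i by apply: sumr_ge0 => i _.
have mB i : measurable (B i) by exact: measurable_Q.
set a := average (B 1) f; set m := average (B j.+1) f.
apply: (@le_trans _ _ (\int[mu]_(y in B j.+1) (`|f y - m| + `|m - a|)%:E)%E).
  apply: ge0_le_integral_fun => //.
  - exact: measurable_dist.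
  - by apply: measurable_funD => //; exact: measurable_dist.
  by move=> y _; rewrite normr_ge0/= -(subrKA m) ler_normD.
under eq_integral do rewrite EFinD.
rewrite ge0_integralD//; last by apply: measurable_EFin_fun; exact: measurable_dist.
apply: (@le_trans _ _ ((vol k c (s * 2 `^ j.+1%:R) * (2 * b j.+1))%:E +
   (`|m - a| * vol k c (s * 2 `^ j.+1%:R))%:E)%E).
  apply: leeD; first exact: (oscillation_integrable n_gt0 p1 (r0 j.+1) (b0 j.+1) mf (osc j.+1)).
  by rewrite integral_cst// EFinM -(volE k c (r0 j.+1)).
rewrite -EFinD lee_fin.
apply: (@le_trans _ _ (vol k c (s * 2 `^ j.+1%:R) * ((2 + vol_ratio * 2) * \sum_(i < j.+2) b i))).
  rewrite [X in _ + X]mulrC -mulrDr ler_wpM2l ?(ltW (vol_gt0 k c n_gt0 (r0 j.+1)))//.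
  rewrite [leRHS]mulrDl lerD//; last by rewrite -mulrA average_chain.
  apply: ler_wpM2l => //; rewrite big_ord_recr/= lerDr; exact: Sge0.
apply: ler_wpM2r; first by rewrite mulr_ge0// addr_ge0// mulr_ge0// ltW.
by apply: vol_le.
Qed.

End chain.
End oscillation_chain.

(** * Increments and convergence of the modified fractional integral *)

Section fractional_difference.
Context {R : realType} {n : nat} (alpha : R).
Hypotheses (n_gt0 : (0 < n)%N) (alpha01 : 0 < alpha < 1).
Implicit Types (k : body) (x y z c : 'rV[R]_n) (s : R) (f h phi : 'rV[R]_n -> R).
Local Notation mu := (lebesgue_rV n).

Lemma fractional_kernelE k x y : fractional_kernel k alpha x y =
  riesz alpha (x - y) - (1 - \1_(Q k 0 1) y) * riesz alpha y.
Proof. by []. Qed.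

Lemma measurable_fractional_kernel2 k :
  measurable_fun [set: 'rV[R]_n * 'rV[R]_n] (fun u => fractional_kernel k alpha u.1 u.2).
Proof.
have m1 : measurable_fun [set: 'rV[R]_n] (\1_(Q k 0 1) : 'rV[R]_n -> R).
  by apply: measurable_indic; exact: measurable_Q.
apply: measurable_funB; first exact: measurable_riesz_sub2.
apply: measurable_funM.
  apply: measurable_funB; first exact: measurable_cst.
  exact: (measurableT_comp m1 measurable_snd).
exact: (measurableT_comp (measurable_riesz alpha) measurable_snd).
Qed.

Lemma measurable_fractional_kernel k x :
  measurable_fun [set: 'rV[R]_n] (fractional_kernel k alpha x).
Proof.
exact: (measurableT_comp (measurable_fractional_kernel2 k) (pair1_measurable x)).
Qed.

Lemma measurable_fractional_integral k f : measurable_fun [set: 'rV[R]_n] f ->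
  measurable_fun [set: 'rV[R]_n] (fractional_integral k alpha f).
Proof.
move=> mf.
pose F (u : 'rV[R]_n * 'rV[R]_n) := (f u.2 * fractional_kernel k alpha u.1 u.2)%:E.
have mF : measurable_fun [set: 'rV[R]_n * 'rV[R]_n] F.
  apply/measurable_EFinP; apply: measurable_funM; last exact: measurable_fractional_kernel2.
  by apply: (measurableT_comp mf).
have mFp := measurable_funepos mF.
have mFn := measurable_funeneg mF.
rewrite (_ : fractional_integral k alpha f = fun x =>
    fine (\int[mu]_y F^\+ (x, y) - \int[mu]_y F^\- (x, y))%E); last first.
  apply/funext => x; rewrite /fractional_integral /Rintegral integralE.
  by congr (fine (_ - _)%E); apply: eq_integral => y _; rewrite ?funeposE ?funenegE.
apply: (measurableT_comp (fine_measurable measurableT)).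
apply: emeasurable_funB.
- exact: (measurable_fun_fubini_tonelli_F (m2 := mu) _ mFp (fun u => funepos_ge0 _ u)).
- exact: (measurable_fun_fubini_tonelli_F (m2 := mu) _ mFn (fun u => funeneg_ge0 _ u)).
Qed.

(** Near [x] and [z] the difference of the kernels has no cancellation to offer, and the
two kernels are estimated separately. *)
Lemma riesz_diff_split k c s phi x z : 0 < s ->
  measurable_fun [set: 'rV[R]_n] phi -> (forall y, 0 <= phi y) ->
  (\int[mu]_y (phi y * `|riesz alpha (x - y) - riesz alpha (z - y)|)%:E <=
   potential alpha (fun y => phi y * \1_(Q k c (2 * s)) y)%R x +
   potential alpha (fun y => phi y * \1_(Q k c (2 * s)) y)%R z +
   \int[mu]_(y in ~` Q k c (2 * s))
      (phi y * `|riesz alpha (x - y) - riesz alpha (z - y)|)%:E)%E.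
Proof.
move=> s0 mphi phi0; have mQ := measurable_Q k c (2 * s).
set D := fun y => `|riesz alpha (x - y) - riesz alpha (z - y)|.
have mD : measurable_fun [set: 'rV[R]_n] D.
  apply: (measurableT_comp (@normr_measurable R setT)).
  by apply: measurable_funB; exact: measurable_riesz_sub.
have m1 : measurable_fun [set: 'rV[R]_n] (fun y => phi y * \1_(Q k c (2 * s)) y).
  by apply: measurable_funM => //; exact: measurable_indic.
have r0 v y : 0 <= riesz alpha (v - y) * (phi y * \1_(Q k c (2 * s)) y).
  by rewrite mulr_ge0 ?riesz_ge0// mulr_ge0.
rewrite -[X in (\int[_]_(_ in X) _ <= _)%E](setUv (Q k c (2 * s))).
rewrite ge0_integral_setU//; last 4 first.
- exact: measurableC.
- by rewrite setUv; apply/measurable_EFinP; exact: measurable_funM.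
- by move=> y _; rewrite lee_fin mulr_ge0.
- by apply/eqP; rewrite setICr.
apply: leeD => //; rewrite -ge0_integralD//; last 4 first.
- by move=> y _; rewrite lee_fin.
- by apply/measurable_EFinP; apply: measurable_funM => //; exact: measurable_riesz_sub.
- by move=> y _; rewrite lee_fin.
- by apply/measurable_EFinP; apply: measurable_funM => //; exact: measurable_riesz_sub.
rewrite [leLHS]integral_mkcond; apply: ge0_le_integral => //.
- by move=> y _; rewrite patchE; case: ifPn => // _; rewrite lee_fin mulr_ge0.
- apply/(measurable_restrictT _ mQ); apply: measurable_EFin_fun.
  exact: measurable_funM.
- by apply: emeasurable_funD; apply/measurable_EFinP; apply: measurable_funM => //;
    exact: measurable_riesz_sub.
move=> y _; rewrite patchE; case: ifPn => yQ; last by rewrite -EFinD lee_fin addr_ge0.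
rewrite -EFinD lee_fin indicE yQ mulr1 -mulrDl mulrC ler_wpM2r//.
rewrite /D (le_trans (ler_normB _ _))// !ger0_norm ?riesz_ge0//.
Qed.

(** Subtracting a constant from [f] does not change the increments, because the
difference of two translated kernels has zero integral. *)
Lemma fractional_integral_increment k f x z (m : R) :
  measurable_fun [set: 'rV[R]_n] f ->
  fractional_integral_cvg k alpha f x -> fractional_integral_cvg k alpha f z ->
  (\int[mu]_y `|riesz alpha (x - y) - riesz alpha (z - y)|%:E < +oo)%E ->
  (`|fractional_integral k alpha f x - fractional_integral k alpha f z|%:E <=
   \int[mu]_y (`|f y - m| * `|riesz alpha (x - y) - riesz alpha (z - y)|)%:E)%E.
Proof.
move=> mf fx fz Dfin.
pose D y := riesz alpha (x - y) - riesz alpha (z - y).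
have mD : measurable_fun [set: 'rV[R]_n] D.
  by apply: measurable_funB; exact: measurable_riesz_sub.
have int v : fractional_integral_cvg k alpha f v ->
    mu.-integrable setT (EFin \o (fun y => f y * fractional_kernel k alpha v y)).
  move=> fv; apply/integrableP; split => //.
  apply/measurable_EFinP; apply: measurable_funM => //.
  exact: measurable_fractional_kernel.
have ID : mu.-integrable setT (EFin \o D).
  by apply/integrableP; split => //; apply/measurable_EFinP.
have ImD : mu.-integrable setT (EFin \o (fun y => m * D y)).
  have := integrableZl measurableT m ID; apply: eq_integrable => //.
have IfD : mu.-integrable setT (EFin \o (fun y => f y * D y)).
  have := integrableB measurableT (int _ fx) (int _ fz); apply: eq_integrable => //.
  by move=> y _; rewrite /= -EFinB !fractional_kernelE /D; congr EFin; ring.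
rewrite /fractional_integral -RintegralB//; [|exact: int|exact: int].
have -> : \int[mu]_y (f y * fractional_kernel k alpha x y - f y * fractional_kernel k alpha z y)
    = \int[mu]_y (f y * D y - m * D y).
  rewrite [RHS]RintegralB// RintegralZl//.
  have -> : \int[mu]_y D y = 0 by rewrite /Rintegral riesz_difference_integral0.
  rewrite mulr0 subr0; apply: eq_Rintegral => y _.
  by rewrite !fractional_kernelE /D; ring.
have Id : mu.-integrable setT (EFin \o (fun y => f y * D y - m * D y)).
  by have := integrableB measurableT IfD ImD; apply: eq_integrable.
rewrite EFin_normr_Rintegral//.
apply: (le_trans (le_abse_integral _ _ _)) => //.
  by case/integrableP : Id.
rewrite le_eqVlt; apply/orP; left; apply/eqP; apply: eq_integral => y _ /=.
by rewrite -mulrBl normrM.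
Qed.

(** [potential_Lq] with both exponents equal to [1]. *)
Lemma potential_ae_lty k c s h : 0 < s -> measurable_fun [set: 'rV[R]_n] h ->
  (forall y, 0 <= h y) -> (forall y, ~ Q k c (2 * s) y -> h y = 0) ->
  (\int[mu]_y (h y)%:E < +oo)%E ->
  {ae mu, forall x, Q k c s x -> (potential alpha h x < +oo)%E}.
Proof.
move=> s0 mh h0 hs hfin.
have I0 : (0 <= \int[mu]_y (h y)%:E)%E by apply: integral_ge0 => y _; rewrite lee_fin.
pose A := fine (\int[mu]_y (h y)%:E) / s ^+ n.
have A0 : 0 <= A by rewrite divr_ge0 ?exprn_ge0 ?fine_ge0 ?(ltW s0).
have nR0 : 0 < n%:R :> R by rewrite ltr0n.
have n1 : 1 <= n%:R :> R by rewrite ler1n.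
have an : alpha < n%:R by case/andP: alpha01 => _ /lt_le_trans; apply.
have sp : @sobolev_pair R n alpha 1 1.
  split; first by rewrite mul1r.
  left; split=> //; rewrite mul1r gtrBl divr_gt0//.
  by case/andP: alpha01.
have [C C0 HC] := potential_Lq n_gt0 alpha01 (lexx 1) (lexx 1) sp A0.
have := HC k h c s s0 mh h0 hs.
have hE : (\int[mu]_y (h y `^ 1)%:E = \int[mu]_y (h y)%:E)%E.
  by apply: eq_integral => y _; rewrite powRr1.
have AE : (\int[mu]_y (h y)%:E = (A * s ^+ n)%:E)%E.
  by rewrite /A divfK ?gt_eqF ?exprn_gt0// fineK// ge0_fin_numE.
rewrite hE AE => /(_ (lexx _)) Hle.
have mp : measurable_fun (Q k c s) (potential alpha h).
  by apply: measurable_funTS; exact: measurable_potential.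
have Ip : mu.-integrable (Q k c s) (potential alpha h).
  apply/integrableP; split => //; apply: le_lt_trans (ltry _).
  apply: le_trans Hle; rewrite le_eqVlt; apply/orP; left; apply/eqP.
  by apply: eq_integral => x _; rewrite gee0_abs ?poweRe1// potential_ge0.
apply: filterS (integrable_ae (measurable_Q k c s) Ip) => x + xQ.
by move=> /(_ xQ); rewrite ge0_fin_numE// potential_ge0.
Qed.

End fractional_difference.

Section fractional_oscillation.
Context {R : realType} {n : nat} (alpha lam : R).
Hypotheses (n_gt0 : (0 < n)%N) (alpha01 : 0 < alpha < 1).
Implicit Types (k : body) (x y z c : 'rV[R]_n) (s : R) (f h phi : 'rV[R]_n -> R).
Local Notation mu := (lebesgue_rV n).

Lemma measurable_mul_indic phi (A : set 'rV[R]_n) : measurable A ->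
  measurable_fun [set: 'rV[R]_n] phi ->
  measurable_fun [set: 'rV[R]_n] (fun y => phi y * \1_A y).
Proof. by move=> mA mphi; apply: measurable_funM => //; exact: measurable_indic. Qed.

Lemma integral_mul_indic phi (A : set 'rV[R]_n) :
  (\int[mu]_y (phi y * \1_A y)%:E = \int[mu]_(y in A) (phi y)%:E)%E.
Proof.
rewrite [RHS]integral_mkcond; apply: eq_integral => y _.
by rewrite patchE indicE; case: ifPn => _; rewrite ?mulr1 ?mulr0.
Qed.

Lemma mul_indic_out phi (A : set 'rV[R]_n) y : ~ A y -> phi y * \1_A y = 0.
Proof. by move=> Ay; rewrite indicE memNset// mulr0. Qed.

Definition chain_const : R := 8 ^+ n * (2 + @vol_ratio R n * 2).

Lemma chain_const_gt0 : 0 < chain_const.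
Proof.
by rewrite mulr_gt0 ?exprn_gt0// addr_gt0// mulr_gt0// vol_ratio_gt0.
Qed.

Lemma pow4E s (j : nat) :
  2 ^+ n * (s * 2 `^ j.+2%:R) ^+ n = 8 ^+ n * (s * 2 `^ j%:R) ^+ n :> R.
Proof.
have -> : 2 `^ j.+2%:R = 4 * 2 `^ j%:R :> R.
  by rewrite !powR_mulrn// !exprS; ring.
by rewrite -!exprMn; congr (_ ^+ _); ring.
Qed.

Lemma vol_pow2_le k c s (j : nat) : 0 < s ->
  vol k c (s * 2 `^ j.+2%:R) <= (s * 2 `^ j%:R) ^+ n * 8 ^+ n.
Proof.
move=> s0; rewrite [leRHS]mulrC -pow4E; apply: vol_le.
by rewrite mulr_gt0// powR_gt0.
Qed.

Lemma riesz_difference_ae_integrable k c s : 0 < s ->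
  {ae mu, forall x, Q k c s x ->
     (potential alpha (fun y => 1 * \1_(Q k c (2 * s)) y)%R x < +oo)%E}.
Proof.
move=> s0; have mQ := measurable_Q k c (2 * s).
apply: (potential_ae_lty n_gt0 alpha01 s0).
- exact: measurable_mul_indic.
- by move=> y; rewrite mulr_ge0.
- by move=> y; exact: (mul_indic_out (fun=> 1)).
- rewrite (integral_mul_indic (fun=> 1)) integral_cst// mul1e.
  have s20 : 0 < 2 * s by rewrite mulr_gt0.
  by have := lebesgue_Q_fin k c s20; rewrite ge0_fin_numE.
Qed.

(** [far_bound] for a constant function: its averages do not grow, and [alpha < 1] makes
the kernel difference integrable at infinity. *)
Lemma riesz_difference_lty k c s x z : 0 < s -> Q k c s x -> Q k c s z ->
  (potential alpha (fun y => 1 * \1_(Q k c (2 * s)) y)%R x < +oo)%E ->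
  (potential alpha (fun y => 1 * \1_(Q k c (2 * s)) y)%R z < +oo)%E ->
  (\int[mu]_y `|riesz alpha (x - y) - riesz alpha (z - y)|%:E < +oo)%E.
Proof.
move=> s0 xc zc px pz.
have [C C0 HC] := far_bound 0 n_gt0 alpha01.
have H := HC k c s (fun=> 1) x z (8 ^+ n) (fun=> 0) 0 s0.
have {}H := H (measurable_cst _) (fun=> ler01) xc zc (exprn_ge0 n (ler0n R 8)) (fun=> lexx 0).
have := riesz_diff_split (phi := fun=> 1) alpha k c x z s0 (measurable_cst (1 : R)) (fun=> ler01).
under eq_integral do rewrite mul1r.
move=> /le_lt_trans; apply.
apply: lte_add_pinfty; first exact: (lte_add_pinfty px pz).
apply: le_lt_trans (H _ _) (ltry _).
  by move=> M; rewrite big1// => i _; rewrite mulr0.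
move=> j; rewrite integral_cst; last exact: measurable_Q.
rewrite mul1e big1 ?addr0; last by move=> i _; rewrite mulr0.
have r0 : 0 < s * 2 `^ j.+2%:R by rewrite mulr_gt0// powR_gt0.
apply: (@le_trans _ _ (vol k c (s * 2 `^ j.+2%:R))%:E); first by rewrite -(volE k c r0).
by rewrite lee_fin vol_pow2_le.
Qed.

Section data.
Context (p : R) (k : body) (c : 'rV[R]_n) (s : R) (f : 'rV[R]_n -> R) (nu : nat -> R) (W : R).
Hypotheses (p1 : 1 <= p) (s0 : 0 < s) (mf : measurable_fun [set: 'rV[R]_n] f)
  (nu0 : forall i, 0 <= nu i)
  (HW : forall M : nat, \sum_(i < M) 2 `^ (i%:R * (lam + alpha - 1)) * nu i <= W)
  (osc : forall i : nat, (oscillation p (Q k c (s * 2 `^ i%:R)) f <=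
     ((s * 2 `^ i%:R) `^ lam * nu i)%:E)%E).

Let m1 := average (Q k c (2 * s)) f.
Let Q1E : Q k c (s * 2 `^ 1%:R) = Q k c (2 * s).
Proof. by rewrite powRr1// mulrC. Qed.

Lemma chain_bound (j : nat) :
  (\int[mu]_(y in Q k c (s * 2 `^ j.+2%:R)) (`|f y - m1|)%:E <=
     ((s * 2 `^ j%:R) ^+ n *
       (0 + \sum_(i < j.+3) (s * 2 `^ i%:R) `^ lam * (chain_const * nu i)))%:E)%E.
Proof.
have := integral_chain n_gt0 p1 mf s0 nu0 osc j.+1.
rewrite Q1E => /le_trans; apply; rewrite lee_fin pow4E add0r.
rewrite le_eqVlt; apply/orP; left; apply/eqP.
under [in RHS]eq_bigr do rewrite mulrCA.
by rewrite -mulr_sumr /chain_const; ring.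
Qed.

Let HWc (M : nat) :
  \sum_(i < M) 2 `^ (i%:R * (lam + alpha - 1)) * (chain_const * nu i) <= chain_const * W.
Proof.
under eq_bigr do rewrite mulrCA.
by rewrite -mulr_sumr ler_wpM2l ?(ltW chain_const_gt0).
Qed.

Let nuc0 i : 0 <= chain_const * nu i.
Proof. by rewrite mulr_ge0// ltW// chain_const_gt0. Qed.

(** Outside [2 G] the correction in the kernel is [K (c - y)] because [c = 0] and
[1 <= s], so that part of the integral is a difference of kernels.  Inside [2 G] the
correction is bounded by [1], and what remains is a potential. *)
Lemma fractional_cvg_ae : 1 <= s -> c = 0 ->
  {ae mu, forall x, Q k c s x -> fractional_integral_cvg k alpha f x}.
Proof.
move=> s1 c0; have mQ := measurable_Q k c (2 * s).
have mnf : measurable_fun [set: 'rV[R]_n] (fun y => `|f y|).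
  exact: (measurableT_comp (@normr_measurable R setT)).
have int1 : (\int[mu]_(y in Q k c (2 * s)) (`|f y|)%:E < +oo)%E.
  have := chain_integrable n_gt0 p1 mf s0 nu0 osc 1.
  by rewrite Q1E => /integrableP[].
have pot : {ae mu, forall x, Q k c s x ->
    (potential alpha (fun y => `|f y| * \1_(Q k c (2 * s)) y)%R x < +oo)%E}.
  apply: (potential_ae_lty n_gt0 alpha01 s0).
  - exact: measurable_mul_indic.
  - by move=> y; rewrite mulr_ge0.
  - by move=> y; exact: (mul_indic_out (fun y => `|f y|)).
  - by rewrite integral_mul_indic.
apply: filterS pot => x px xc; have {}px := px xc.
have cc : Q k c s c by exact: Q_center.
pose a : R := 8 ^+ n * `|m1|.
have a0 : 0 <= a by rewrite mulr_ge0 ?exprn_ge0.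
have [C C0 HC] := far_bound lam n_gt0 alpha01.
have far := HC k c s (fun y => `|f y|) x c a _ _ s0 mnf (fun y => normr_ge0 (f y)) xc cc a0 nuc0 HWc.
have {}far : (\int[mu]_(y in ~` Q k c (2 * s))
    (`|f y| * `|riesz alpha (x - y) - riesz alpha (c - y)|)%:E < +oo)%E.
  apply: le_lt_trans (far _) (ltry _) => j.
  have mQj := measurable_Q k c (s * 2 `^ j.+2%:R).
  apply: (@le_trans _ _ (\int[mu]_(y in Q k c (s * 2 `^ j.+2%:R)) (`|f y - m1| + `|m1|)%:E)%E).
    apply: ge0_le_integral_fun => //.
    - by apply: measurable_funD => //; exact: measurable_dist.
    - by move=> y _; rewrite normr_ge0/= -[X in `|X| <= _](subrK m1) ler_normD.
  under eq_integral do rewrite EFinD.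
  rewrite ge0_integralD//; last by apply: measurable_EFin_fun; exact: measurable_dist.
  rewrite mulrDr (addrC (_ * a)%R) EFinD; apply: leeD.
    by apply: (le_trans (chain_bound j)); rewrite add0r.
  have r0 : 0 < s * 2 `^ j.+2%:R by rewrite mulr_gt0// powR_gt0.
  rewrite integral_cst//.
  apply: (@le_trans _ _ (`|m1|%:E * (vol k c (s * 2 `^ j.+2%:R))%:E)%E).
    by rewrite -(volE k c r0).
  rewrite -EFinM lee_fin mulrC /a [leRHS]mulrA ler_wpM2r//.
  exact: vol_pow2_le.
rewrite /fractional_integral_cvg.
pose G1 y := (riesz alpha (x - y) * (`|f y| * \1_(Q k c (2 * s)) y))%:E.
pose G2 y := (`|f y| * \1_(Q k c (2 * s)) y)%:E.
pose G3 y := (`|f y| * `|riesz alpha (x - y) - riesz alpha (c - y)| * \1_(~` Q k c (2 * s)) y)%:E.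
have mG1 : measurable_fun [set: 'rV[R]_n] G1.
  apply/measurable_EFinP; apply: measurable_funM; first exact: measurable_riesz_sub.
  exact: measurable_mul_indic.
have mG2 : measurable_fun [set: 'rV[R]_n] G2.
  by apply/measurable_EFinP; exact: measurable_mul_indic.
have mG3 : measurable_fun [set: 'rV[R]_n] G3.
  apply/measurable_EFinP; apply: measurable_mul_indic; first exact: measurableC.
  apply: measurable_funM => //; apply: (measurableT_comp (@normr_measurable R setT)).
  by apply: measurable_funB; exact: measurable_riesz_sub.
have G10 y : (0 <= G1 y)%E by rewrite lee_fin mulr_ge0 ?riesz_ge0// mulr_ge0.
have G20 y : (0 <= G2 y)%E by rewrite lee_fin mulr_ge0.
have G30 y : (0 <= G3 y)%E by rewrite lee_fin !mulr_ge0.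
apply: (@le_lt_trans _ _ (\int[mu]_y (G1 y + G2 y + G3 y))%E).
  apply: ge0_le_integral => //.
  - apply/measurable_EFinP; apply: (measurableT_comp (@normr_measurable R setT)).
    by apply: measurable_funM => //; exact: measurable_fractional_kernel.
  - by apply: emeasurable_funD => //; exact: emeasurable_funD.
  move=> y _; rewrite /G1 /G2 /G3 -!EFinD lee_fin fractional_kernelE normrM.
  have [yc|yc] := pselect (Q k c (2 * s) y).
    rewrite !indicE (mem_set yc) (memNset (_ : ~ (~` Q k c (2 * s)) y)); last by move=> /(_ yc).
    rewrite !mulr1 mulr0 addr0 [leLHS]mulrC [leRHS](_ : _ = (riesz alpha (x - y) + 1) * `|f y|); last by ring.
    rewrite ler_wpM2r//.
    rewrite (le_trans (ler_normB _ _))// ger0_norm ?riesz_ge0// lerD2l.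
    have [y1|y1] := pselect (Q k 0 1 y).
      by rewrite (mem_set y1) subrr mul0r normr0.
    rewrite memNset// subr0 mul1r ger0_norm ?riesz_ge0//.
    have y1' : 1 <= euclidean_norm y.
      apply: le_trans (body_le_euclidean k y).
      by rewrite leNgt; apply/negP => yy; apply: y1; rewrite QE/= subr0.
    rewrite /riesz invf_le1 ?powR_gt0 ?(lt_le_trans ltr01)//.
    rewrite -[leLHS](powRr0 (euclidean_norm y)) ler_powR//.
    exact: ltW (riesz_exponent_gt0 n_gt0 alpha01).
  rewrite !indicE (memNset yc) (mem_set (yc : (~` _) y)) !mulr0 !add0r mulr1.
  rewrite memNset; last first.
    move=> y1; apply: yc; move: y1; rewrite !QE/= c0 subr0 => /lt_le_trans; apply.
    by lra.
  by rewrite subr0 mul1r c0 sub0r riesz_opp.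
rewrite ge0_integralD//; last 2 first.
- by move=> y _; rewrite adde_ge0.
- exact: emeasurable_funD.
rewrite ge0_integralD//.
apply: lte_add_pinfty; first apply: lte_add_pinfty => //.
- by rewrite /G2 integral_mul_indic.
- by rewrite /G3 (integral_mul_indic (fun y => `|f y| * `|riesz alpha (x - y) - riesz alpha (c - y)|)).
Qed.

End data.
End fractional_oscillation.

(** * Oscillations of the modified fractional integral *)

Section fractional_oscillation_bound.
Context {R : realType} {n : nat} (alpha lam : R).
Hypotheses (n_gt0 : (0 < n)%N) (alpha01 : 0 < alpha < 1).
Implicit Types (k : body) (x y z c : 'rV[R]_n) (s : R) (f h phi : 'rV[R]_n -> R).
Local Notation mu := (lebesgue_rV n).

Definition vol_low : R := (2 / n%:R) ^+ n.

Lemma vol_low_gt0 : 0 < vol_low.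
Proof. by rewrite exprn_gt0// divr_gt0// ltr0n. Qed.

Lemma ler_powRD (q a b : R) : 0 <= q -> 0 <= a -> 0 <= b ->
  (a + b) `^ q <= 2 `^ q * (a `^ q + b `^ q).
Proof.
move=> q0 a0 b0.
have M0 : 0 <= Num.max a b by rewrite le_max a0.
apply: (@le_trans _ _ ((2 * Num.max a b) `^ q)).
  apply: ge0_ler_powR; rewrite ?nnegrE ?addr_ge0 ?mulr_ge0//.
  have MA : a <= Num.max a b by rewrite le_max lexx.
  have MB : b <= Num.max a b by rewrite le_max lexx orbT.
  lra.
rewrite [leLHS]powRM// ler_wpM2l ?powR_ge0//.
by case: (leP a b) => _; [rewrite lerDr|rewrite lerDl]; exact: powR_ge0.
Qed.

(** A function cannot exceed its mean almost everywhere. *)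
Lemma exists_good_point (q C1 : R) : 1 <= q -> 0 < C1 ->
  exists2 K : R, 0 < K & forall k c s h (P : set 'rV[R]_n), 0 < s ->
    measurable_fun [set: 'rV[R]_n] h -> (forall y, 0 <= h y) ->
    (\int[mu]_(x in Q k c s) (potential alpha h x `^ q) <=
      (C1 * s ^+ n * s `^ (alpha * q))%:E)%E ->
    {ae mu, forall x, Q k c s x -> P x} ->
    exists z, [/\ Q k c s z, P z & (potential alpha h z <= (K * s `^ alpha)%:E)%E].
Proof.
move=> q1 C10; have q0 : 0 < q by exact: lt_le_trans q1.
have vl := vol_low_gt0.
pose K0 := C1 / vol_low + 1.
have K00 : 0 < K0 by rewrite addr_gt0// divr_gt0.
exists (K0 `^ q^-1); first by rewrite powR_gt0.
move=> k c s h P s0 mh h0 Hint Pae; apply: contrapT => noz.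
have mQ := measurable_Q k c s.
have Ks0 : 0 <= K0 `^ q^-1 * s `^ alpha by rewrite mulr_ge0 ?powR_ge0.
have KE : (K0 `^ q^-1 * s `^ alpha) `^ q = K0 * s `^ (alpha * q).
  by rewrite powRM ?powR_ge0// -!powRrM mulVf ?gt_eqF// powRr1// ltW.
have mpot : measurable_fun [set: 'rV[R]_n] (fun x => potential alpha h x `^ q)%E.
  by apply: (measurableT_comp (measurable_poweR q)); exact: measurable_potential.
have : ((K0 * s `^ (alpha * q))%:E * mu (Q k c s) <=
    \int[mu]_(x in Q k c s) (potential alpha h x `^ q))%E.
  rewrite -integral_cst//; apply: ae_ge0_le_integral => //.
  - by move=> x _; rewrite lee_fin mulr_ge0 ?powR_ge0 ?(ltW K00).
  - by move=> x _; exact: poweR_ge0.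
  - exact: measurable_funTS.
  apply: filterS Pae => x Px xQ.
  have := Px xQ; rewrite -KE -poweR_EFin => {}Px.
  apply: gt0_ler_poweR; first exact: ltW.
  - by rewrite in_itv/= leey lee_fin Ks0.
  - by rewrite in_itv/= leey potential_ge0.
  by rewrite leNgt; apply/negP => /ltW Hx; apply: noz; exists x.
move=> /le_trans/(_ Hint); rewrite (volE k c s0) -EFinM lee_fin; apply/negP.
rewrite -ltNge; have sq : 0 < s `^ (alpha * q) by rewrite powR_gt0.
apply: (@lt_le_trans _ _ (K0 * s `^ (alpha * q) * (vol_low * s ^+ n))); last first.
  by rewrite ler_wpM2l ?(vol_ge k c n_gt0 s0)// mulr_ge0 ?(ltW K00) ?ltW.
rewrite (_ : K0 * _ * _ = (C1 + vol_low) * s ^+ n * s `^ (alpha * q)); last first.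
  by rewrite /K0; field; rewrite gt_eqF.
by rewrite ltr_pM2r// ltr_pM2r ?exprn_gt0// ltrDl.
Qed.

(** The quantity [nu i] is the Campanato seminorm of [f] attached to the [i]-th dilate of
the ball.  Estimating the increment from a good point [z] and taking L^q norms in [x]
bounds the L^q mean of [F - F z], which dominates the oscillation by
[oscillation_le_dist]. *)
Lemma fractional_oscillation_le (p q p0 : R) : 1 <= p -> 1 <= q -> 1 <= p0 -> p0 <= p ->
  @sobolev_pair R n alpha p0 q ->
  exists2 C : R, 0 < C & forall k c s f (nu : nat -> R) W, 0 < s -> 0 < W ->
    measurable_fun [set: 'rV[R]_n] f -> (forall i, 0 <= nu i) ->
    (forall M : nat, \sum_(i < M) 2 `^ (i%:R * (lam + alpha - 1)) * nu i <= W) ->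
    (forall i : nat, (oscillation p (Q k c (s * 2 `^ i%:R)) f <=
       ((s * 2 `^ i%:R) `^ lam * nu i)%:E)%E) ->
    {ae mu, forall x, fractional_integral_cvg k alpha f x} ->
    (oscillation q (Q k c s) (fractional_integral k alpha f) <=
       (C * (s `^ (lam + alpha) * W))%:E)%E.
Proof.
move=> p1 q1 p01 p0p sp.
have p_gt0 : 0 < p by exact: lt_le_trans p1.
have q0 : 0 < q by exact: lt_le_trans q1.
have [a_gt0 a_lt1] : 0 < alpha /\ alpha < 1 by apply/andP.
have vl := vol_low_gt0.
pose A : R := 2 * (2 ^+ n * 2 ^+ n).
have A0 : 0 <= A by rewrite !mulr_ge0 ?exprn_ge0.
have [C1 C10 HC1] := potential_Lq n_gt0 alpha01 p01 q1 sp A0.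
have [K K0 HK] := exists_good_point q1 C10.
have [C2 C20 HC2] := far_bound lam n_gt0 alpha01.
pose cc_ : R := @chain_const R n.
have cc : 0 < cc_ by exact: chain_const_gt0.
pose K2 : R := 2 * K + C2 * cc_.
have K20 : 0 < K2 by apply: addr_gt0; apply: mulr_gt0.
pose K3 : R := 2 `^ q * (2 `^ q * (C1 / vol_low) + K2 `^ q).
have K30 : 0 < K3.
  by rewrite mulr_gt0 ?powR_gt0// addr_gt0 ?powR_gt0// mulr_gt0 ?powR_gt0 ?divr_gt0.
exists (8 * K3 `^ q^-1); first by rewrite mulr_gt0// powR_gt0.
move=> k c s f nu W s0 W0 mf nu0 HW osc cvg.
have V0 := vol_gt0 k c n_gt0 s0.
have mQ := measurable_Q k c (2 * s).
have Q1E : Q k c (s * 2 `^ 1%:R) = Q k c (2 * s) by rewrite powRr1// mulrC.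
pose m1 := average (Q k c (2 * s)) f.
pose S : R := s `^ lam * W.
have S0 : 0 < S by rewrite mulr_gt0// powR_gt0.
(* [S] is the size of [f - m1] on the double ball, hence [h = g / L] is of size 1. *)
pose L : R := 2 * S.
have L0 : 0 < L by rewrite mulr_gt0.
have mfm : measurable_fun [set: 'rV[R]_n] (fun y => `|f y - m1|) by exact: measurable_dist.
pose g y := `|f y - m1| * \1_(Q k c (2 * s)) y.
have mg : measurable_fun [set: 'rV[R]_n] g by exact: measurable_mul_indic.
have g0 y : 0 <= g y by rewrite mulr_ge0.
pose h y := L^-1 * g y.
have mh : measurable_fun [set: 'rV[R]_n] h by apply: measurable_funM => //; exact: measurable_cst.
have h0 y : 0 <= h y by rewrite mulr_ge0// invr_ge0 ltW.
have hs y : ~ Q k c (2 * s) y -> h y = 0.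
  move=> yQ; rewrite /h (_ : g y = 0) ?mulr0//.
  exact: (mul_indic_out (fun y => `|f y - m1|) yQ).
(* The oscillation on the double ball is the term [i = 1] of the tail sum. *)
have b1L : (s * 2 `^ 1%:R) `^ lam * nu 1 <= L.
  have := HW 2; rewrite big_ord_recr big_ord1/= mul0r powRr0 mul1r mul1r => HW2.
  have nu1 : 2 `^ (lam + alpha - 1) * nu 1 <= W by apply: le_trans HW2; rewrite lerDr.
  rewrite powRr1// powRM// ?(ltW s0)// -mulrA /L /S [leRHS]mulrCA ler_wpM2l ?powR_ge0//.
  rewrite (_ : 2 `^ lam = 2 `^ (1 - alpha) * 2 `^ (lam + alpha - 1)); last first.
    by rewrite -powRD_gt0//; congr (_ `^ _); ring.
  rewrite -mulrA ler_pM ?mulr_ge0 ?powR_ge0//.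
  rewrite -[leRHS]powRr1// ler_powR ?ler1n// gerBl; exact: ltW.
have hp : (\int[mu]_y (h y `^ p)%:E <= (2 ^+ n * (2 * s) ^+ n)%:E)%E.
  have s20 : 0 < 2 * s by rewrite mulr_gt0.
  have H1 := oscillation_integral n_gt0 p1 (_ : 0 < s * 2 `^ 1%:R) _ (osc 1).
  have {}H1 := H1 (mulr_gt0 s0 (powR_gt0 _ (ltr0n R 2))) (mulr_ge0 (powR_ge0 _ _) (nu0 1)).
  rewrite Q1E -/m1 in H1.
  apply: (@le_trans _ _ (\int[mu]_y ((L^-1 `^ p)%:E * ((`|f y - m1| `^ p) * \1_(Q k c (2 * s)) y)%:E))%E).
    apply: ge0_le_integral => //.
    - by move=> y _; rewrite lee_fin powR_ge0.
    - by apply: measurable_EFin_fun; exact: measurable_powR_fun.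
    - apply: emeasurable_funM; first exact: measurable_cst.
      apply: measurable_EFin_fun; apply: measurable_mul_indic => //.
      exact: measurable_powR_fun.
    move=> y _; rewrite -EFinM lee_fin /h powRM ?invr_ge0 ?(ltW L0)//.
    rewrite ler_wpM2l ?powR_ge0// /g indicE; case: (y \in _) => /=.
      by rewrite !mulr1.
    by rewrite !mulr0 powR0// gt_eqF.
  rewrite ge0_integralZl//; last 2 first.
  - apply: measurable_EFin_fun; apply: measurable_mul_indic => //.
    exact: measurable_powR_fun.
  - by rewrite lee_fin powR_ge0.
  rewrite (integral_mul_indic (fun y => `|f y - m1| `^ p)).
  apply: le_trans (lee_wpmul2l _ H1) _; first by rewrite lee_fin powR_ge0.
  rewrite -EFinM lee_fin mulrCA -powRM ?invr_ge0 ?(ltW L0) ?mulr_ge0 ?powR_ge0//.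
  apply: (@le_trans _ _ (vol k c (s * 2 `^ 1%:R) * 1)); last first.
    by rewrite mulr1 powRr1// mulrC; exact: vol_le.
  rewrite ler_wpM2l ?fine_ge0//.
  rewrite (le_trans (y := 1 `^ p))//; last by rewrite powR1.
  rewrite ge0_ler_powR ?nnegrE ?mulr_ge0 ?invr_ge0 ?powR_ge0 ?(ltW L0) ?(ltW p_gt0)//.
  by rewrite mulrC ler_pdivrMr// mul1r.
(* The normalization of h makes its p-th powers have bounded mean, so the exponent
   is lowered by [h ^ p0 <= 1 + h ^ p] on the ball. *)
have hp0 : (\int[mu]_y (h y `^ p0)%:E <= (A * s ^+ n)%:E)%E.
  have p00 : 0 < p0 by exact: lt_le_trans p01.
  apply: (@le_trans _ _ (\int[mu]_y ((1 * \1_(Q k c (2 * s)) y)%:E + (h y `^ p)%:E))%E).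
    apply: ge0_le_integral => //.
    - by move=> y _; rewrite lee_fin powR_ge0.
    - by apply: measurable_EFin_fun; exact: measurable_powR_fun.
    - apply: emeasurable_funD; apply: measurable_EFin_fun; last exact: measurable_powR_fun.
      exact: measurable_mul_indic.
    move=> y _; rewrite -EFinD lee_fin.
    have [yQ|yQ] := pselect (Q k c (2 * s) y); last first.
      by rewrite hs// !powR0 ?gt_eqF// addr0 mul1r.
    rewrite indicE mem_set// mulr1; have [h1|h1] := leP (h y) 1.
      rewrite (le_trans (y := 1))//; last by rewrite lerDl powR_ge0.
      rewrite (le_trans (y := 1 `^ p0))//; last by rewrite powR1.
      by rewrite ge0_ler_powR ?nnegrE// ltW.
    by rewrite (le_trans (ler_powR (ltW h1) p0p))// lerDr.
  rewrite ge0_integralD//; last 3 first.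
  - by apply: measurable_EFin_fun; exact: measurable_mul_indic.
  - by move=> y _; rewrite lee_fin powR_ge0.
  - by apply: measurable_EFin_fun; exact: measurable_powR_fun.
  rewrite (integral_mul_indic (fun=> 1)) integral_cst// mul1e.
  apply: (@le_trans _ _ (((2 ^+ n * (2 * s) ^+ n)%:E + (2 ^+ n * (2 * s) ^+ n)%:E)%E)).
    apply: leeD => //; rewrite -exprMn; apply: lebesgue_Q_le.
    by rewrite mulr_gt0.
  rewrite -EFinD lee_fin /A exprMn.
  by rewrite le_eqVlt; apply/orP; left; apply/eqP; ring.
have Hpot := HC1 k h c s s0 mh h0 hs hp0.
have pot1 := riesz_difference_ae_integrable n_gt0 alpha01 k c s0.
have good : {ae mu, forall x, Q k c s x -> fractional_integral_cvg k alpha f x /\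
    (potential alpha (fun y => 1 * \1_(Q k c (2 * s)) y)%R x < +oo)%E}.
  by apply: filterS2 cvg pot1 => x fx px xQ; split; [exact: fx|exact: px].
have [z [zQ [zf zp] zK]] := HK k c s h _ s0 mh h0 Hpot good.
have far x : Q k c s x -> (\int[mu]_(y in ~` Q k c (2 * s))
    (`|f y - m1| * `|riesz alpha (x - y) - riesz alpha (z - y)|)%:E <=
    (C2 * cc_ * (s `^ alpha * S))%:E)%E.
  move=> xQ.
  have := HC2 k c s (fun y => `|f y - m1|) x z 0 (fun i => cc_ * nu i) (cc_ * W) s0 mfm (fun y => normr_ge0 (f y - m1)) xQ zQ (lexx 0).
  have E : C2 * (s `^ alpha * (0 + s `^ lam * (cc_ * W))) = C2 * cc_ * (s `^ alpha * S).
    by rewrite /S; ring.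
  rewrite E; apply.
  - by move=> i; rewrite mulr_ge0// ltW.
  - by move=> M; under eq_bigr do rewrite mulrCA; rewrite -mulr_sumr ler_wpM2l// ltW.
  - exact: (chain_bound n_gt0 p1 s0 mf nu0 osc).
have potg x : potential alpha g x = (L%:E * potential alpha h x)%E.
  rewrite /potential -ge0_integralZl//; last 3 first.
  - apply: measurable_EFin_fun; apply: measurable_funM => //.
    exact: measurable_riesz_sub.
  - by move=> y _; rewrite lee_fin mulr_ge0 ?riesz_ge0.
  - by rewrite lee_fin ltW.
  apply: eq_integral => y _; rewrite -EFinM /h; congr EFin; field.
  by rewrite gt_eqF.
pose F := fractional_integral k alpha f.
have mF : measurable_fun [set: 'rV[R]_n] F by exact: measurable_fractional_integral.
pose T : R := K2 * (s `^ alpha * S).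
have T0 : 0 < T by rewrite mulr_gt0// mulr_gt0// powR_gt0.
have incr : {ae mu, forall x, Q k c s x ->
    (`|F x - F z|%:E <= L%:E * potential alpha h x + T%:E)%E}.
  apply: filterS good => x Hx xQ; have [xf xp] := Hx xQ.
  have Dfin := riesz_difference_lty n_gt0 alpha01 s0 xQ zQ xp zp.
  apply: (le_trans (fractional_integral_increment m1 mf xf zf Dfin)).
  apply: (le_trans (riesz_diff_split alpha k c x z s0 mfm (fun y => normr_ge0 (f y - m1)))).
  rewrite !potg -addeA leeD2l//.
  apply: (@le_trans _ _ (L%:E * (K * s `^ alpha)%:E + (C2 * cc_ * (s `^ alpha * S))%:E)%E).
    by apply: leeD; [apply: lee_wpmul2l => //; rewrite lee_fin ltW|exact: far].
  rewrite -EFinM -EFinD lee_fin /L /T /K2.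
  by rewrite le_eqVlt; apply/orP; left; apply/eqP; ring.
have mpq : measurable_fun [set: 'rV[R]_n] (fun x => potential alpha h x `^ q)%E.
  by apply: (measurableT_comp (measurable_poweR q)); exact: measurable_potential.
pose o : R := K3 `^ q^-1 * (s `^ alpha * S).
have o0 : 0 < o by rewrite mulr_gt0 ?powR_gt0// mulr_gt0// powR_gt0.
have -> : 8 * K3 `^ q^-1 * (s `^ (lam + alpha) * W) = 8 * o.
  by rewrite /o /S powRD_gt0//; ring.
apply: (oscillation_le_dist n_gt0 (a := F z) q1 s0 (ltW o0) mF).
have mQs := measurable_Q k c s.
apply: (@le_trans _ _ (\int[mu]_(x in Q k c s)
   ((2 `^ q)%:E * ((L `^ q)%:E * potential alpha h x `^ q + (T `^ q)%:E)))%E).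
  apply: ae_ge0_le_integral => //.
  - by apply: measurable_EFin_fun; apply: measurable_powR_fun; exact: measurable_dist.
  - move=> x _; rewrite mule_ge0 ?lee_fin ?powR_ge0// adde_ge0 ?lee_fin ?powR_ge0//.
    by rewrite mule_ge0 ?poweR_ge0// lee_fin powR_ge0.
  - apply: measurable_funTS; apply: emeasurable_funM; first exact: measurable_cst.
    apply: emeasurable_funD; last exact: measurable_cst.
    by apply: emeasurable_funM => //; exact: measurable_cst.
  apply: filterS incr => x Hx xQ; move: (Hx xQ).
  have := potential_ge0 alpha x h0; case: (potential alpha h x) => [v|_ _|//].
    rewrite lee_fin => v0; rewrite -EFinM -EFinD !lee_fin => Hv.
    rewrite -[X in 2 `^ q * (X + _)]powRM ?(ltW L0)//.
    apply: le_trans (ler_powRD (ltW q0) _ (ltW T0)); last by rewrite mulr_ge0// ltW.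
    apply: ge0_ler_powR => //; [exact: ltW|rewrite nnegrE].
    by apply: addr_ge0; [apply: mulr_ge0 => //|]; exact: ltW.
  rewrite poweRyr ?gt_eqF// gt0_muley ?lte_fin ?powR_gt0// addye// gt0_muley ?lte_fin ?powR_gt0//.
  exact: leey.
have mLp : measurable_fun (Q k c s) (fun x => (L `^ q)%:E * potential alpha h x `^ q)%E.
  apply: measurable_funTS; apply: emeasurable_funM => //; exact: measurable_cst.
have Lp0 x : (0 <= (L `^ q)%:E * potential alpha h x `^ q)%E.
  by rewrite mule_ge0 ?poweR_ge0// lee_fin powR_ge0.
rewrite ge0_integralZl//; last 2 first.
- by apply: (emeasurable_funD mLp); exact: measurable_cst.
- by move=> x _; rewrite adde_ge0// lee_fin powR_ge0.
rewrite ge0_integralD//; last by move=> x _; rewrite lee_fin powR_ge0.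
rewrite ge0_integralZl//; last 3 first.
- exact: measurable_funTS.
- by move=> x _; exact: poweR_ge0.
- by rewrite lee_fin powR_ge0.
apply: (@le_trans _ _ ((2 `^ q)%:E * ((L `^ q)%:E * (C1 * s ^+ n * s `^ (alpha * q))%:E +
    (T `^ q * vol k c s)%:E))%E).
  apply: lee_wpmul2l; first by rewrite lee_fin powR_ge0.
  apply: leeD; first by apply: lee_wpmul2l => //; rewrite lee_fin powR_ge0.
  by rewrite integral_cst// EFinM -(volE k c s0).
rewrite -[((L `^ q)%:E * _)%E]EFinM -EFinD -EFinM lee_fin.
have aS : 0 <= s `^ alpha * S by rewrite mulr_ge0 ?powR_ge0// ltW.
have oq : o `^ q = K3 * (s `^ alpha * S) `^ q.
  rewrite /o (powRM q (powR_ge0 K3 q^-1) aS); congr (_ * _).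
  by rewrite -powRrM mulVf ?gt_eqF// powRr1// ltW.
have Tq : T `^ q = K2 `^ q * (s `^ alpha * S) `^ q by exact: (powRM q (ltW K20) aS).
have Lq : L `^ q * s `^ (alpha * q) = 2 `^ q * (s `^ alpha * S) `^ q.
  rewrite powRrM -(powRM q (ltW L0) (powR_ge0 s alpha)) -(powRM q (ler0n R 2) aS).
  by congr (_ `^ _); rewrite /L; ring.
rewrite oq Tq; set X := (s `^ alpha * S) `^ q in Lq *.
have X0 : 0 <= X by exact: powR_ge0.
rewrite (_ : L `^ q * _ = C1 * s ^+ n * (L `^ q * s `^ (alpha * q))); last by ring.
rewrite Lq /K3.
have sV : s ^+ n <= vol k c s / vol_low.
  by rewrite ler_pdivlMr// mulrC; exact: vol_ge.
rewrite (_ : vol k c s * _ = 2 `^ q * (C1 * (vol k c s / vol_low) * (2 `^ q * X) + K2 `^ q * X * vol k c s)); last first.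
  by ring.
rewrite ler_wpM2l ?powR_ge0// lerD2r ler_wpM2r ?mulr_ge0 ?powR_ge0//.
by rewrite ler_wpM2l// ltW.
Qed.

End fractional_oscillation_bound.

(** * Integrals of nonmeasurable functions *)

Section integral_without_measurability.
Local Open Scope ereal_scope.
Context d (T : measurableType d) (R : realType) (mu : {measure set T -> \bar R}).
Implicit Types (f g : T -> \bar R).

Import HBNNSimple.

(** The integral of a nonnegative function is a supremum over the simple functions below
it, so that monotonicity requires no measurability. *)
Lemma le_integral_any f g : (forall x, 0 <= f x) -> (forall x, f x <= g x) ->
  \int[mu]_x f x <= \int[mu]_x g x.
Proof.
move=> f0 fg; have g0 x : 0 <= g x by exact: le_trans (f0 x) (fg x).
rewrite !ge0_integralTE//; apply: ereal_sup_le => _ /= [h hf <-].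
by exists h => // x; exact: le_trans (hf x) (fg x).
Qed.

(** Multiplied by the indicator of the complement of a negligible set, a simple function
below [f] goes below [g] and keeps its integral. *)
Lemma ge0_ae_eq_integral_any f g : (forall x, 0 <= f x) -> (forall x, 0 <= g x) ->
  {ae mu, forall x, f x = g x} -> \int[mu]_x f x = \int[mu]_x g x.
Proof.
move=> f0 g0 fg.
suff le f' g' : (forall x, 0 <= f' x) -> (forall x, 0 <= g' x) ->
    {ae mu, forall x, f' x = g' x} -> \int[mu]_x f' x <= \int[mu]_x g' x.
  apply/eqP; rewrite eq_le !le//.
  by apply: filterS fg => x ->.
move=> {f0 g0 fg} f0 g0 [N [mN N0 subN]].
rewrite ge0_integralTE//; apply: ge_ereal_sup => _ /= [h hf <-].
have mNC : measurable (~` N) by exact: measurableC.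
pose h' := mul_nnsfun h (indic_nnsfun R mNC).
have h'E x : h' x = (h x * \1_(~` N) x)%R by [].
have -> : sintegral mu h = \int[mu]_x (h' x)%:E.
  rewrite -integralT_nnsfun; apply: ge0_ae_eq_integral => //.
  - by apply/measurable_EFinP; exact: measurable_funP.
  - by apply/measurable_EFinP; exact: measurable_funP.
  - by move=> x _; rewrite lee_fin.
  - by move=> x _; rewrite lee_fin.
  exists N; split => // x /= H; apply: contrapT => xN; apply: H => _.
  by rewrite -[(h x * _)%R]/(h x * \1_(~` N) x)%R indicE mem_set// mulr1.
apply: le_integral_any => x; first by rewrite lee_fin.
rewrite h'E indicE; have [xN|xN] := pselect (N x).
  by rewrite memNset ?mulr0//=; exact.
rewrite mem_set// mulr1 (_ : g' x = f' x); first exact: hf.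
by apply/esym; apply: contrapT => /subN.
Qed.

Lemma ae_eq_integral_any (D : set T) f g : {ae mu, forall x, f x = g x} ->
  \int[mu]_(x in D) f x = \int[mu]_(x in D) g x.
Proof.
move=> fg; rewrite [LHS]integral_mkcond [RHS]integral_mkcond [LHS]integralE [RHS]integralE.
congr (_ - _); apply: ge0_ae_eq_integral_any.
- by move=> x; exact: funepos_ge0.
- by move=> x; exact: funepos_ge0.
- by apply: filterS fg => x fgx; rewrite !funeposE !patchE fgx.
- by move=> x; exact: funeneg_ge0.
- by move=> x; exact: funeneg_ge0.
- by apply: filterS fg => x fgx; rewrite !funenegE !patchE fgx.
Qed.

End integral_without_measurability.

(** * The measure dr/r *)

Section dr_over_r_dilation.
Context {R : realType}.
Local Notation leb := (@lebesgue_measure R).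

Lemma measurable_dilation (a : R) :
  measurable_fun [set: measurableTypeR R] (fun t : measurableTypeR R => a * t : measurableTypeR R).
Proof. by apply: measurable_funM => //; exact: measurable_cst. Qed.

Lemma lebesgue_measure_dilation (a : R) (A : set R) : 0 < a -> measurable A ->
  (a%:E * leb ((fun t => a * t)%R @^-1` A) = leb A)%E.
Proof.
move=> a0 mA.
have md := measurable_dilation a.
pose nu := mscale (NngNum (ltW a0))
  (measure_function_pushforward__canonical__measure_function_Measure leb md).
rewrite -[LHS]/(nu A).
apply/esym; apply: (@lebesgue_measure_unique R nu) => //= _ [[b c] /= _ <-].
rewrite /nu/= /mscale/= /pushforward.
rewrite (_ : _ @^-1` _ = `]b / a, c / a]%classic); last first.
  apply/seteqP; split => x; rewrite /= !in_itv/= ltr_pdivrMr// ler_pdivlMr//;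
    by rewrite mulrC.
rewrite !lebesgue_measure_itv/= !lte_fin ltr_pM2r ?invr_gt0//.
case: ifP => // _; last by rewrite mule0.
by rewrite -!EFinD -EFinM; congr EFin; field; rewrite gt_eqF.
Qed.

Lemma dr_over_r_dilation (a : R) (A : set R) : 0 < a -> measurable A ->
  dr_over_r ((fun t => a * t)%R @^-1` A) = dr_over_r A.
Proof.
move=> a0 mA; rewrite /dr_over_r.
have md := measurable_dilation a.
pose nu := measure_function_pushforward__canonical__measure_function_Measure leb md.
have mAI : measurable (A `&` `]0, +oo[) by apply: measurableI => //; exact: measurable_itv.
have minv : measurable_fun (A `&` `]0, +oo[) (fun r : R => (r^-1)%:E).
  apply/measurable_EFinP; apply: (eq_measurable_fun (@powR R ^~ (-1))).
    move=> r; rewrite inE => -[_]/=; rewrite in_itv/= andbT => r0.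
    by rewrite powR_inv1// ltW.
  exact: (measurable_funTS (@measurable_powR R (-1))).
have inv0 r : (A `&` `]0, +oo[) r -> (0 <= (r^-1)%:E :> \bar R)%E.
  by move=> [_]/=; rewrite in_itv/= andbT => r0; rewrite lee_fin invr_ge0 ltW.
transitivity (\int[mscale (NngNum (ltW a0)) nu]_(r in A `&` `]0%R, +oo[) (r^-1)%:E)%E; last first.
  apply: eq_measure_integral => B mB _; rewrite /mscale/= /pushforward.
  exact: lebesgue_measure_dilation.
rewrite ge0_integral_mscale// ge0_integral_pushforward//; last first.
  by move=> y; rewrite inE => /inv0.
have mP : measurable ((fun t : measurableTypeR R => a * t : measurableTypeR R)%R @^-1`
    (A `&` `]0, +oo[)).
  by rewrite -[X in measurable X]setTI; exact: (measurable_dilation a).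
rewrite -ge0_integralZl//; last 2 first.
- apply: (measurable_comp mAI _ minv); last exact: measurable_funTS.
  by move=> _ [t [At t0] <-].
- by move=> t At; exact: (inv0 (a * t)).
have -> : (fun t => a * t) @^-1` A `&` `]0, +oo[%classic =
    (fun t => a * t) @^-1` (A `&` `]0, +oo[%classic).
  by apply/seteqP; split => t [At]/=; rewrite !in_itv/= !andbT pmulr_rgt0.
apply: eq_integral => t; rewrite inE/= => -[_]; rewrite in_itv/= andbT pmulr_rgt0// => t0.
by rewrite -EFinM; congr EFin; field; rewrite !gt_eqF.
Qed.

Lemma ge0_integral_dr_dilation (a : R) (g : R -> \bar R) : 0 < a ->
  measurable_fun [set: measurableTypeR R] g -> (forall r, 0 <= g r)%E ->
  (\int[dr_over_r]_r g (a * r)%R = \int[dr_over_r]_r g r)%E.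
Proof.
move=> a0 mg g0; have md := measurable_dilation a.
transitivity (\int[pushforward (@dr_over_r R)
    (fun t : measurableTypeR R => a * t : measurableTypeR R)%R]_r g r)%E.
  by rewrite ge0_integral_pushforward.
by apply: eq_measure_integral => A mA _; exact: dr_over_r_dilation.
Qed.

(** The exact value is [ln 2]. *)
Lemma dr_over_r_dyadic_ge (r : R) : 0 < r ->
  ((2^-1)%:E <= dr_over_r `[r, (2 * r)%R]%classic)%E.
Proof.
move=> r0; have r20 : 0 < 2 * r by rewrite mulr_gt0.
have rI : `[r, 2 * r]%classic `&` `]0, +oo[%classic = `[r, 2 * r]%classic :> set R.
  apply/seteqP; split => [t []//|t tr]; split => //; move: tr.
  by rewrite /= !in_itv/= andbT => /andP[/(lt_le_trans r0)].
rewrite /dr_over_r rI.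
apply: (@le_trans _ _ (\int[leb]_(t in `[r, (2 * r)%R]) ((2 * r)^-1)%:E)%E).
  rewrite integral_cst//= lebesgue_measure_itv/= lte_fin ltr_pMl// ltr1n.
  rewrite -EFinD -EFinM lee_fin.
  by rewrite le_eqVlt; apply/orP; left; apply/eqP; field; rewrite gt_eqF.
have minv : measurable_fun `[r, 2 * r]%classic (fun r : R => (r^-1)%:E).
  apply/measurable_EFinP; apply: (eq_measurable_fun (@powR R ^~ (-1))).
    move=> t; rewrite inE/= in_itv/= => /andP[rt _].
    by rewrite powR_inv1// ltW// (lt_le_trans r0).
  exact: (measurable_funTS (@measurable_powR R (-1))).
apply: ge0_le_integral => //.
- by move=> t _; rewrite lee_fin invr_ge0 ltW.
- move=> t /=; rewrite in_itv/= => /andP[rt tr].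
  by rewrite lee_fin lef_pV2 ?posrE// (lt_le_trans r0).
Qed.

End dr_over_r_dilation.

(** * Campanato norms of the modified fractional integral *)

Section campanato_theory.
Context {R : realType} {n : nat}.
Hypothesis n_gt0 : (0 < n)%N.
Implicit Types (k : body) (c : 'rV[R]_n) (s r : R) (f : 'rV[R]_n -> R).
Local Notation mu := (lebesgue_rV n).

Lemma oscillation_ge0 p G f : (0 <= oscillation p G f)%E.
Proof. exact: poweR_ge0. Qed.

Lemma le_campanato_norm k p lam (U V : set 'rV[R]_n) f : U `<=` V ->
  (campanato_norm k p lam U f <= campanato_norm k p lam V f)%E.
Proof.
move=> UV; apply: ereal_sup_le => z [x [s [s0 sU ->]]].
by exists x, s; split => //; exact: subset_trans UV.
Qed.

Lemma campanato_norm_ge0 k p lam r f : 0 < r ->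
  (0 <= campanato_norm k p lam (Q k 0 r) f)%E.
Proof.
move=> r0; apply: le_trans (ereal_sup_ubound _); last first.
  by exists 0, r; split => //.
by rewrite mule_ge0 ?oscillation_ge0// lee_fin powR_ge0.
Qed.

Lemma oscillation_le_campanato k p lam (U : set 'rV[R]_n) f c s (N : R) :
  0 < s -> Q k c s `<=` U -> (campanato_norm k p lam U f <= N%:E)%E ->
  (oscillation p (Q k c s) f <= (s `^ lam * N)%:E)%E.
Proof.
move=> s0 sU NU.
have H : ((s `^ (- lam))%:E * oscillation p (Q k c s) f <= N%:E)%E.
  by apply: le_trans NU; apply: ereal_sup_ubound; exists c, s.
rewrite EFinM; apply: le_trans (lee_wpmul2l _ H); last by rewrite lee_fin powR_ge0.
rewrite muleA -EFinM -powRD_gt0// subrr powRr0 mul1e//.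
Qed.

(** Here [s <= r] and the centre [c] has norm less than [r]. *)
Lemma Q_dyadic_sub k c s r (i : nat) : 0 < s -> Q k c s `<=` Q k 0 r ->
  Q k c (s * 2 `^ i%:R) `<=` Q k 0 (2 `^ i.+1%:R * r).
Proof.
move=> s0 sr; have sr' := Q_radius_le n_gt0 s0 sr.
have cr := Q_center_lt s0 sr.
have r0 := lt_le_trans s0 sr'.
apply: subset_Q; rewrite subr0 -[i.+1%:R]natr1 powRD_gt0// powRr1//.
have P1 : 1 <= 2 `^ i%:R :> R by rewrite -[leLHS](powRr0 2) ler_powR ?ler1n.
set P := 2 `^ i%:R in P1 *.
have : s * P <= r * P by rewrite ler_wpM2r// (le_trans _ P1).
have : r <= r * P by rewrite ler_peMr// ltW.
lra.
Qed.

Section bound.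
Context (alpha lam p q p0 : R).
Hypotheses (alpha01 : 0 < alpha < 1) (p1 : 1 <= p) (q1 : 1 <= q) (p01 : 1 <= p0)
  (p0p : p0 <= p) (sp : @sobolev_pair R n alpha p0 q).

(** [fractional_oscillation_le] on every ball contained in [Q k 0 r], all of whose dilates
are controlled by the dilates of [Q k 0 r]. *)
Lemma campanato_fractional_le : exists2 C : R, 0 < C &
  forall k f r W (N : R -> R), 0 < r -> 0 <= W ->
    measurable_fun [set: 'rV[R]_n] f ->
    (forall t, 0 < t -> campanato_norm k p lam (Q k 0 t) f = (N t)%:E) ->
    (forall M : nat, \sum_(i < M) 2 `^ (i%:R * (lam + alpha - 1)) *
        N (2 `^ i.+1%:R * r) <= W) ->
    {ae mu, forall x, fractional_integral_cvg k alpha f x} ->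
    (campanato_norm k q (lam + alpha) (Q k 0 r) (fractional_integral k alpha f)
       <= (C * W)%:E)%E.
Proof.
have [C C0 HC] := @fractional_oscillation_le R n alpha lam n_gt0 alpha01 p q p0 p1 q1 p01 p0p sp.
exists C => // k f r W N r0 W0 mf NE HW cvg.
apply: ge_ereal_sup => _ [c [s [s0 sr ->]]].
have nu0 (i : nat) : 0 <= N (2 `^ i.+1%:R * r).
  have P0 : 0 < 2 `^ i.+1%:R * r by rewrite mulr_gt0// powR_gt0.
  by rewrite -lee_fin -NE// campanato_norm_ge0.
have osc (i : nat) : (oscillation p (Q k c (s * 2 `^ i%:R)) f <=
    ((s * 2 `^ i%:R) `^ lam * N (2 `^ i.+1%:R * r))%:E)%E.
  have P0 : 0 < 2 `^ i.+1%:R * r by rewrite mulr_gt0// powR_gt0.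
  apply: (@oscillation_le_campanato k p lam (Q k 0 (2 `^ i.+1%:R * r))).
  - by rewrite mulr_gt0// powR_gt0.
  - exact: Q_dyadic_sub.
  - by rewrite NE.
(* The oscillation bound asks for a positive [W]. *)
apply/lee_addgt0Pr => e e0.
pose W' := W + e / C.
have W'0 : 0 < W' by rewrite ltr_wpDl// divr_gt0.
have HW' (M : nat) : \sum_(i < M) 2 `^ (i%:R * (lam + alpha - 1)) *
    N (2 `^ i.+1%:R * r) <= W'.
  by apply: (le_trans (HW M)); rewrite lerDl ltW// divr_gt0.
have H := HC k c s f (fun i => N (2 `^ i.+1%:R * r)) W' s0 W'0 mf nu0 HW' osc cvg.
have sm : (0 <= (s `^ (- (lam + alpha)))%:E :> \bar R)%E by rewrite lee_fin powR_ge0.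
apply: le_trans (lee_wpmul2l sm H) _.
rewrite -EFinM -EFinD lee_fin /W' le_eqVlt; apply/orP; left; apply/eqP.
have -> : s `^ (- (lam + alpha)) * (C * (s `^ (lam + alpha) * (W + e / C))) =
    (s `^ (- (lam + alpha)) * s `^ (lam + alpha)) * (C * W + e).
  by field; rewrite gt_eqF.
by rewrite -powRD_gt0// addNr powRr0 mul1r.
Qed.

(** The balls [Q k 0 m] cover the space. *)
Lemma fractional_cvg_ae_all k f (N : R -> R) : measurable_fun [set: 'rV[R]_n] f ->
  (forall t, 0 < t -> campanato_norm k p lam (Q k 0 t) f = (N t)%:E) ->
  (forall r, 1 <= r -> exists W, forall M : nat,
     \sum_(i < M) 2 `^ (i%:R * (lam + alpha - 1)) * N (2 `^ i.+1%:R * r) <= W) ->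
  {ae mu, forall x, fractional_integral_cvg k alpha f x}.
Proof.
move=> mf NE HW.
have H (m : nat) : {ae mu, forall x, Q k 0 m.+1%:R x -> fractional_integral_cvg k alpha f x}.
  have m0 : 0 < m.+1%:R :> R by [].
  have m1 : 1 <= m.+1%:R :> R by rewrite ler1n.
  have [W HWm] := HW _ m1.
  have nu0 (i : nat) : 0 <= N (2 `^ i.+1%:R * m.+1%:R).
    have P0 : 0 < 2 `^ i.+1%:R * m.+1%:R :> R by rewrite mulr_gt0// powR_gt0.
    by rewrite -lee_fin -NE// campanato_norm_ge0.
  apply: (fractional_cvg_ae (p := p) n_gt0 alpha01 p1 m0 mf nu0 HWm) => // i.
  have P0 : 0 < 2 `^ i.+1%:R * m.+1%:R :> R by rewrite mulr_gt0// powR_gt0.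
  apply: (@oscillation_le_campanato k p lam (Q k 0 (2 `^ i.+1%:R * m.+1%:R))).
  - by rewrite mulr_gt0// powR_gt0.
  - exact: Q_dyadic_sub.
  - by rewrite NE.
have := ae_foralln H; apply: filterS => x Hx.
apply: (Hx (Num.truncn (body_norm k x))).
by rewrite QE/= subr0; exact: truncnS_gt.
Qed.

(** One half of the slack [1 - (sigma + lam + alpha)] absorbs the growth allowed in the
last hypothesis, the other half makes the geometric series converge. *)
Lemma weighted_tail_sum (sigma : R) : sigma + lam + alpha < 1 ->
  exists2 C : R, 0 < C & forall (wt N : R -> R) (r b : R), 0 < r -> 0 <= b ->
    (forall t, 0 < t -> 0 < wt t) ->
    (forall t T, 0 < t -> 1 <= T -> wt t <= T `^ sigma * wt (T * t)) ->
    (forall i : nat, wt (2 `^ i.+1%:R * r) * N (2 `^ i.+1%:R * r) <=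
        2 `^ (i%:R * ((1 - (sigma + lam + alpha)) / 2)) * b) ->
    forall M : nat, \sum_(i < M) 2 `^ (i%:R * (lam + alpha - 1)) *
        N (2 `^ i.+1%:R * r) <= C * b / wt r.
Proof.
move=> sla; set d := (1 - (sigma + lam + alpha)) / 2.
have d0 : 0 < d by rewrite divr_gt0// subr_gt0.
pose rho : R := 2 `^ (- d).
have rho1 : rho < 1 by apply: powR2_lt1; rewrite oppr_lt0.
have rho0 : 0 <= rho by exact: powR_ge0.
exists (2 `^ sigma * (1 - rho)^-1); first by rewrite mulr_gt0 ?powR_gt0// invr_gt0 subr_gt0.
move=> wt N r b r0 b0 wt0 wtT HN M.
have wr := wt0 r r0.
apply: (@le_trans _ _ (\sum_(i < M) (2 `^ sigma * b / wt r) *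
    (if (0 <= i)%N then rho ^+ (i - 0) else 0))); last first.
  rewrite -mulr_sumr [leRHS](_ : _ = 2 `^ sigma * b / wt r * (1 - rho)^-1); last first.
    by field; rewrite !gt_eqF// subr_gt0.
  apply: ler_wpM2l; first by rewrite mulr_ge0 ?mulr_ge0 ?powR_ge0// invr_ge0 ltW.
  by apply: (@geo_sum_le R rho 0 M); rewrite rho0.
apply: ler_sum => i _; rewrite leq0n subn0.
set t := 2 `^ i.+1%:R * r.
have T1 : 1 <= 2 `^ i.+1%:R :> R by rewrite -[leLHS](powRr0 2) ler_powR ?ler1n.
have t0 : 0 < t by rewrite mulr_gt0// powR_gt0.
have wtt := wt0 t t0.
have Nt : N t <= 2 `^ (i%:R * d) * b * ((2 `^ i.+1%:R) `^ sigma / wt r).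
  rewrite (le_trans (y := 2 `^ (i%:R * d) * b / wt t))//.
    by rewrite ler_pdivlMr// mulrC; exact: HN.
  apply: ler_wpM2l; first by rewrite mulr_ge0// powR_ge0.
  rewrite ler_pdivlMr// mulrC ler_pdivrMr//.
  exact: wtT.
apply: le_trans (ler_wpM2l (powR_ge0 _ _) Nt) _.
rewrite /rho -powR_natM// -powRrM -[i.+1%:R]natr1.
rewrite (_ : (i%:R + 1) * sigma = sigma + i%:R * sigma); last by ring.
rewrite powRD_gt0// le_eqVlt; apply/orP; left; apply/eqP.
have -> : 2 `^ (- d * i%:R) = 2 `^ (i%:R * (lam + alpha - 1)) * 2 `^ (i%:R * d) * 2 `^ (i%:R * sigma) :> R.
  by rewrite -!powRD_gt0//; congr (_ `^ _); rewrite /d; field.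
by field; rewrite gt_eqF.
Qed.

End bound.
End campanato_theory.

(** * Weights *)

Section weight.
Context {R : realType}.

(** [Theta] is almost increasing but possibly not measurable.  The running supremum of
[Theta (r ^ tau)] is comparable to it and monotone, hence measurable. *)
Lemma regular_weight (Theta : R -> R) (sigma tau : R) : Theta_star Theta -> 0 < tau ->
  exists wt : R -> R, exists c : R, [/\ 0 < c,
    measurable_fun [set: R] wt,
    (forall r, 0 < r -> 0 < r `^ (- sigma) * Theta (r `^ tau) <= wt r),
    (forall r, 0 < r -> wt r <= c * (r `^ (- sigma) * Theta (r `^ tau))) &
    (forall r T, 0 < r -> 1 <= T -> wt r <= T `^ sigma * wt (T * r))].
Proof.
move=> [Th0 [C [e [e' [C0 /andP[e0 _] /andP[e'0 _] HTh]]]]] tau0.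
have mono s r : 0 < s -> s <= r -> Theta (s `^ tau) <= C * Theta (r `^ tau).
  move=> s0 sr; have r0 := lt_le_trans s0 sr.
  have st : 0 < s `^ tau by exact: powR_gt0.
  have rt : 0 < r `^ tau by exact: powR_gt0.
  have t1 : s `^ tau / r `^ tau <= 1.
    rewrite ler_pdivrMr// mul1r; apply: (ge0_ler_powR (ltW tau0)) => //; rewrite nnegrE; exact: ltW.
  have t0 : 0 < s `^ tau / r `^ tau by rewrite divr_gt0.
  have := HTh _ _ rt t0; rewrite divfK ?gt_eqF// ler_pdivrMr ?Th0// => /le_trans; apply.
  rewrite ler_wpM2r ?(ltW (Th0 _ rt))// ler_piMr ?(ltW C0)//.
  have pw z : 0 < z -> (s `^ tau / r `^ tau) `^ z <= 1.
    move=> z0; apply: (@le_trans _ _ (1 `^ z)); last by rewrite powR1.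
    apply: (ge0_ler_powR (ltW z0)) => //; rewrite nnegrE; exact: ltW.
  by rewrite ge_max !pw.
pose E r := [set Theta (s `^ tau) | s in [set s : R | 0 < s <= r]].
pose M r := sup (E r).
have E0 r : 0 < r -> E r !=set0.
  by move=> r0; exists (Theta (r `^ tau)), r => //=; rewrite r0 lexx.
have Eub r : ubound (E r) (C * Theta (r `^ tau)).
  by move=> _ [s /= /andP[s0 sr] <-]; exact: mono.
have Ehs r : 0 < r -> has_sup (E r).
  by move=> r0; split; [exact: E0|exists (C * Theta (r `^ tau)); exact: Eub].
have ThM r : 0 < r -> Theta (r `^ tau) <= M r.
  move=> r0; apply: ub_le_sup; first by case: (Ehs r r0).
  by exists r => //=; rewrite r0 lexx.
have MTh r : 0 < r -> M r <= C * Theta (r `^ tau).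
  by move=> r0; apply: ge_sup => //; exact: E0.
have Mnd : {homo M : r s / r <= s}.
  move=> r s rs; have [r0|r0] := ltP 0 r; last first.
    rewrite {1}/M (_ : E r = set0) ?sup0.
      have [s0|s0] := ltP 0 s; first exact: le_trans (ltW (Th0 _ (powR_gt0 _ s0))) (ThM _ s0).
      rewrite /M (_ : E s = set0) ?sup0//; apply/seteqP; split => // _ [t /= /andP[t0 ts] _].
      by have := lt_le_trans t0 (le_trans ts s0); rewrite ltxx.
    apply/seteqP; split => // _ [t /= /andP[t0 ts] _].
    by have := lt_le_trans t0 (le_trans ts r0); rewrite ltxx.
  have s0 := lt_le_trans r0 rs.
  apply: ge_sup; first exact: E0.
  move=> _ [t /= /andP[t0 tr] <-]; apply: ub_le_sup; first by case: (Ehs s s0).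
  by exists t => //=; rewrite t0 (le_trans tr).
exists (fun r => r `^ (- sigma) * M r), C; split => //.
- apply: measurable_funM; first exact: measurable_powR.
  exact: nondecreasing_measurable.
- move=> r r0; rewrite mulr_gt0 ?powR_gt0 ?Th0 ?powR_gt0//=.
  by rewrite ler_wpM2l ?powR_ge0// ThM.
- move=> r r0 /=; rewrite [leRHS]mulrCA; apply: ler_wpM2l; [exact: powR_ge0|exact: MTh].
- move=> r T r0 T1; have T0 : 0 < T by exact: lt_le_trans T1.
  rewrite /= [in leRHS]mulrA [(T * r) `^ _]powRM ?(ltW T0) ?(ltW r0)//.
  rewrite mulrA -powRD_gt0// subrr powRr0 mul1r.
  by apply: ler_wpM2l; [exact: powR_ge0|apply: Mnd; rewrite ler_peMl// ltW].
Qed.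

End weight.

(** * L^u norms against dr/r *)

Section norm_transfer.
Context {R : realType} (J : set R) (w wt : R -> R) (c sigma : R) (u : \bar R).
Hypotheses (mJ : measurable J) (J_gt0 : forall r, J r -> 0 < r)
  (J_up : forall r T, J r -> 1 <= T -> J (T * r)).
Hypotheses (u_gt0 : (0 < u)%E) (c_gt0 : 0 < c)
  (mwt : measurable_fun [set: R] wt)
  (w_wt : forall r, 0 < r -> 0 < w r <= wt r)
  (wt_w : forall r, 0 < r -> wt r <= c * w r)
  (wtT : forall r T, 0 < r -> 1 <= T -> wt r <= T `^ sigma * wt (T * r))
  (sigma_gt0 : 0 < sigma).
Implicit Types (N : R -> R) (P : R -> \bar R) (A : R).
Local Notation dr := (@dr_over_r R).
Local Notation norm P := (Lnorm dr u ((fun r => (w r)%:E * P r)%E \_ J)).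

Let dr_pos : (0 < dr [set: R])%E.
Proof.
apply: (@lt_le_trans _ _ (2^-1)%:E); first by rewrite lte_fin invr_gt0.
apply: le_trans (dr_over_r_dyadic_ge ltr01) _.
by apply: le_measure => //; rewrite inE//; exact: measurable_itv.
Qed.

(** On [[r, 2 r]] the function [w N] is at least a multiple of [wt r * N r], because [N]
increases and [wt] decreases at most by a factor; and this interval has [dr / r]
measure at least [1 / 2]. *)
Lemma norm_pointwise : exists2 C : R, 0 < C & forall N A,
  {homo N : x y / x <= y} -> (forall r, 0 <= N r) -> 0 <= A ->
  (norm (fun r => (N r)%:E) <= A%:E)%E ->
  forall r, J r -> wt r * N r <= C * A.
Proof.
have K0 : 0 < 2 `^ sigma * c by rewrite mulr_gt0// powR_gt0.
have low N r t : {homo N : x y / x <= y} -> (forall r, 0 <= N r) -> J r ->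
    r <= t <= 2 * r -> wt r * N r / (2 `^ sigma * c) <= w t * N t.
  move=> Nnd N0 Jr /andP[rt tr]; have r0 := J_gt0 Jr.
  have t0 := lt_le_trans r0 rt.
  have T1 : 1 <= t / r by rewrite ler_pdivlMr// mul1r.
  have T2 : t / r <= 2 by rewrite ler_pdivrMr.
  rewrite ler_pdivrMr//.
  have wtt : wt r <= 2 `^ sigma * (c * w t).
    apply: (le_trans (wtT r0 T1)); rewrite divfK ?gt_eqF//.
    have wtt0 : 0 < wt t by case/andP: (w_wt t0) => /lt_le_trans; apply.
    apply: ler_pM; [exact: powR_ge0|exact: ltW| |exact: wt_w].
    apply: (ge0_ler_powR (ltW sigma_gt0)); rewrite ?nnegrE//.
    by rewrite (le_trans _ T1).
  have wr0 : 0 < wt r by case/andP: (w_wt r0) => /lt_le_trans; apply.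
  rewrite (_ : w t * N t * _ = 2 `^ sigma * (c * w t) * N t); last by ring.
  by apply: ler_pM => //; [exact: ltW|exact: Nnd].
move: u u_gt0 => [v v0|_|//].
- have v_gt0 : 0 < v by rewrite -lte_fin.
  exists (2 `^ sigma * c * 2 `^ v^-1); first by rewrite mulr_gt0// powR_gt0.
  move=> N A Nnd N0 A0 + r Jr; rewrite unlock => HA.
  set a := wt r * N r / (2 `^ sigma * c).
  have r0 := J_gt0 Jr.
  have wr0 : 0 < wt r by case/andP: (w_wt r0) => /lt_le_trans; apply.
  have a0 : 0 <= a by rewrite divr_ge0 ?mulr_ge0// ltW.
  suff aA : a <= 2 `^ v^-1 * A.
    by move: aA; rewrite /a ler_pdivrMr// => /le_trans; apply; rewrite mulrC mulrA.
  set I := (\int[_]_x _)%E in HA.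
  have I0 : (0 <= I)%E by apply: integral_ge0 => x _; exact: poweR_ge0.
  have IA : (I <= (A `^ v)%:E)%E.
    have : ((I `^ v^-1) `^ v <= (A%:E) `^ v)%E.
      apply: gt0_ler_poweR => //; first exact: ltW.
      - by rewrite in_itv/= leey poweR_ge0.
      - by rewrite in_itv/= leey lee_fin A0.
    by rewrite -poweRrM mulVf ?gt_eqF// poweRe1// poweR_EFin.
  have mI : measurable `[r, (2 * r)%R]%classic by exact: measurable_itv.
  have H : ((2^-1)%:E * (a `^ v)%:E <= I)%E.
    apply: (@le_trans _ _ (\int[dr]_t (a `^ v * \1_(`[r, (2 * r)%R]%classic) t)%:E)%E).
      under eq_integral do rewrite EFinM.
      rewrite ge0_integralZl//; last 2 first.
      - by apply/measurable_EFinP; exact: measurable_indic.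
      - by rewrite lee_fin powR_ge0.
      rewrite integral_indic// setIT muleC lee_wpmul2l// ?lee_fin ?powR_ge0//.
      exact: dr_over_r_dyadic_ge.
    apply: le_integral_any => t; first by rewrite lee_fin mulr_ge0 ?powR_ge0.
    rewrite indicE; case: (boolP (t \in _)) => [|_]; last by rewrite mulr0 poweR_ge0.
    rewrite inE/= in_itv/= => /andP[rt tr].
    have Jt : J t.
      by rewrite -(divfK (lt0r_neq0 r0) t); apply: J_up => //; rewrite ler_pdivlMr// mul1r.
    have wt0 := w_wt (J_gt0 Jt).
    rewrite mulr1 patchE mem_set// -EFinM abse_EFin poweR_EFin lee_fin.
    apply: (ge0_ler_powR (ltW v_gt0)); rewrite ?nnegrE//.
    apply: le_trans (ler_norm _); apply: low => //; exact/andP.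
  have : 2^-1 * a `^ v <= A `^ v by rewrite -lee_fin EFinM; exact: le_trans H IA.
  rewrite ler_pdivrMl// => aA.
  have : (a `^ v) `^ v^-1 <= (2 * A `^ v) `^ v^-1.
    apply: ge0_ler_powR; rewrite ?nnegrE ?mulr_ge0 ?powR_ge0// invr_ge0 ltW//.
  rewrite [leRHS]powRM ?powR_ge0// -!powRrM mulfV ?gt_eqF//.
  by rewrite !powRr1.
- exists (2 `^ sigma * c) => // N A Nnd N0 A0 + r Jr; rewrite unlock dr_pos => HA.
  have r0 := J_gt0 Jr.
  have : {ae dr, forall t, (`|((fun r => (w r)%:E * (N r)%:E)%E \_ J) t| <= A%:E)%E}.
    by apply: filterS (ess_sup_ge _ _) => t /le_trans; apply; exact: HA.
  move=> [Z [mZ Z0 subZ]].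
  have [t rt tZ] : exists2 t, r <= t <= 2 * r & ~ Z t.
    apply: contrapT => noT.
    have sub : `[r, (2 * r)%R]%classic `<=` Z.
      move=> t; rewrite /= in_itv/= => rt; apply: contrapT => tZ; apply: noT.
      by exists t.
    have := dr_over_r_dyadic_ge r0.
    rewrite leNgt => /negP; apply.
    apply: (@le_lt_trans _ _ (dr Z)); last by rewrite Z0 lte_fin invr_gt0.
    by apply: le_measure => //; rewrite inE//; exact: measurable_itv.
  have rt' : r <= t by case/andP: rt.
  have Jt : J t.
    by rewrite -(divfK (lt0r_neq0 r0) t); apply: J_up => //; rewrite ler_pdivlMr// mul1r.
  have wA : w t * N t <= A.
    have : (`|((fun r => (w r)%:E * (N r)%:E)%E \_ J) t| <= A%:E)%E.
      by apply: contrapT => H; apply: tZ; exact: subZ.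
    rewrite patchE mem_set// -EFinM abse_EFin lee_fin; exact: le_trans (ler_norm _).
  have := le_trans (low N r t Nnd N0 Jr rt) wA.
  by rewrite ler_pdivrMr// [leRHS]mulrC.
Qed.

(** For finite [u = v], the hypothesis on [P] is used with [b ^ v] the sum over [i] of
[2 ^ (- i d v)] times the [v]-th power of [wt N] at [2 ^ (i + 1) r]: each term is at
most the sum, and the integral of the sum is computed termwise by dilation
invariance.  For [u = +oo] the pointwise bound gives a constant [b]. *)
Lemma norm_transfer (d Cx : R) : 0 < d -> 0 < Cx ->
  exists2 C : R, 0 < C & forall N P A,
  {homo N : x y / x <= y} -> (forall r, 0 <= N r) ->
  (forall r, 0 < r -> (0 <= P r)%E) -> 0 <= A ->
  (norm (fun r => (N r)%:E) <= A%:E)%E ->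
  (forall r b, 0 < r -> 0 <= b ->
    (forall i : nat, wt (2 `^ i.+1%:R * r) * N (2 `^ i.+1%:R * r) <= 2 `^ (i%:R * d) * b) ->
    (P r <= (Cx * b / wt r)%:E)%E) ->
  (norm P <= (C * A)%:E)%E.
Proof.
move=> d0 Cx0.
have [Cp Cp0 HCp] := norm_pointwise.
have wt_gt0 r : 0 < r -> 0 < wt r.
  by move=> /w_wt/andP[/lt_le_trans]; apply.
have Jdil (i : nat) r : J r -> J (2 `^ i.+1%:R * r).
  by move=> Jr; apply: J_up => //; rewrite -[leLHS](powRr0 2) ler_powR ?ler1n.
have wP (P : R -> \bar R) r b : 0 < r -> (0 <= P r)%E -> 0 <= b ->
    (P r <= (b / wt r)%:E)%E -> (`|(w r)%:E * P r| <= b%:E)%E.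
  move=> r0 P0 b0 Pb; have /andP[w0 wwt] := w_wt r0.
  rewrite gee0_abs; last by rewrite mule_ge0// lee_fin ltW.
  apply: le_trans (lee_wpmul2l _ Pb) _; first by rewrite lee_fin ltW.
  rewrite -EFinM lee_fin mulrA ler_pdivrMr ?wt_gt0// mulrC ler_wpM2l//.
move: HCp; move: u u_gt0 => [v v0|_|//] HCp.
- have v_gt0 : 0 < v by rewrite -lte_fin.
  pose rho : R := 2 `^ (- (d * v)).
  have rho1 : rho < 1 by apply: powR2_lt1; rewrite oppr_lt0 mulr_gt0.
  have rho0 : 0 <= rho by exact: powR_ge0.
  pose C0 := Cx `^ v * (1 - rho)^-1 * c `^ v.
  have C00 : 0 < C0 by rewrite !mulr_gt0 ?powR_gt0// invr_gt0 subr_gt0.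
  exists (C0 `^ v^-1); first by rewrite powR_gt0.
  move=> N P A Nnd N0 P0 A0; rewrite unlock => HA HP.
  set I := (\int[_]_x _)%E in HA.
  have I0 : (0 <= I)%E by apply: integral_ge0 => x _; exact: poweR_ge0.
  have IA : (I <= (A `^ v)%:E)%E.
    have : ((I `^ v^-1) `^ v <= (A%:E) `^ v)%E.
      apply: gt0_ler_poweR => //; first exact: ltW.
      - by rewrite in_itv/= leey poweR_ge0.
      - by rewrite in_itv/= leey lee_fin A0.
    by rewrite -poweRrM mulVf ?gt_eqF// poweRe1// poweR_EFin.
  pose phi r := wt r * N r * \1_J r.
  have phi0 r : 0 <= phi r.
    rewrite /phi indicE; case: (boolP (r \in J)) => [|_]; last by rewrite mulr0.
    by rewrite inE => /J_gt0 r0; rewrite !mulr_ge0// ltW// wt_gt0.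
  have mphi : measurable_fun [set: R] (fun r => phi r `^ v).
    apply: (measurableT_comp (measurable_powR v)).
    apply: measurable_funM; last exact: measurable_indic.
    by apply: measurable_funM => //; exact: nondecreasing_measurable.
  have mphiE : measurable_fun [set: R] (fun r => (phi r `^ v)%:E) by exact/measurable_EFinP.
  have intphi : (\int[dr]_r (phi r `^ v)%:E <= (c `^ v * A `^ v)%:E)%E.
    have cv0 : 0 < c `^ v by rewrite powR_gt0.
    have H : (((c `^ v)^-1)%:E * \int[dr]_r (phi r `^ v)%:E <= I)%E.
      rewrite -ge0_integralZl//; last 2 first.
      - by move=> r _; rewrite lee_fin powR_ge0.
      - by rewrite lee_fin invr_ge0 ltW.
      apply: le_integral_any => r.
        by rewrite -EFinM lee_fin mulr_ge0 ?powR_ge0// invr_ge0 ltW.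
      rewrite /phi indicE patchE; case: (boolP (r \in J)) => [|_]; last first.
        by rewrite mulr0 powR0 ?gt_eqF// mule0 poweR_ge0.
      rewrite inE => Jr; have r0 := J_gt0 Jr; have /andP[w0 _] := w_wt r0.
      rewrite mulr1 -!EFinM abse_EFin poweR_EFin lee_fin ler_pdivrMl//.
      rewrite -powRM ?(ltW c_gt0)//; apply: (ge0_ler_powR (ltW v_gt0)).
      - by rewrite nnegrE mulr_ge0// ltW// wt_gt0.
      - by rewrite nnegrE mulr_ge0// ltW.
      rewrite ger0_norm ?mulr_ge0 ?(ltW w0)// mulrA ler_wpM2r//.
      exact: wt_w.
    have := le_trans H IA => {}H.
    have := lee_wpmul2l (_ : (0 <= (c `^ v)%:E)%E) H.
    rewrite lee_fin (ltW cv0) => /(_ isT).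
    by rewrite muleA -EFinM mulfV ?gt_eqF// mul1e -EFinM.
  pose S r := (\sum_(0 <= i <oo) (rho ^+ i)%:E * (phi (2 `^ i.+1%:R * r) `^ v)%:E)%E.
  have t0 (i : nat) r : (0 <= (rho ^+ i)%:E * (phi (2 `^ i.+1%:R * r) `^ v)%:E)%E.
    by rewrite -EFinM lee_fin mulr_ge0 ?exprn_ge0 ?powR_ge0.
  have S0 r : (0 <= S r)%E by apply: nneseries_ge0 => i _ _; exact: t0.
  have key r : (`|((fun r => (w r)%:E * P r)%E \_ J) r| `^ v <= (Cx `^ v)%:E * S r)%E.
    rewrite patchE; case: (boolP (r \in J)) => [|_]; last first.
      rewrite abse0 poweR0r ?gt_eqF// mule_ge0// lee_fin powR_ge0//.
    rewrite inE => Jr; have r0 := J_gt0 Jr.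
    have [Sfin|Sinf] := ltP (S r) +oo%E; last first.
      move: Sinf; rewrite leye_eq => /eqP ->.
      by rewrite gt0_muley ?lte_fin ?powR_gt0// leey.
    have SE : S r = (fine (S r))%:E by rewrite fineK// ge0_fin_numE.
    set b := fine (S r) `^ v^-1.
    have fS0 : 0 <= fine (S r) by rewrite fine_ge0.
    have b0 : 0 <= b by exact: powR_ge0.
    have Hi (i : nat) : wt (2 `^ i.+1%:R * r) * N (2 `^ i.+1%:R * r) <= 2 `^ (i%:R * d) * b.
      have := nneseries_term_le i (fun j => t0 j r); rewrite -/(S r) SE -EFinM lee_fin.
      rewrite /phi indicE mem_set ?mulr1; last exact: Jdil.
      set a := wt _ * N _ => Ha.
      have a0 : 0 <= a.
        by rewrite mulr_ge0// ltW// wt_gt0// mulr_gt0// powR_gt0.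
      have E1 : rho ^+ i * a `^ v = (2 `^ (- (i%:R * d)) * a) `^ v.
        rewrite powRM ?powR_ge0// /rho -powR_natM// -powRrM; congr (_ `^ _ * _).
        by ring.
      have : ((2 `^ (- (i%:R * d)) * a) `^ v) `^ v^-1 <= b.
        rewrite -E1; apply: ge0_ler_powR => //; rewrite ?nnegrE ?invr_ge0 ?(ltW v_gt0)//.
        by rewrite mulr_ge0 ?exprn_ge0 ?powR_ge0.
      rewrite -powRrM mulfV ?gt_eqF// powRr1 ?(mulr_ge0 (powR_ge0 _ _) a0)//.
      by rewrite powRN ler_pdivrMl ?powR_gt0.
    have Pb := HP r b r0 b0 Hi.
    have := wP P r (Cx * b) r0 (P0 r r0) (mulr_ge0 (ltW Cx0) b0) Pb => H.
    apply: (@le_trans _ _ ((Cx * b)%:E `^ v)%E).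
      apply: gt0_ler_poweR => //; first exact: ltW.
      - by rewrite in_itv/= leey abse_ge0.
      - by rewrite in_itv/= leey lee_fin mulr_ge0// ltW.
    rewrite poweR_EFin powRM ?(ltW Cx0)// EFinM lee_wpmul2l ?lee_fin ?powR_ge0//.
    by rewrite SE lee_fin /b -powRrM mulVf ?gt_eqF// powRr1.
  have mti (i : nat) : measurable_fun [set: R] (fun r => ((rho ^+ i)%:E * (phi (2 `^ i.+1%:R * r) `^ v)%:E)%E).
    apply: emeasurable_funM; first exact: measurable_cst.
    exact: (measurableT_comp mphiE (measurable_dilation (2 `^ i.+1%:R))).
  have mS : measurable_fun [set: R] S.
    by apply: ge0_emeasurable_sum => // i _; exact: mti.
  have IP : (\int[dr]_r (`|((fun r => (w r)%:E * P r)%E \_ J) r| `^ v) <= (C0 * A `^ v)%:E)%E.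
    apply: (@le_trans _ _ (\int[dr]_r ((Cx `^ v)%:E * S r))%E).
      by apply: le_integral_any => r; [exact: poweR_ge0|exact: key].
    rewrite ge0_integralZl//; last by rewrite lee_fin powR_ge0.
    rewrite integral_nneseries//.
    rewrite (_ : C0 * _ = Cx `^ v * ((1 - rho)^-1 * (c `^ v * A `^ v))); last by rewrite /C0; ring.
    rewrite EFinM; apply: lee_wpmul2l; first by rewrite lee_fin powR_ge0.
    apply: nneseries_le_fin => [i|M]; first by apply: integral_ge0 => r _; exact: t0.
    apply: (@le_trans _ _ (\sum_(i < M) (rho ^+ i * (c `^ v * A `^ v))%:E)%E).
      apply: lee_sum => i _.
      rewrite ge0_integralZl//; last 3 first.
      - exact: (measurableT_comp mphiE (measurable_dilation (2 `^ i.+1%:R))).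
      - by move=> r _; rewrite lee_fin powR_ge0.
      - by rewrite lee_fin exprn_ge0.
      rewrite EFinM lee_wpmul2l ?lee_fin ?exprn_ge0//.
      rewrite (ge0_integral_dr_dilation (g := fun r => (phi r `^ v)%:E))//.
      by move=> r; rewrite lee_fin powR_ge0.
    rewrite sumEFin lee_fin -mulr_suml ler_wpM2r ?mulr_ge0 ?powR_ge0//.
    apply: le_trans (@geo_sum_le R rho 0 M _); last by rewrite rho0.
    by apply: ler_sum => i _ /=; rewrite subn0.
  apply: (@le_trans _ _ ((C0 * A `^ v)%:E `^ v^-1)%E).
    apply: gt0_ler_poweR => //; first by rewrite invr_ge0 ltW.
    - rewrite in_itv/= leey integral_ge0// => r _; exact: poweR_ge0.
    - by rewrite in_itv/= leey lee_fin mulr_ge0 ?powR_ge0// ltW.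
  rewrite poweR_EFin [X in X%:E]powRM ?powR_ge0 ?(ltW C00)// -powRrM mulfV ?gt_eqF//.
  by rewrite powRr1.
- exists (Cx * Cp); first exact: mulr_gt0.
  move=> N P A Nnd N0 P0 A0 HA HP; rewrite unlock dr_pos.
  apply/ess_supP; apply: nearW => r /=; rewrite patchE.
  have CA : 0 <= Cx * Cp * A by rewrite !mulr_ge0// ltW.
  case: (boolP (r \in J)) => [|_]; last by rewrite abse0 lee_fin.
  rewrite inE => Jr; have r0 := J_gt0 Jr.
  apply: wP => //; first exact: P0.
  rewrite -(mulrA Cx); apply: HP => //; first by rewrite mulr_ge0// ltW.
  move=> i; apply: (le_trans (HCp N A Nnd N0 A0 HA _ (Jdil i r Jr))).
  rewrite ler_peMl ?mulr_ge0 ?(ltW Cp0)//.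
  by rewrite -[leLHS](powRr0 2) ler_powR ?ler1n// mulr_ge0// ltW.
Qed.

End norm_transfer.

(** * Changing the function on a negligible set *)

Section ae_invariance.
Context {R : realType} {n : nat}.
Implicit Types (k : body) (f g : 'rV[R]_n -> R).
Local Notation mu := (lebesgue_rV n).

Lemma ae_eq_oscillation p G f g : {ae mu, forall x, f x = g x} ->
  oscillation p G f = oscillation p G g.
Proof.
move=> fg; rewrite /oscillation.
have -> : average G f = average G g.
  rewrite /average /Rintegral; congr (_ * fine _); apply: ae_eq_integral_any.
  by apply: filterS fg => x ->.
rewrite (@ae_eq_integral_any _ _ _ mu G _ (fun y => (`|g y - average G g| `^ p)%:E))//.
by apply: filterS fg => x ->.
Qed.

Lemma ae_eq_campanato_norm k p lam U f g : {ae mu, forall x, f x = g x} ->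
  campanato_norm k p lam U f = campanato_norm k p lam U g.
Proof.
suff H f' g' : {ae mu, forall x, f' x = g' x} ->
    (campanato_norm k p lam U f' <= campanato_norm k p lam U g')%E.
  move=> fg; apply: le_anti; apply/andP; split; apply: H => //.
  by apply: filterS fg => x ->.
move=> fg; apply: ereal_sup_le => z [c [s [s0 sU ->]]].
exists c, s; split; [exact: s0|exact: sU|].
by rewrite (ae_eq_oscillation p (Q k c s) fg).
Qed.

Lemma ae_eq_B_norm k J w u p lam f g : {ae mu, forall x, f x = g x} ->
  B_norm k J w u p lam f = B_norm k J w u p lam g.
Proof.
move=> fg; rewrite /B_norm.
have E : (fun r => campanato_norm k p lam (Q k 0 r) f) =
    (fun r => campanato_norm k p lam (Q k 0 r) g).
  by apply/funext => r; exact: ae_eq_campanato_norm.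
exact: (congr1 (fun h => Lnorm dr_over_r u ((fun r => (w r)%:E * h r)%E \_ J)) E).
Qed.

Lemma ae_eq_fractional_integral k alpha f g : {ae mu, forall x, f x = g x} ->
  fractional_integral k alpha f = fractional_integral k alpha g.
Proof.
move=> fg; apply/funext => x; rewrite /fractional_integral /Rintegral; congr fine.
by apply: ae_eq_integral_any; apply: filterS fg => y ->.
Qed.

Lemma ae_eq_fractional_integral_cvg k alpha f g : {ae mu, forall x, f x = g x} ->
  fractional_integral_cvg k alpha f = fractional_integral_cvg k alpha g.
Proof.
move=> fg; apply/funext => x; rewrite /fractional_integral_cvg.
rewrite (@ae_eq_integral_any _ _ _ mu setT _
  (fun y => `|g y * fractional_kernel k alpha x y|%:E))//.
by apply: filterS fg => y ->.
Qed.

End ae_invariance.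

(** For [p >= n / alpha] the exponent is lowered to some [p0 < n / alpha]; as [p0] tends to
[n / alpha] the bound on [q] tends to infinity. *)
Lemma sobolev_pair_exists (R : realType) (n : nat) (alpha p q : R) :
  (0 < n)%N -> 0 < alpha < 1 -> 1 <= q ->
  [\/ p = 1 /\ 1 <= q < n%:R / (n%:R - alpha),
      1 < p < n%:R / alpha /\ 1 <= q <= p * n%:R / (n%:R - p * alpha) |
      n%:R / alpha <= p /\ 1 <= q] ->
  exists p0, [/\ 1 <= p0, p0 <= p & @sobolev_pair R n alpha p0 q].
Proof.
move=> n0 /andP[a0 a1] q1 pq.
have n1 : 1 <= n%:R :> R by rewrite ler1n.
have nR : 0 < n%:R :> R by rewrite ltr0n.
have q0 : 0 < q by exact: lt_le_trans q1.
case: pq => [[-> /andP[_ qn]]|[/andP[p1 pn] /andP[_ qn]]|[np _]].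
- exists 1; split => //; split; first by rewrite mul1r; lra.
  left; split => //; move: qn; rewrite ltr_pdivlMr; last by lra.
  move=> qn; rewrite -(ltr_pM2r nR) mul1r.
  have -> : q * (1 - alpha / n%:R) * n%:R = q * (n%:R - alpha) by field; rewrite gt_eqF.
  by [].
- have pa : p * alpha < n%:R by rewrite -ltr_pdivlMr.
  exists p; split => //; first exact: ltW.
  split => //; right; split => //; move: qn; rewrite ler_pdivlMr; last by lra.
  move=> qn; rewrite -(ler_pM2r nR).
  have -> : q * (1 - p * alpha / n%:R) * n%:R = q * (n%:R - p * alpha) by field; rewrite gt_eqF.
  by [].
- pose nu := n%:R / alpha.
  have nu1 : 1 < nu by rewrite ltr_pdivlMr// mul1r; lra.
  (* The second entry makes [1 - p0 / nu <= 1 / (2 q)], the first keeps [1 < p0]. *)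
  pose p0 := Num.max ((1 + nu) / 2) (nu * (1 - (2 * q)^-1)).
  have p01 : 1 < p0 by rewrite lt_max; apply/orP; left; lra.
  have q2 : 0 < (2 * q)^-1 by rewrite invr_gt0 mulr_gt0.
  have p0n : p0 < nu.
    rewrite gt_max; apply/andP; split; first by lra.
    by rewrite gtr_pMr; lra.
  exists p0; split; [exact: ltW|exact: le_trans (ltW p0n) np|].
  split; first by rewrite -ltr_pdivlMr.
  right; split => //; apply: le_trans (ltW p01).
  have H : nu * (1 - (2 * q)^-1) <= p0 by rewrite le_max lexx orbT.
  have H2 : 1 - (2 * q)^-1 <= p0 * alpha / n%:R.
    have -> : p0 * alpha / n%:R = p0 / nu by rewrite /nu; field; rewrite !gt_eqF.
    by rewrite ler_pdivlMr 1?mulrC// (lt_trans ltr01).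
  have H3 : q * (1 - p0 * alpha / n%:R) <= q * (2 * q)^-1.
    by rewrite ler_wpM2l ?(ltW q0)//; lra.
  apply: (le_trans H3); rewrite invfM mulrCA mulfV ?gt_eqF//; lra.
Qed.

(** * Boundedness on the B spaces *)

Section boundedness.
Context {R : realType} {n : nat} (k : body) (alpha p q lam sigma : R) (u : \bar R)
  (J : set R) (w wt : R -> R) (c : R).
Hypotheses (n_gt0 : (0 < n)%N) (alpha01 : 0 < alpha < 1) (p1 : 1 <= p) (q1 : 1 <= q)
  (u_gt0 : (0 < u)%E) (sigma_gt0 : 0 < sigma) (sla : sigma + lam + alpha < 1).
Hypothesis sob : exists p0, [/\ 1 <= p0, p0 <= p & @sobolev_pair R n alpha p0 q].
Hypotheses (mJ : measurable J) (J_gt0 : forall r, J r -> 0 < r)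
  (J_up : forall r T, J r -> 1 <= T -> J (T * r)) (J1 : J 1).
Hypotheses (c_gt0 : 0 < c)
  (mwt : measurable_fun [set: R] wt)
  (w_wt : forall r, 0 < r -> 0 < w r <= wt r)
  (wt_w : forall r, 0 < r -> wt r <= c * w r)
  (wtT : forall r T, 0 < r -> 1 <= T -> wt r <= T `^ sigma * wt (T * r)).
Local Notation mu := (lebesgue_rV n).

(** The dyadic sums look at larger radii only, so that the range [J] of the radii may be
any set stable under dilations by [T >= 1]; both spaces are instances. *)
Lemma fractional_integral_bounded_of_weight :
  fractional_integral_bounded (n := n) k alpha J w u p lam q (lam + alpha).
Proof.
have [p0 [p01 p0p sp]] := sob.
have [C0 C00 HC0] := campanato_fractional_le n_gt0 lam alpha01 p1 q1 p01 p0p sp.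
have [C1 C10 HC1] := weighted_tail_sum sla.
have [C2 C20 HC2] := norm_pointwise J_gt0 J_up u_gt0 c_gt0 w_wt wt_w wtT sigma_gt0.
set d := (1 - (sigma + lam + alpha)) / 2 in HC1.
have d0 : 0 < d by rewrite divr_gt0// subr_gt0.
have [C3 C30 HC3] := norm_transfer mJ J_gt0 J_up u_gt0 c_gt0 mwt w_wt wt_w wtT
  sigma_gt0 d0 (mulr_gt0 C00 C10).
have wt_gt0 r : 0 < r -> 0 < wt r.
  by move=> /w_wt/andP[/lt_le_trans]; apply.
exists C3; first exact: C30.
move=> f [[g mg fg] camp_f fin_f].
rewrite (ae_eq_fractional_integral _ _ fg) (ae_eq_fractional_integral_cvg _ _ fg).
rewrite (ae_eq_B_norm _ _ _ _ _ _ fg) in fin_f *.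
have camp_g r : 0 < r -> (campanato_norm k p lam (Q k 0 r) g < +oo)%E.
  by move=> /camp_f; rewrite /campanato/= (ae_eq_campanato_norm _ _ _ _ fg).
move=> {camp_f fg f}.
pose N r := if 0 < r then fine (campanato_norm k p lam (Q k 0 r) g) else 0.
have NE r : 0 < r -> campanato_norm k p lam (Q k 0 r) g = (N r)%:E.
  by move=> r0; rewrite /N r0 fineK// ge0_fin_numE ?camp_g ?campanato_norm_ge0.
have N0 r : 0 <= N r.
  by rewrite /N; case: ifPn => // r0; rewrite fine_ge0// campanato_norm_ge0.
have Nnd : {homo N : r s / r <= s}.
  move=> r s rs; have [r0|r0] := ltP 0 r; last by rewrite {1}/N ltNge r0.
  have s0 := lt_le_trans r0 rs.
  by rewrite -lee_fin -!NE// le_campanato_norm//; exact: le_Q.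
have BE : B_norm k J w u p lam g = Lnorm dr_over_r u ((fun r => (w r)%:E * (N r)%:E)%E \_ J).
  congr (Lnorm _ _ _); apply/funext => r; rewrite !patchE.
  by case: ifPn => //; rewrite inE => /J_gt0 r0; rewrite NE.
pose A := fine (B_norm k J w u p lam g).
have AE : B_norm k J w u p lam g = A%:E.
  by rewrite fineK// ge0_fin_numE// Lnorm_ge0.
have A0 : 0 <= A by rewrite fine_ge0// Lnorm_ge0.
have NA : (Lnorm dr_over_r u ((fun r => (w r)%:E * (N r)%:E)%E \_ J) <= A%:E)%E.
  by rewrite -AE BE.
have tail r : J r -> forall M : nat, \sum_(i < M) 2 `^ (i%:R * (lam + alpha - 1)) *
    N (2 `^ i.+1%:R * r) <= C1 * (C2 * A) / wt r.
  move=> Jr; apply: HC1 => //; [exact: J_gt0|by rewrite mulr_ge0// ltW|] => i.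
  have Ji : J (2 `^ i.+1%:R * r).
    by apply: J_up => //; rewrite -[leLHS](powRr0 2) ler_powR ?ler1n.
  apply: (le_trans (HC2 N A Nnd N0 A0 NA _ Ji)).
  rewrite ler_peMl ?mulr_ge0 ?(ltW C20)//.
  by rewrite -[leLHS](powRr0 2) ler_powR ?ler1n// mulr_ge0// ltW.
have J_ge1 r : 1 <= r -> J r by move=> r1; rewrite -[r]mulr1; exact: J_up.
have cvg : {ae mu, forall x, fractional_integral_cvg k alpha g x}.
  apply: (fractional_cvg_ae_all (p := p) n_gt0 alpha01 p1 mg NE) => r r1.
  by exists (C1 * (C2 * A) / wt r); exact/tail/J_ge1.
set F := fractional_integral k alpha g.
have camp_le r W : 0 < r -> 0 <= W ->
    (forall M : nat, \sum_(i < M) 2 `^ (i%:R * (lam + alpha - 1)) *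
        N (2 `^ i.+1%:R * r) <= W) ->
    (campanato_norm k q (lam + alpha) (Q k 0 r) F <= (C0 * W)%:E)%E.
  by move=> r0 W0 HW; exact: (HC0 k g r W N).
have bound : (B_norm k J w u q (lam + alpha) F <= (C3 * A)%:E)%E.
  apply: (HC3 N (fun r => campanato_norm k q (lam + alpha) (Q k 0 r) F)) => //.
    by move=> r r0; exact: campanato_norm_ge0.
  move=> r b r0 b0 Hb.
  rewrite -!mulrA; apply: camp_le => //.
    by rewrite mulr_ge0 ?mulr_ge0 ?(ltW C10)// invr_ge0 ltW// wt_gt0.
  by move=> M; rewrite mulrA; exact: HC1.
split; [exact: cvg| |by rewrite AE -EFinM].
split; [|move=> r r0|exact: le_lt_trans bound (ltry _)].
  exists F; last exact: nearW.
  exact: measurable_fractional_integral.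
(* If [J] starts at 1, a small ball is contained in one of radius 1. *)
set r1 := Num.max 1 r.
have r11 : 1 <= r1 by rewrite le_max lexx.
have r10 : 0 < r1 by exact: lt_le_trans r11.
apply: (@le_lt_trans _ _ (campanato_norm k q (lam + alpha) (Q k 0 r1) F)).
  by apply: le_campanato_norm; apply: le_Q; rewrite le_max lexx orbT.
apply: le_lt_trans (camp_le _ _ r10 _ (tail _ (J_ge1 _ r11))) (ltry _).
by rewrite !mulr_ge0// ?invr_ge0 ltW// wt_gt0.
Qed.

End boundedness.

Theorem theorem5p15 (R : realType) (n : nat) (k : body)
    (alpha p q lambda mu sigma tau : R) (u : \bar R) (Theta : R -> R)
    (n_gt0 : (0 < n)%N)
    (alpha01 : 0 < alpha < 1)
    (p_ge1 : 1 <= p) (q_ge1 : 1 <= q)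
    (lambda_range : - n%:R / p <= lambda < 1)
    (mu_range : - n%:R / q <= mu < 1)
    (lambda_alpha : lambda + alpha = mu)
    (u_gt0 : (0 < u)%E)
    (Theta_in : Theta_star Theta)
    (sigma_gt0 : 0 < sigma) (tau_gt0 : 0 < tau) (tau_lt_sigma : tau < sigma)
    (sigma_lambda_alpha : sigma + lambda + alpha < 1)
    (pq : [\/ p = 1 /\ 1 <= q < n%:R / (n%:R - alpha),
              1 < p < n%:R / alpha /\ 1 <= q <= p * n%:R / (n%:R - p * alpha) |
              n%:R / alpha <= p /\ 1 <= q]) :
  let w := fun r : R => r `^ (- sigma) * Theta (r `^ tau) in
  fractional_integral_bounded (n := n) k alpha `[1, +oo[ w u p lambda q mu /\
  fractional_integral_bounded (n := n) k alpha `]0, +oo[ w u p lambda q mu.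

Proof.
move=> w; rewrite -lambda_alpha.
have [wt [c [c0 mwt wwt wtw wtT]]] := regular_weight sigma Theta_in tau_gt0.
have sob := sobolev_pair_exists n_gt0 alpha01 q_ge1 pq.
have H J := @fractional_integral_bounded_of_weight R n k alpha p q lambda sigma u J
  w wt c n_gt0 alpha01 p_ge1 q_ge1 u_gt0 sigma_gt0 sigma_lambda_alpha sob.
split; apply: (H _ _ _ _ _ c0 mwt wwt wtw wtT).
- exact: measurable_itv.
- by move=> r /=; rewrite in_itv/= andbT; exact: lt_le_trans.
- move=> r T /=; rewrite !in_itv/= !andbT => r1 T1.
  by rewrite (le_trans r1)// ler_peMl// (le_trans _ r1).
- by rewrite /= in_itv/= lexx.
- exact: measurable_itv.
- by move=> r /=; rewrite in_itv/= andbT.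
- move=> r T /=; rewrite !in_itv/= !andbT => r0 T1.
  by rewrite mulr_gt0// (lt_le_trans _ T1).
- by rewrite /= in_itv/= ltr01.
Qed.
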